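(* Let $\{X_i\}_{i\ge 1}$ be a sequence of $\chi$-valued random variables in which every $X_i$ has the same marginal density $m(x)=\int_{\Theta}p(x\mid\theta)f(\theta)\,d\mu(\theta)$ with respect to $\nu$, where the support $\Theta$ of the mixing density $f$ is a compact subset of a Euclidean space. Assume there are constants $c_0>0$ and $0<\rho<1$ such that for all $n\ge 1$ $$\sup_i E\Big[\int\Big(\frac{m(x_{i+n}\mid X_{1:i})}{m(x_{i+n})}-1\Big)^2 m(x_{i+n})\,d\nu(x_{i+n})\Big]\le c_0^2\rho^{2n}.$$ Assume that the initial estimate $f_0$ has the same support as $f$, and that conditions B1, B2$'$, B3, B4, C1, C2, C3 stated in the context hold. Let $f_n$ be the predictive recursion estimator defined in the context, and let $F_n$ and $F$ be the cumulative distribution functions associated with $f_n$ and $f$. Then, with probability one, $F_n$ converges to $F$ in the weak topology as $n\to\infty$.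
   Context: Setting. $\nu$ and $\mu$ are sigma-finite measures on the sample space $\chi$ and on the parameter space. $\widehat\Theta\supseteq\Theta$ is a closed convex set, and for each $\theta\in\widehat\Theta$, $p(\cdot\mid\theta)$ is a probability density on $\chi$ with respect to $\nu$ (the mixing kernel). $f$ is a density with respect to $\mu$. $X_{1:i}=\{X_1,\dots,X_i\}$, and $m(\cdot\mid X_{1:i})$ in the displayed condition is the conditional density of $X_{i+n}$ given $X_{1:i}$. Predictive recursion (PR). Starting from an initial mixing density $f_0$ and positive weights $w_i$, define for $i\ge1$ $$f_i(\theta)=(1-w_i)f_{i-1}(\theta)+w_i\frac{p(X_i\mid\theta)f_{i-1}(\theta)}{m_{i-1}(X_i)},\qquad m_{i-1}(x)=\int p(x\mid\theta)f_{i-1}(\theta)\,d\mu(\theta);$$ each iterate $f_i$ is a mixing (probability) density and $m_i$ is the corresponding marginal density. It is assumed that $K_0=\int f\log(f/f_0)\,d\mu$ and $K_0^*=\int m\log(m/m_0)\,d\nu$ are finite. Conditions. There are a finite set $\Theta_H\subset\widehat\Theta$ and a compact set $\chi_c\subset\chi$ such that: C1. For some constant $c_u>1$: for any $x\notin\chi_c$ there exist $\theta_1^x,\theta_2^x\in\Theta_H$ with $\sup_{\theta,\theta'\in\Theta}\frac{p(x\mid\theta)}{p(x\mid\theta')}\le c_u\frac{p(x\mid\theta_2^x)}{p(x\mid\theta_1^x)}$. C2. There is $a>0$ with $\inf_{x\in\chi_c,\theta\in\Theta}p(x\mid\theta)>a$. C3. There is $b<\infty$ with $\sup_{x\in\chi_c,\theta\in\Theta}p(x\mid\theta)<b$.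 B1. $w_i\downarrow0$ and $w_i\sim i^{-\alpha}$ with $\alpha\in(0.5,1]$. B2$'$. There is $b_3>0$ such that for every positive integer $j$, $\sup_{\theta_1,\theta_2,\theta_3\in\widehat\Theta}E_{\theta_3}\big[\big(\frac{p(X\mid\theta_1)}{p(X\mid\theta_2)}\big)^j\big]<b_3^j$, where $E_{\theta_3}$ is expectation under $X\sim p(\cdot\mid\theta_3)$. B3. $\sup_{\theta_1,\theta_2,\theta_3\in\widehat\Theta}E_{\theta_3}\big[\big(\frac{p(X\mid\theta_1)}{p(X\mid\theta_2)}\big)^2\big]<B<\infty$. B4. For each $x\in\chi$ the map $\theta\mapsto p(x\mid\theta)$ is bounded and continuous.
   Formalization: Added: F is identifiable, i.e. the only probability measure on Θ whose mixture equals m ν-a.e. (without this the claim fails, e.g. for constant p(x|θ)); and the weights satisfy 0 < w_i ≤ 1, so that every iterate f_i is a probability density. *)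

(* Defs.v *)
From HB Require Import structures.
From mathcomp Require Import all_boot all_order all_algebra.
From mathcomp Require Import all_classical all_reals all_analysis.

Set Implicit Arguments.
Unset Strict Implicit.
Unset Printing Implicit Defensive.

Import Order.TTheory GRing.Theory Num.Theory.
Import numFieldNormedType.Exports.

Local Open Scope classical_set_scope.
Local Open Scope ring_scope.

Notation borel T := (g_sigma_algebraType (@open T)).

Definition is_density {d} {T : measurableType d} {R : realType}
    (mu : {measure set T -> \bar R}) (g : T -> R) :=
  [/\ measurable_fun [set: T] g, forall t, 0 <= g t &
      (\int[mu]_t (g t)%:E = 1)%E].

(* Computed in \bar R, where c / 0 = +oo for c > 0, 0 / 0 = 0, lne 0 = -oo and
   0 * (-oo) = 0: the integrand is 0 where g = 0, and +oo where g > 0 = h. *)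
Definition kullback_leibler {d} {T : measurableType d} {R : realType}
    (mu : {measure set T -> \bar R}) (g h : T -> R) : \bar R :=
  (\int[mu]_t ((g t)%:E * lne ((g t)%:E / (h t)%:E)))%E.

Section mixture.
Context {R : realType} {k : nat} {chi : ptopologicalType}.
Implicit Types (nu : {measure set (borel chi) -> \bar R})
  (mu : {measure set (borel 'rV[R]_k) -> \bar R})
  (Theta : set 'rV[R]_k) (p : chi -> 'rV[R]_k -> R) (g : 'rV[R]_k -> R).

Definition mixture mu Theta p g (x : chi) : R :=
  \int[mu]_(t in Theta) (p x t * g t).

(* The distribution of the mixing density g, as a set function. *)
Definition mixing_dist mu g (A : set (borel 'rV[R]_k)) : \bar R :=
  (\int[mu]_(t in A) (g t)%:E)%E.

(* Among all Borel probability measures on Theta, with or without a density,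
   only the distribution of g has a mixture equal to that of g. *)
Definition identifiable nu mu Theta p g :=
  forall G : probability (borel 'rV[R]_k) R, G Theta = 1%E ->
    {ae nu, forall x, \int[G]_(t in Theta) p x t = mixture mu Theta p g x} ->
  forall A, measurable A -> G A = mixing_dist mu g A.

(* The ratio is extended-real: it is +oo, not 0, when only the denominator
   vanishes. *)
Definition lratio p x t1 t2 : \bar R := ((p x t1)%:E / (p x t2)%:E)%E.

Definition ratio_moment nu p (j : nat) t1 t2 t3 : \bar R :=
  (\int[nu]_x (lratio p x t1 t2 ^+ j * (p x t3)%:E))%E.

Definition sup_ratio_moment nu p (That : set 'rV[R]_k) (j : nat) : \bar R :=
  ereal_sup [set y | exists t1 t2 t3,
    [/\ That t1, That t2, That t3 & y = ratio_moment nu p j t1 t2 t3]].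

(* Weights and data are indexed from 1: w 0 and x 0 are not used. *)
Fixpoint pred_rec mu Theta p (w : nat -> R) (f0 : 'rV[R]_k -> R)
    (x : nat -> chi) (n : nat) : 'rV[R]_k -> R :=
  if n is n'.+1 then
    let f := pred_rec mu Theta p w f0 x n' in
    fun t => (1 - w n) * f t
             + w n * (p (x n) t * f t / mixture mu Theta p f (x n))
  else f0.

Definition weakly_cvg (Fn : nat -> set (borel 'rV[R]_k) -> \bar R)
    (F : set (borel 'rV[R]_k) -> \bar R) :=
  forall g : 'rV[R]_k -> R, continuous g -> [bounded g t | t in setT] ->
    (fun n => \int[Fn n]_t (g t)%:E)%E @ \oo --> (\int[F]_t (g t)%:E)%E.

End mixture.

Section dependence.
Context {R : realType} {d} {Omega : measurableType d} {chi : ptopologicalType}.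
Variables (P : probability Omega R) (nu : {measure set (borel chi) -> \bar R}).
Variable X : nat -> {mfun Omega >-> borel chi}.

(* X_{1:i} *)
Definition past (i : nat) (omega : Omega) : i.-tuple (borel chi) :=
  [tuple X j.+1 omega | j < i].

(* q y is the density with respect to nu of X_{i+n} given X_{1:i} = y *)
Definition is_cond_density (i n : nat)
    (q : i.-tuple (borel chi) -> borel chi -> R) :=
  [/\ measurable_fun setT (fun z : i.-tuple (borel chi) * borel chi => q z.1 z.2),
      forall y x, 0 <= q y x &
      forall A B, measurable A -> measurable B ->
        P (past i @^-1` A `&` X (i + n)%N @^-1` B) =
        (\int[P]_(omega in past i @^-1` A)
            \int[nu]_(x in B) (q (past i omega) x)%:E)%E].

Definition chi2_dependence (m : chi -> R) (i : nat)
    (q : i.-tuple (borel chi) -> borel chi -> R) : \bar R :=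
  (\int[P]_omega \int[nu]_x
      ((q (past i omega) x / m x - 1) ^+ 2 * m x)%:E)%E.

End dependence.

(* Main.v *)
Require Import Defs.
From HB Require Import structures.
From mathcomp Require Import all_boot all_order all_algebra.
From mathcomp Require Import all_classical all_reals all_analysis.
From mathcomp Require Import measurable_realfun.
From mathcomp Require Import ring lra zify.

Set Implicit Arguments.
Unset Strict Implicit.
Unset Printing Implicit Defensive.

Import Order.TTheory GRing.Theory Num.Theory.
Import numFieldNormedType.Exports.

Local Open Scope classical_set_scope.
Local Open Scope ring_scope.

(** The idea.  Write [m] for the mixture of [f], [Q] for the law [m * nu] of a
    single observation, and [f_n = f0 * h_n] for the iterates.  Relative to
    [kappa x t = p x t / m x] the recursion reads
    [h_n = h_(n-1) * (1 + w_n * (kappa X_n / M_(n-1) X_n - 1))], where [M_n] is the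
    integral of [kappa] against [f_n], that is, the mixture of [f_n] divided by [m].

    The bound on all moments of the likelihood ratios says that these ratios are
    bounded by [b3] almost everywhere ([ae_ratio_le], [ae_ratio_all]), so that
    [kappa] may be taken between two positive constants.  Two consequences: the
    functions [M_n] move by at most a multiple of [w_n] at each step, and the mean
    of [ln h_n] under the target [f] grows at step [n] by at least
    [w_n * (1 / M_(n-1) X_n - 1)], less a multiple of [w_n ^ 2] ([mean_ln_tilt]).
    That mean never exceeds the divergence of [f] from [f0]
    ([mean_ln_le_divergence]), so the weighted sum of the gains
    [1 / M_(n-1) X_n - 1] is bounded above along every data sequence ([sum_gain_le]).

    If [X_n] were independent of the past, the expected gain would be that of
    [T_(n-1)], where [T_n], the integral of [1 / M_n - 1] under [Q], is the
    chi-square divergence of [Q] from the mixture of [f_n].  The dependence condition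
    allows the replacement of [X_n] by an independent copy once the iterate is taken
    at an earlier time ([chi2_decoupling], [mean_chi2_le]).  A lag proportional to
    [ln n] makes the weighted sum of the errors finite ([power_weights_lag]): the
    weights are of order [n ^ -alpha] with [2 * alpha > 1].  Hence the sum of the
    [w_n * T_(n-1)] has finite expectation and is almost surely finite; as [T] varies
    slowly and the weights are not summable, [T_n] tends to [0]
    ([lipschitz_summable_cvg0], [ae_chi2_cvg0]).

    It remains to see that [T_n -> 0] implies weak convergence
    ([weakly_cvg_tilted]).  Along a subsequence on which [T_n] is summable, [M_n]
    tends to [1] almost everywhere, so every weak limit point of the iterates has the
    mixture [m]; there are limit points because [Theta] is compact
    ([ultra_weak_limit]), and by identifiability each of them is [f]. *)

(** * Bounded measurable functions *)

Definition bounded_mfun {d} {T : measurableType d} {R : realType}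
    (f : T -> R) :=
  measurable_fun [set: T] f /\ exists C, forall x, `|f x| <= C.

Section bounded_mfun_closure.
Context {d} {T : measurableType d} {R : realType}.
Implicit Types f g : T -> R.

Lemma ge0_measurable_funV (D : set T) f : (forall x, 0 <= f x) ->
  measurable_fun D f -> measurable_fun D (fun x => (f x)^-1).
Proof.
move=> f0 mf; under eq_fun do rewrite -powR_inv1//.
exact: (measurableT_comp (@measurable_powR R (-1))).
Qed.

Lemma bounded_mfun_itv f a b : measurable_fun setT f ->
  (forall x, a <= f x <= b) -> bounded_mfun f.
Proof.
move=> mf fab; split=> //; exists (`|a| + `|b|) => x.
have /andP[af fb] := fab x; rewrite ler_norml; apply/andP; split.
  by have := ler_norm (- a); rewrite normrN; have := normr_ge0 b; lra.
by have := ler_norm b; have := normr_ge0 a; lra.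
Qed.

Lemma bounded_mfun_cst (c : R) : bounded_mfun (fun _ : T => c).
Proof. by split=> //; exists `|c|. Qed.

Lemma bounded_mfunD f g : bounded_mfun f -> bounded_mfun g ->
  bounded_mfun (fun x => f x + g x).
Proof.
move=> [mf [C fC]] [mg [D gD]]; split; first exact: measurable_funD.
by exists (C + D) => x; rewrite (le_trans (ler_normD _ _))// lerD.
Qed.

Lemma bounded_mfunN f : bounded_mfun f -> bounded_mfun (fun x => - f x).
Proof.
move=> [mf [C fC]]; split; first exact: measurableT_comp.
by exists C => x; rewrite normrN.
Qed.

Lemma bounded_mfunB f g : bounded_mfun f -> bounded_mfun g ->
  bounded_mfun (fun x => f x - g x).
Proof. by move=> bf bg; apply: bounded_mfunD => //; apply: bounded_mfunN. Qed.

Lemma bounded_mfunM f g : bounded_mfun f -> bounded_mfun g ->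
  bounded_mfun (fun x => f x * g x).
Proof.
move=> [mf [C fC]] [mg [D gD]]; split; first exact: measurable_funM.
by exists (C * D) => x; rewrite normrM ler_pM.
Qed.

Lemma bounded_mfunV c f : 0 < c -> (forall x, c <= f x) ->
  bounded_mfun f -> bounded_mfun (fun x => (f x)^-1).
Proof.
move=> c0 cf [mf [C fC]].
apply: (@bounded_mfun_itv _ 0 c^-1); last first.
  move=> x; have fx0 : 0 < f x by exact: lt_le_trans c0 (cf x).
  by rewrite invr_ge0 ltW//= lef_pV2.
by apply: ge0_measurable_funV => // x; exact: le_trans (ltW c0) (cf x).
Qed.

Lemma bounded_mfun_ln c f : 0 < c -> (forall x, c <= f x) ->
  bounded_mfun f -> bounded_mfun (fun x => ln (f x)).
Proof.
move=> c0 cf [mf [C fC]].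
apply: (@bounded_mfun_itv _ (ln c) (ln C)); last first.
  move=> x; have fx0 : 0 < f x by exact: lt_le_trans c0 (cf x).
  have fxC : f x <= C by exact: le_trans (ler_norm _) (fC x).
  have C0 : 0 < C by exact: lt_le_trans fx0 fxC.
  by rewrite !ler_ln ?posrE// cf.
exact: (measurableT_comp (@measurable_ln R)).
Qed.

Lemma bounded_mfun_sum I (s : seq I) (F : I -> T -> R) :
  (forall i, bounded_mfun (F i)) ->
  bounded_mfun (fun x => \sum_(i <- s) F i x).
Proof.
move=> bF; elim: s => [|i s IH].
  by under eq_fun do rewrite big_nil; exact: bounded_mfun_cst.
by under eq_fun do rewrite big_cons; exact: bounded_mfunD.
Qed.

Lemma bounded_mfun_comp d' (T' : measurableType d') (h : T' -> T) f :
  measurable_fun setT h -> bounded_mfun f -> bounded_mfun (f \o h).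
Proof.
move=> mh [mf [C fC]]; split; first exact: measurableT_comp.
by exists C => x; exact: fC.
Qed.

End bounded_mfun_closure.

Section bounded_mfun_integral.
Context {d} {T : measurableType d} {R : realType} (P : probability T R).
Implicit Types f g : T -> R.

Lemma bounded_mfun_integrable f : bounded_mfun f ->
  P.-integrable setT (EFin \o f).
Proof.
move=> [mf [C fC]]; apply: measurable_bounded_integrable => //.
  by rewrite [X in (X < _)%E](probability_setT P) ltry.
exists C; split; first exact: num_real.
by move=> M CM x _; exact: le_trans (fC x) (ltW CM).
Qed.

Lemma bounded_mfun_EFin f : bounded_mfun f ->
  (\int[P]_x (f x)%:E = (\int[P]_x f x)%:E)%E.
Proof.
by move=> bf; rewrite /Rintegral fineK// integrable_fin_num//;
  exact: bounded_mfun_integrable.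
Qed.

Lemma mean_cst (c : R) : \int[P]_x c = c.
Proof. by rewrite Rintegral_cst// [X in fine X](probability_setT P) mulr1. Qed.

Lemma meanD f g : bounded_mfun f -> bounded_mfun g ->
  \int[P]_x (f x + g x) = \int[P]_x f x + \int[P]_x g x.
Proof. by move=> bf bg; apply: RintegralD => //; exact: bounded_mfun_integrable. Qed.

Lemma meanB f g : bounded_mfun f -> bounded_mfun g ->
  \int[P]_x (f x - g x) = \int[P]_x f x - \int[P]_x g x.
Proof. by move=> bf bg; apply: RintegralB => //; exact: bounded_mfun_integrable. Qed.

Lemma meanZl c f : bounded_mfun f -> \int[P]_x (c * f x) = c * \int[P]_x f x.
Proof. by move=> bf; apply: RintegralZl => //; exact: bounded_mfun_integrable. Qed.

Lemma meanZr c f : bounded_mfun f -> \int[P]_x (f x * c) = \int[P]_x f x * c.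
Proof. by move=> bf; apply: RintegralZr => //; exact: bounded_mfun_integrable. Qed.

Lemma le_mean f g : bounded_mfun f -> bounded_mfun g ->
  (forall x, f x <= g x) -> \int[P]_x f x <= \int[P]_x g x.
Proof.
by move=> bf bg fg; apply: le_Rintegral => //; exact: bounded_mfun_integrable.
Qed.

Lemma mean_sum I (s : seq I) (F : I -> T -> R) :
  (forall i, bounded_mfun (F i)) ->
  \int[P]_x (\sum_(i <- s) F i x) = \sum_(i <- s) \int[P]_x F i x.
Proof.
move=> bF; elim: s => [|i s IH].
  by under eq_Rintegral do rewrite big_nil; rewrite big_nil mean_cst.
under eq_Rintegral do rewrite big_cons.
by rewrite meanD ?IH ?big_cons//; exact: bounded_mfun_sum.
Qed.

Lemma mean_itv a b f : bounded_mfun f -> (forall x, a <= f x <= b) ->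
  a <= \int[P]_x f x <= b.
Proof.
move=> bf fab; rewrite -[X in X <= _ <= _]mean_cst -[X in _ <= _ <= X]mean_cst.
by apply/andP; split; apply: le_mean => //; try exact: bounded_mfun_cst;
  move=> x; have /andP[] := fab x.
Qed.

Lemma norm_mean_le c f : bounded_mfun f -> (forall x, `|f x| <= c) ->
  `|\int[P]_x f x| <= c.
Proof.
by move=> bf fc; rewrite ler_norml; apply: mean_itv => // x; rewrite -ler_norml.
Qed.

End bounded_mfun_integral.

Section bounded_mfun_fubini.
Context {d1 d2} {T1 : measurableType d1} {T2 : measurableType d2}
  {R : realType} (P2 : probability T2 R).
Implicit Types f : T1 * T2 -> R.

Lemma bounded_mfun_pairl f x : bounded_mfun f -> bounded_mfun (fun y => f (x, y)).
Proof.
move=> bf; apply: (@bounded_mfun_comp _ _ _ _ _ (fun y => (x, y))) => //.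
exact: measurable_fun_pair.
Qed.

Lemma bounded_mfun_pairr f y : bounded_mfun f -> bounded_mfun (fun x => f (x, y)).
Proof.
move=> bf; apply: (@bounded_mfun_comp _ _ _ _ _ (fun x => (x, y))) => //.
Qed.

Lemma bounded_mfun_mean2 f : bounded_mfun f ->
  bounded_mfun (fun x => \int[P2]_y f (x, y)).
Proof.
move=> bf; have [mf [C fC]] := bf; split; last first.
  exists C => x; apply: norm_mean_le => //; exact: bounded_mfun_pairl.
have bfC : bounded_mfun (fun z => f z + C).
  by apply: bounded_mfunD => //; exact: bounded_mfun_cst.
have -> : (fun x => \int[P2]_y f (x, y)) =
    (fun x => \int[P2]_y (f (x, y) + C) - C).
  apply/funext => x; rewrite meanD ?mean_cst ?addrK//.
    exact: bounded_mfun_pairl.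
  exact: bounded_mfun_cst.
apply: measurable_funB => //; apply: measurableT_comp => //.
apply: (@measurable_fun_fubini_tonelli_F _ _ _ _ _ P2
  (fun z => (f z + C)%:E)).
  by apply/measurable_EFinP; case: bfC.
move=> z; rewrite lee_fin; have := fC z; rewrite ler_norml => /andP[+ _]; lra.
Qed.

End bounded_mfun_fubini.

Section bounded_mfun_fubini_swap.
Context {d1 d2} {T1 : measurableType d1} {T2 : measurableType d2}
  {R : realType} (P1 : probability T1 R) (P2 : probability T2 R).
Implicit Types f : T1 * T2 -> R.

Lemma mean_swap f : bounded_mfun f ->
  \int[P1]_x \int[P2]_y f (x, y) = \int[P2]_y \int[P1]_x f (x, y).
Proof.
move=> bf.
have := @Fubini _ _ _ _ _ P1 P2 (EFin \o f)
  (bounded_mfun_integrable (P1 \x P2)%E bf).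
rewrite /Rintegral => /= FE; congr fine.
transitivity (\int[P1]_x \int[P2]_y (f (x, y))%:E)%E.
  apply: eq_integral => x _.
  by rewrite (bounded_mfun_EFin P2 (bounded_mfun_pairl x bf)).
rewrite FE; apply: eq_integral => y _.
by rewrite (bounded_mfun_EFin P1 (bounded_mfun_pairr y bf)).
Qed.

End bounded_mfun_fubini_swap.

(** * One step of the recursion, relative to the target *)

Section recursion_step.
Context {d1 d2} {S : measurableType d1} {T : measurableType d2} {R : realType}.
Variables (Q : probability S R) (F0 F : probability T R).
Variables (kappa : S -> T -> R) (b : R).

(** Densities are relative to [F0], and [kappa x t] stands for the density of [x]
    under [t] divided by its density under the target; [mix h] is then the mixture of
    [h] divided by the target, [tilt] is one step of the recursion, and
    [chi2_to_target h] is the chi-square divergence of the target from the mixture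
    of [h]. *)
Definition mix (h : T -> R) (x : S) : R := \int[F0]_t (kappa x t * h t).

Definition tilt (w : R) (h : T -> R) (x : S) (t : T) : R :=
  h t * (1 + w * (kappa x t / mix h x - 1)).

Definition chi2_to_target (h : T -> R) : R := \int[Q]_x ((mix h x)^-1 - 1).

Definition pos_density (h : T -> R) :=
  [/\ bounded_mfun h, exists2 c, 0 < c & forall t, c <= h t & \int[F0]_t h t = 1].

Hypothesis measurable_kappa : measurable_fun setT (fun z : S * T => kappa z.1 z.2).
Hypothesis b_ge1 : 1 <= b.
Hypothesis kappa_itv : forall x t, b^-1 <= kappa x t <= b.
Hypothesis kappa_Q : forall t, \int[Q]_x kappa x t = 1.
Hypothesis kappa_F : forall x, \int[F]_t kappa x t = 1.

Let b_gt0 : 0 < b. Proof. exact: lt_le_trans ltr01 b_ge1. Qed.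
Let kappa_gt0 x t : 0 < kappa x t.
Proof. by have /andP[+ _] := kappa_itv x t; apply: lt_le_trans; rewrite invr_gt0. Qed.

Let bounded_kappa : bounded_mfun (fun z : S * T => kappa z.1 z.2).
Proof. by apply: bounded_mfun_itv => // z; exact: kappa_itv. Qed.

Let bounded_kappal x : bounded_mfun (kappa x).
Proof. exact: (bounded_mfun_pairl x bounded_kappa). Qed.

Let bounded_kappar t : bounded_mfun (kappa ^~ t).
Proof. exact: (bounded_mfun_pairr t bounded_kappa). Qed.

Lemma pos_density1 : pos_density (fun=> 1).
Proof.
split; [exact: bounded_mfun_cst| by exists 1|exact: mean_cst].
Qed.

Section one_density.
Variable h : T -> R.
Hypothesis hh : pos_density h.

Let bh : bounded_mfun h. Proof. by have [] := hh. Qed.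
Let h_gt0 t : 0 < h t.
Proof. by have [_ [c c0 ch] _] := hh; exact: lt_le_trans (ch t). Qed.
Let h1 : \int[F0]_t h t = 1. Proof. by have [] := hh. Qed.

Let bkh x : bounded_mfun (fun t => kappa x t * h t).
Proof. exact: bounded_mfunM. Qed.

Lemma mix_itv x : b^-1 <= mix h x <= b.
Proof.
rewrite -[X in X <= _ <= _]mulr1 -[X in _ <= _ <= X]mulr1 -h1 /mix.
rewrite -!meanZl//; apply/andP; split; apply: le_mean => //;
  do ?[by apply: bounded_mfunM => //; exact: bounded_mfun_cst];
  by move=> t; rewrite ler_pM2r//; have /andP[] := kappa_itv x t.
Qed.

Lemma mix_gt0 x : 0 < mix h x.
Proof. by have /andP[+ _] := mix_itv x; apply: lt_le_trans; rewrite invr_gt0. Qed.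

Lemma bounded_mix : bounded_mfun (mix h).
Proof.
apply: (@bounded_mfun_mean2 _ _ _ _ _ F0 (fun z => kappa z.1 z.2 * h z.2)).
apply: bounded_mfunM => //.
exact: (@bounded_mfun_comp _ _ _ _ _ snd).
Qed.

Lemma invmix_itv x : b^-1 <= (mix h x)^-1 <= b.
Proof.
have /andP[l u] := mix_itv x; apply/andP; split.
  by rewrite lef_pV2 ?posrE// mix_gt0.
by rewrite -[leRHS]invrK lef_pV2 ?posrE ?invr_gt0// mix_gt0.
Qed.

Lemma bounded_invmix : bounded_mfun (fun x => (mix h x)^-1).
Proof.
apply: (@bounded_mfunV _ _ _ b^-1); [by rewrite invr_gt0| |exact: bounded_mix].
by move=> x; have /andP[] := mix_itv x.
Qed.

Lemma mean_mix : \int[Q]_x mix h x = 1.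
Proof.
rewrite /mix (@mean_swap _ _ _ _ _ Q F0 (fun z => kappa z.1 z.2 * h z.2)); last first.
  apply: bounded_mfunM => //.
  exact: (@bounded_mfun_comp _ _ _ _ _ snd).
rewrite -[RHS]h1; apply: eq_Rintegral => t _ /=.
by rewrite meanZr// kappa_Q mul1r.
Qed.

(** Expanding the square gives [(1 - M)^2 / M = M^-1 - 2 + M] for a mixture [M],
    and [M] integrates to [1]. *)
Lemma chi2_to_targetE :
  chi2_to_target h = \int[Q]_x ((1 - mix h x) ^+ 2 / mix h x).
Proof.
transitivity (\int[Q]_x ((mix h x)^-1 - 1) + \int[Q]_x (mix h x - 1)).
  rewrite [X in _ + X]meanB ?mean_mix ?mean_cst ?subrr ?addr0//.
    exact: bounded_mix.
  exact: bounded_mfun_cst.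
rewrite -meanD.
- by apply: eq_Rintegral => x _; field; rewrite gt_eqF// mix_gt0.
- apply: bounded_mfunB; [exact: bounded_invmix|exact: bounded_mfun_cst].
- apply: bounded_mfunB; [exact: bounded_mix|exact: bounded_mfun_cst].
Qed.

Lemma chi2_to_target_ge0 : 0 <= chi2_to_target h.
Proof.
rewrite chi2_to_targetE; apply: Rintegral_ge0 => x _.
by rewrite divr_ge0 ?sqr_ge0// ltW// mix_gt0.
Qed.

Lemma chi2_to_target_le : chi2_to_target h <= b.
Proof.
have : - 1 <= chi2_to_target h <= b; last by case/andP.
apply: mean_itv.
  by apply: bounded_mfunB; [exact: bounded_invmix|exact: bounded_mfun_cst].
move=> x; have /andP[l u] := invmix_itv x.
have : 0 < b^-1 by rewrite invr_gt0.
by lra.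
Qed.

Let ratio x t := kappa x t / mix h x.

Let ratio_itv x t : (b ^+ 2)^-1 <= ratio x t <= b ^+ 2.
Proof.
have /andP[l u] := invmix_itv x; have /andP[kl ku] := kappa_itv x t.
rewrite -exprVn !expr2 /ratio; apply/andP; split; apply: ler_pM => //.
- by rewrite invr_ge0 ltW.
- by rewrite invr_ge0 ltW.
- exact: ltW.
- by rewrite invr_ge0 ltW// mix_gt0.
Qed.

Let bratio x : bounded_mfun (ratio x).
Proof. by apply: bounded_mfunM => //; exact: bounded_mfun_cst. Qed.

Let mean_ratio x : \int[F0]_t (ratio x t * h t) = 1.
Proof.
transitivity (\int[F0]_t (kappa x t * h t * (mix h x)^-1)).
  by apply: eq_Rintegral => t _; rewrite /ratio mulrAC.
by rewrite meanZr// -/(mix h x) divff// gt_eqF// mix_gt0.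
Qed.

Section weight.
Variable w : R.
Hypothesis w01 : 0 <= w <= 1.

Let factor x t := 1 + w * (ratio x t - 1).

Let factor_itv x t : (b ^+ 2)^-1 <= factor x t <= b ^+ 2.
Proof.
have /andP[l u] := ratio_itv x t; have /andP[w0 w1] := w01.
have b2 : 1 <= b ^+ 2 by rewrite exprn_ege1.
have b2' : (b ^+ 2)^-1 <= 1 by rewrite invf_le1// (lt_le_trans ltr01).
by rewrite /factor; apply/andP; split; nra.
Qed.

Let bfactor x : bounded_mfun (factor x).
Proof.
apply: bounded_mfunD; first exact: bounded_mfun_cst.
apply: bounded_mfunM; first exact: bounded_mfun_cst.
by apply: bounded_mfunB => //; exact: bounded_mfun_cst.
Qed.

Lemma tilt_pos_density x : pos_density (tilt w h x).
Proof.
split.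
- exact: (bounded_mfunM bh (bfactor x)).
- have [_ [c c0 ch] _] := hh; exists (c * (b ^+ 2)^-1).
    by rewrite mulr_gt0// invr_gt0 exprn_gt0.
  move=> t; apply: ler_pM => //; first exact: ltW.
    by rewrite invr_ge0 exprn_ge0// ltW.
  by have /andP[] := factor_itv x t.
- transitivity (\int[F0]_t ((1 - w) * h t + w * (ratio x t * h t))).
    by apply: eq_Rintegral => t _; rewrite /tilt -/(ratio x t); ring.
  have brh : bounded_mfun (fun t => ratio x t * h t) by exact: bounded_mfunM.
  rewrite meanD ?meanZl ?h1 ?mean_ratio//; first by ring.
  + by apply: bounded_mfunM => //; exact: bounded_mfun_cst.
  + by apply: bounded_mfunM => //; exact: bounded_mfun_cst.
Qed.

Lemma mix_tilt_lipschitz x y : `|mix (tilt w h x) y - mix h y| <= w * b.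
Proof.
have brh : bounded_mfun (fun t => ratio x t * h t) by exact: bounded_mfunM.
have bkrh : bounded_mfun (fun t => kappa y t * (ratio x t * h t)).
  exact: bounded_mfunM.
have -> : mix (tilt w h x) y - mix h y =
    w * (\int[F0]_t (kappa y t * (ratio x t * h t)) - mix h y).
  rewrite /mix -[X in _ = _ * X]meanB// -meanZl; last exact: bounded_mfunB.
  rewrite -meanB//; last first.
    by apply: bounded_mfunM => //; have [] := tilt_pos_density x.
  by apply: eq_Rintegral => t _; rewrite /tilt -/(ratio x t); ring.
have /andP[w0 _] := w01; rewrite normrM (ger0_norm w0) ler_wpM2l//.
suff : 0 <= \int[F0]_t (kappa y t * (ratio x t * h t)) <= b.
  have := mix_gt0 y; have /andP[_] := mix_itv y.
  by move=> ? ? /andP[? ?]; rewrite ler_norml; apply/andP; split; lra.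
have r0 t : 0 <= ratio x t by rewrite divr_ge0// ltW// mix_gt0.
apply/andP; split.
  apply: Rintegral_ge0 => t _; apply: mulr_ge0; first exact: ltW.
  by apply: mulr_ge0 => //; exact: ltW.
rewrite -[leRHS]mulr1 -(mean_ratio x) -meanZl//; apply: le_mean => //.
  by apply: bounded_mfunM => //; exact: bounded_mfun_cst.
move=> t; apply: ler_wpM2r; first by apply: mulr_ge0 => //; exact: ltW.
by have /andP[] := kappa_itv y t.
Qed.

(** The gain in the mean of the log density under the target [F] is, to first order
    in the weight, [w * (1 / mix h x - 1)], because [kappa x] integrates to [1]
    under [F]; the second order term comes from [ln y >= 1 - 1 / y]. *)
Lemma mean_ln_tilt x :
  \int[F]_t ln (h t) + w * ((mix h x)^-1 - 1) - b ^+ 6 * w ^+ 2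
    <= \int[F]_t ln (tilt w h x t).
Proof.
have [_ [c c0 ch] _] := hh.
have b2_gt0 : 0 < (b ^+ 2)^-1 by rewrite invr_gt0 exprn_gt0.
have f0 t : 0 < factor x t.
  by have /andP[+ _] := factor_itv x t; apply: lt_le_trans.
have blnh : bounded_mfun (fun t => ln (h t)) by exact: (bounded_mfun_ln c0).
have blnf : bounded_mfun (fun t => ln (factor x t)).
  by apply: (bounded_mfun_ln b2_gt0) => // t; have /andP[] := factor_itv x t.
have -> : \int[F]_t ln (tilt w h x t) =
    \int[F]_t ln (h t) + \int[F]_t ln (factor x t).
  rewrite -meanD//; apply: eq_Rintegral => t _.
  by rewrite /tilt -/(ratio x t) -/(factor x t) lnM ?posrE.
rewrite -addrA lerD2l.
have -> : w * ((mix h x)^-1 - 1) - b ^+ 6 * w ^+ 2 =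
    \int[F]_t (w * (kappa x t * (mix h x)^-1 - 1) - b ^+ 6 * w ^+ 2).
  have bu : bounded_mfun (fun t => kappa x t * (mix h x)^-1) by exact: bratio.
  rewrite meanB ?meanZl ?meanB ?meanZr ?kappa_F ?mean_cst ?mul1r//;
    by do ?[exact: bounded_mfun_cst|exact: bu|apply: bounded_mfunB
           |apply: bounded_mfunM].
apply: le_mean => //.
  apply: bounded_mfunB; last exact: bounded_mfun_cst.
  apply: bounded_mfunM; first exact: bounded_mfun_cst.
  by apply: bounded_mfunB; [exact: bratio|exact: bounded_mfun_cst].
move=> t; rewrite -/(ratio x t).
have /andP[rl ru] := ratio_itv x t.
(* [z ^ 2 / (1 + z)] is at most [b ^ 4 * w ^ 2] times [b ^ 2] *)
set z := w * (ratio x t - 1).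
have zE : factor x t = 1 + z by [].
have z2 : z ^+ 2 <= b ^+ 4 * w ^+ 2.
  rewrite /z exprMn mulrC ler_wpM2r ?sqr_ge0//.
  have -> : b ^+ 4 = (b ^+ 2) ^+ 2 by rewrite -exprM.
  rewrite -ler_sqrt ?sqr_ge0// !sqrtr_sqr.
  rewrite [leRHS]ger0_norm ?exprn_ge0 ?(ltW b_gt0)//.
  have b2 : 1 <= b ^+ 2 by rewrite exprn_ege1.
  by rewrite ler_norml; apply/andP; split; lra.
have z1_gt0 : 0 < 1 + z by rewrite -zE.
have z1V : (1 + z)^-1 <= b ^+ 2.
  rewrite -[leRHS]invrK lef_pV2 ?posrE// -zE.
  by have /andP[] := factor_itv x t.
apply: (@le_trans _ _ (1 - (1 + z)^-1)).
  have -> : 1 - (1 + z)^-1 = z - z ^+ 2 * (1 + z)^-1.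
    by field; rewrite gt_eqF.
  rewrite lerD2l lerN2.
  have -> : b ^+ 6 * w ^+ 2 = b ^+ 4 * w ^+ 2 * b ^+ 2 by ring.
  by rewrite ler_pM// ?sqr_ge0// invr_ge0 ltW.
(* [ln y <= y - 1] at [y = (1 + z)^-1] *)
rewrite zE; have := @le_ln1Dx R ((1 + z)^-1 - 1).
have -> : 1 + ((1 + z)^-1 - 1) = (1 + z)^-1 by ring.
rewrite lnV ?posrE//.
have : 0 < (1 + z)^-1 by rewrite invr_gt0.
move=> H1 /(_ _); lra.
Qed.

End weight.
End one_density.

Lemma invmix_lipschitz h h' e x : pos_density h -> pos_density h' ->
  `|mix h' x - mix h x| <= e -> `|(mix h' x)^-1 - (mix h x)^-1| <= b ^+ 2 * e.
Proof.
move=> hh hh' he.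
have -> : (mix h' x)^-1 - (mix h x)^-1 =
    ((mix h' x)^-1 * (mix h x)^-1) * (mix h x - mix h' x).
  by field; rewrite !gt_eqF//; exact: mix_gt0.
rewrite normrM; apply: ler_pM => //; last by rewrite distrC.
rewrite normrM expr2; apply: ler_pM => //.
- have /andP[l u] := invmix_itv hh' x.
  by rewrite ger0_norm// invr_ge0 ltW// mix_gt0.
- have /andP[l u] := invmix_itv hh x.
  by rewrite ger0_norm// invr_ge0 ltW// mix_gt0.
Qed.

Lemma chi2_to_target_lipschitz h h' e : pos_density h -> pos_density h' ->
  (forall x, `|mix h' x - mix h x| <= e) ->
  `|chi2_to_target h' - chi2_to_target h| <= b ^+ 2 * e.
Proof.
move=> hh hh' he; rewrite /chi2_to_target -meanB; last first.
- by apply: bounded_mfunB; [exact: bounded_invmix|exact: bounded_mfun_cst].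
- by apply: bounded_mfunB; [exact: bounded_invmix|exact: bounded_mfun_cst].
apply: norm_mean_le.
  by apply: bounded_mfunB; apply: bounded_mfunB;
    try exact: bounded_invmix; exact: bounded_mfun_cst.
move=> x; rewrite opprB addrA subrK; exact: invmix_lipschitz.
Qed.

End recursion_step.

(** * Series of nonnegative terms *)

Section nonneg_series.
Context {R : realType}.

Lemma is_cvg_telescoping (u : nat -> R) C :
  (forall n, \sum_(0 <= i < n) `|u i.+1 - u i| <= C) -> cvgn u.
Proof.
move=> uC.
have cv : cvgn (series (telescope u)).
  apply: normed_cvg; apply: nondecreasing_is_cvgn.
    by apply: nondecreasing_series => *; exact: normr_ge0.
  by exists C => _ [n _ <-]; exact: uC.
have -> : u = (fun n => u 0%N + series (telescope u) n).
  by apply/funext => n; rewrite [LHS]eq_sum_telescope.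
by apply: is_cvgD => //; exact: is_cvg_cst.
Qed.

(** A discrete Barbalat lemma: read [v] as time increments; then [t] is Lipschitz
    and integrable over an infinite time span.  The squares of [t] have summable
    increments, since [|t i.+1 ^ 2 - t i ^ 2| <= c * v i * (2 * t i + c * v i)],
    so they converge, and only [0] is a possible limit. *)
Lemma lipschitz_summable_cvg0 (t v : nat -> R) c C C' :
  0 <= c -> (forall i, 0 <= t i) -> (forall i, 0 <= v i) ->
  (forall i, `|t i.+1 - t i| <= c * v i) ->
  (forall n, \sum_(0 <= i < n) v i * t i <= C) ->
  (forall n, \sum_(0 <= i < n) v i ^+ 2 <= C') ->
  (forall A, exists n, A <= \sum_(0 <= i < n) v i) ->
  t @ \oo --> 0.
Proof.
move=> c0 t0 v0 tv vtC v2C vy.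
have cvu : cvgn (fun n => t n ^+ 2).
  apply: (@is_cvg_telescoping _ (2 * c * C + c ^+ 2 * C')) => n.
  apply: (@le_trans _ _ (\sum_(0 <= i < n)
      (2 * c * (v i * t i) + c ^+ 2 * v i ^+ 2))).
    apply: ler_sum => i _; rewrite subr_sqr normrM.
    have := tv i; rewrite ler_norml => /andP[l1 l2].
    have ti := t0 i; have tSi := t0 i.+1; have vi := v0 i.
    have cv : 0 <= c * v i by rewrite mulr_ge0.
    rewrite [X in _ * X]ger0_norm ?addr_ge0//.
    apply: (@le_trans _ _ (c * v i * (2 * t i + c * v i))).
      by apply: ler_pM => //; [exact: addr_ge0|lra].
    by rewrite le_eqVlt; apply/orP; left; apply/eqP; ring.
  rewrite big_split/= -!mulr_sumr; apply: lerD.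
    by rewrite ler_wpM2l// mulr_ge0.
  by rewrite ler_wpM2l// sqr_ge0.
set l := limn (fun n => t n ^+ 2).
have l0 : 0 <= l by apply: limr_ge => //; near=> n; exact: sqr_ge0.
suff l_eq0 : l = 0.
  have : (fun n => Num.sqrt (t n ^+ 2)) @ \oo --> Num.sqrt 0.
    apply: (cvg_comp (fun n => t n ^+ 2) Num.sqrt); last exact: sqrt_continuous.
    by rewrite -l_eq0; exact: cvu.
  by rewrite sqrtr0; under eq_fun do rewrite sqrtr_sqr ger0_norm//.
apply/eqP; rewrite eq_le l0 andbT leNgt; apply/negP => lpos.
pose s := Num.sqrt (l / 2).
have s0 : 0 < s by rewrite sqrtr_gt0 divr_gt0.
have [N _ Ns] : \forall n \near \oo, s <= t n.
  have : \forall n \near \oo, l / 2 < t n ^+ 2.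
    apply: (cvgr_gt l) => //; lra.
  apply: filterS => n ln; rewrite -[leRHS]ger0_norm// -sqrtr_sqr.
  by rewrite ler_wsqrtr// ltW.
(* total weight that would force the weighted sum of [t] above [C] *)
have [n] := vy ((C + s * \sum_(0 <= i < N) v i + 1) / s).
rewrite ler_pdivrMr// mulrC => An.
suff : s * \sum_(0 <= i < n) v i <= C + s * \sum_(0 <= i < N) v i by lra.
have vtn0 m : 0 <= \sum_(0 <= i < m) v i * t i.
  by apply: sumr_ge0 => i _; rewrite mulr_ge0.
have C0 : 0 <= C by exact: le_trans (vtn0 0%N) (vtC 0%N).
have [nN|Nn] := leqP n N.
  apply: (@le_trans _ _ (s * \sum_(0 <= i < N) v i)); last by lra.
  rewrite ler_wpM2l ?(ltW s0)// (big_cat_nat _ nN)//= lerDl.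
  exact: sumr_ge0.
rewrite (big_cat_nat _ (ltnW Nn))//= mulrDr addrC lerD2r.
apply: le_trans (vtC n); rewrite [leRHS](big_cat_nat _ (ltnW Nn))//=.
rewrite mulr_sumr -[leLHS]add0r; apply: lerD => //.
rewrite !big_nat; apply: ler_sum => i /andP[Ni _].
by rewrite mulrC ler_wpM2l//; exact: Ns.
Unshelve. all: by end_near. Qed.

(** The sum of the series has finite expectation, by monotone convergence. *)
Lemma ae_bounded_series {d} {T : measurableType d} (P : probability T R)
  (u : nat -> T -> R) C : (forall i, bounded_mfun (u i)) ->
  (forall i x, 0 <= u i x) ->
  (forall n, \sum_(0 <= i < n) \int[P]_x u i x <= C) ->
  {ae P, forall x, exists C, forall n, \sum_(0 <= i < n) u i x <= C}.
Proof.
move=> bu u0 uC.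
have mu i : measurable_fun [set: T] (fun x => (u i x)%:E).
  by apply/measurable_EFinP; case: (bu i).
pose S x := (\sum_(0 <= i <oo) (u i x)%:E)%E.
have u0' i x : setT x -> (0 <= (u i x)%:E)%E by rewrite lee_fin.
have iS : P.-integrable setT S.
  apply/integrableP; split.
    apply: (emeasurable_fun_cvg (fun n x => \sum_(0 <= i < n) (u i x)%:E)%E).
      by move=> n; exact: emeasurable_sum.
    by move=> x _; apply: is_cvg_nneseries => n _ _; exact: u0'.
  under eq_integral.
    move=> x _; rewrite gee0_abs; last first.
      by apply: nneseries_ge0 => n _ _; exact: u0'.
    over.
  rewrite integral_nneseries//; apply: (@le_lt_trans _ _ C%:E); last by rewrite ltry.
  apply: lime_le.
    by apply: is_cvg_nneseries => n _ _; apply: integral_ge0 => x _; exact: u0'.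
  near=> n; rewrite /= (eq_bigr (fun i => (\int[P]_x u i x)%:E)) ?sumEFin ?lee_fin//.
  by move=> i _; rewrite -bounded_mfun_EFin.
have := integrable_ae measurableT iS; apply: filterS => x /(_ I) Sx.
exists (fine (S x)) => n; rewrite -lee_fin fineK// -sumEFin.
by apply: nneseries_lim_ge => i _ _; exact: u0'.
Unshelve. all: by end_near. Qed.

End nonneg_series.

(** * The recursion along a weakly dependent sequence *)

Section recursion.
Context {d1 d2} {S : measurableType d1} {T : measurableType d2} {R : realType}.
Variables (Q : probability S R) (F0 F : probability T R).
Variables (kappa : S -> T -> R) (b : R) (w : nat -> R).

Fixpoint tilts (x : nat -> S) (n : nat) : T -> R :=
  if n is n'.+1 then tilt F0 kappa (w n) (tilts x n') (x n) else fun=> 1.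

Hypothesis measurable_kappa : measurable_fun setT (fun z : S * T => kappa z.1 z.2).
Hypothesis b_ge1 : 1 <= b.
Hypothesis kappa_itv : forall x t, b^-1 <= kappa x t <= b.
Hypothesis kappa_Q : forall t, \int[Q]_x kappa x t = 1.
Hypothesis kappa_F : forall x, \int[F]_t kappa x t = 1.
Hypothesis w01 : forall i, 0 <= w i.+1 <= 1.

Let b_gt0 : 0 < b. Proof. exact: lt_le_trans ltr01 b_ge1. Qed.
Let b_ge0 : 0 <= b. Proof. exact: ltW. Qed.
Let w_ge0 i : 0 <= w i.+1. Proof. by have /andP[] := w01 i. Qed.

Notation M x n := (mix F0 kappa (tilts x n)).
Notation chi2 x n := (chi2_to_target Q F0 kappa (tilts x n)).
Notation pos_density := (pos_density F0).

Lemma tilts_pos_density x n : pos_density (tilts x n).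
Proof.
elim: n => [|n IH]; first exact: pos_density1.
exact: (tilt_pos_density measurable_kappa b_ge1).
Qed.

Lemma eq_tilts x x' n : (forall i, (i < n)%N -> x i.+1 = x' i.+1) ->
  tilts x n = tilts x' n.
Proof.
elim: n => // n IH xx' /=; rewrite IH ?xx'// => i ni; apply: xx'.
exact: leqW.
Qed.

Lemma mix_drift x m n y : (m <= n)%N ->
  `|M x n y - M x m y| <= b * \sum_(m <= i < n) w i.+1.
Proof.
elim: n => [|n IH]; first by rewrite leqn0 => /eqP ->; rewrite subrr normr0 big_nil mulr0.
rewrite leq_eqVlt => /predU1P[->|mn]; first by rewrite subrr normr0 big_geq// mulr0.
rewrite big_nat_recr//= [leRHS]mulrDr [leRHS]addrC [X in _ <= X + _]mulrC.
rewrite -(subrKA (M x n y)); apply: (le_trans (ler_normD _ _)); apply: lerD.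
  exact: (mix_tilt_lipschitz measurable_kappa b_ge1 kappa_itv
    (tilts_pos_density x n) (w01 n)).
exact: IH.
Qed.

Lemma invmix_drift x m n y : (m <= n)%N ->
  `|(M x n y)^-1 - (M x m y)^-1| <= b ^+ 3 * \sum_(m <= i < n) w i.+1.
Proof.
move=> mn; rewrite exprSr -mulrA.
apply: (invmix_lipschitz measurable_kappa b_ge1 kappa_itv);
  [exact: tilts_pos_density|exact: tilts_pos_density|exact: mix_drift].
Qed.

Lemma chi2_drift x m n : (m <= n)%N ->
  `|chi2 x n - chi2 x m| <= b ^+ 3 * \sum_(m <= i < n) w i.+1.
Proof.
move=> mn; rewrite exprSr -mulrA.
apply: (chi2_to_target_lipschitz Q measurable_kappa b_ge1 kappa_itv);
  [exact: tilts_pos_density|exact: tilts_pos_density|].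
by move=> y; exact: mix_drift.
Qed.

(** Along every data sequence the mean of the log densities of the iterates stays
    bounded above as soon as [F] has finite divergence from [F0], which limits the
    total first order gain. *)
Lemma sum_gain_le K x n :
  (forall h, pos_density h -> \int[F]_t ln (h t) <= K) ->
  \sum_(0 <= i < n) w i.+1 * ((M x i (x i.+1))^-1 - 1)
    <= K + b ^+ 6 * \sum_(0 <= i < n) w i.+1 ^+ 2.
Proof.
move=> hK; have := hK _ (tilts_pos_density x n).
suff : \sum_(0 <= i < n) w i.+1 * ((M x i (x i.+1))^-1 - 1)
    - b ^+ 6 * \sum_(0 <= i < n) w i.+1 ^+ 2 <= \int[F]_t ln (tilts x n t) by lra.
elim: n => [|n IH].
  by rewrite !big_nil mulr0 subr0 /= ln1 mean_cst.
rewrite !big_nat_recr//= [b ^+ 6 * _]mulrDr.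
have := mean_ln_tilt measurable_kappa b_ge1 kappa_itv kappa_F
  (tilts_pos_density x n) (w01 n) (x n.+1).
move: IH; set A := \sum_(_ <= _ < _) _; set B := \sum_(_ <= _ < _) _.
set g := w n.+1 * _; set c := b ^+ 6 * w n.+1 ^+ 2; lra.
Qed.

Section measurability.
Context {d} {Z : measurableType d} (xi : nat -> Z -> S).
Hypothesis mxi : forall i, measurable_fun setT (xi i).

Lemma bounded_mfun_tilts n :
  bounded_mfun (fun z : Z * T => tilts (xi ^~ z.1) n z.2) /\
  bounded_mfun (fun z : Z * S => M (xi ^~ z.1) n z.2).
Proof.
have bk : bounded_mfun (fun z : S * T => kappa z.1 z.2).
  by apply: bounded_mfun_itv => // z; exact: kappa_itv.
have mixP m : bounded_mfun (fun z : Z * T => tilts (xi ^~ z.1) m z.2) ->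
    bounded_mfun (fun z : Z * S => M (xi ^~ z.1) m z.2).
  move=> bh.
  apply: (@bounded_mfun_mean2 _ _ _ _ _ F0
    (fun u => kappa u.1.2 u.2 * tilts (xi ^~ u.1.1) m u.2)).
  apply: bounded_mfunM.
    apply: (@bounded_mfun_comp _ _ _ _ _ (fun u : Z * S * T => (u.1.2, u.2)) _ _ bk).
    apply/measurable_fun_pair => //.
    exact: (measurableT_comp measurable_snd measurable_fst).
  apply: (@bounded_mfun_comp _ _ _ _ _ (fun u : Z * S * T => (u.1.1, u.2)) _ _ bh).
  apply/measurable_fun_pair => //.
  exact: (measurableT_comp measurable_fst measurable_fst).
suff bh : bounded_mfun (fun z : Z * T => tilts (xi ^~ z.1) n z.2).
  by split => //; exact: mixP.
elim: n => [|n IH]; first exact: bounded_mfun_cst.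
have mxiS : measurable_fun setT (fun z : Z * T => xi n.+1 z.1).
  exact: (measurableT_comp (mxi n.+1) measurable_fst).
rewrite /= /tilt; apply: bounded_mfunM => //.
apply: bounded_mfunD; first exact: bounded_mfun_cst.
apply: bounded_mfunM; first exact: bounded_mfun_cst.
apply: bounded_mfunB; last exact: bounded_mfun_cst.
apply: bounded_mfunM.
  apply: (@bounded_mfun_comp _ _ _ _ _ (fun z : Z * T => (xi n.+1 z.1, z.2)) _ _ bk).
  exact/measurable_fun_pair.
apply: (@bounded_mfunV _ _ _ b^-1); first by rewrite invr_gt0.
  move=> z; have /andP[] // := mix_itv measurable_kappa kappa_itv
    (tilts_pos_density (xi ^~ z.1) n) (xi n.+1 z.1).
apply: (@bounded_mfun_comp _ _ _ _ _ (fun z : Z * T => (z.1, xi n.+1 z.1)) _ _ (mixP _ IH)).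
exact/measurable_fun_pair.
Qed.

Lemma bounded_mfun_invmix n :
  bounded_mfun (fun z : Z * S => (M (xi ^~ z.1) n z.2)^-1).
Proof.
apply: (@bounded_mfunV _ _ _ b^-1); first by rewrite invr_gt0.
  move=> z; have /andP[] // := mix_itv measurable_kappa kappa_itv
    (tilts_pos_density (xi ^~ z.1) n) z.2.
by have [] := bounded_mfun_tilts n.
Qed.

Lemma bounded_mfun_chi2 n : bounded_mfun (fun z => chi2 (xi ^~ z) n).
Proof.
apply: (@bounded_mfun_mean2 _ _ _ _ _ Q (fun z => (M (xi ^~ z.1) n z.2)^-1 - 1)).
by apply: bounded_mfunB; [exact: bounded_mfun_invmix|exact: bounded_mfun_cst].
Qed.

End measurability.

Section dependent_data.
Context {d} {Omega : measurableType d} (P : probability Omega R).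
Variables (X : nat -> Omega -> S) (eps : nat -> R) (K C1 C2 : R).
Variables (lag : nat -> nat) (i0 : nat).
Hypothesis mX : forall i, measurable_fun setT (X i).
Hypothesis eps_ge0 : forall n, 0 <= eps n.
Hypothesis mixing : forall j n (Phi : j.-tuple S * S -> R) C,
  (1 <= j)%N -> (1 <= n)%N -> measurable_fun setT Phi ->
  (forall z, 0 <= Phi z <= C) ->
  \int[P]_o \int[Q]_y Phi ([tuple X i.+1 o | i < j], y) - C * eps n
    <= \int[P]_o Phi ([tuple X i.+1 o | i < j], X (j + n)%N o).
Hypothesis finite_divergence :
  forall h, pos_density h -> \int[F]_t ln (h t) <= K.
Hypothesis lag_itv : forall i, (i0 <= i)%N -> (1 <= lag i <= i)%N.
Hypothesis sum_w2 : forall n, \sum_(0 <= i < n) w i.+1 ^+ 2 <= C1.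
Hypothesis sum_lag : forall n, \sum_(i0 <= i < n)
  w i.+1 * (\sum_(i.+1 - lag i <= s < i) w s.+1 + eps (lag i)) <= C2.
Hypothesis sum_w : forall A, exists n, A <= \sum_(0 <= i < n) w i.+1.

Let x_ o i := X i o.

(** Decoupling.  The distance of the iterate [i] to the target is nearly that of
    the earlier iterate [i.+1 - lag i], whose expected distance is a gain at an
    observation that is almost independent of it. *)
Lemma mean_chi2_le i : (i0 <= i)%N ->
  \int[P]_o chi2 (x_ o) i
    <= \int[P]_o ((M (x_ o) i (X i.+1 o))^-1 - 1) +
       2 * b ^+ 3 * (\sum_(i.+1 - lag i <= s < i) w s.+1 + eps (lag i)).
Proof.
move=> /lag_itv/andP[l1 li].
set j := (i.+1 - lag i)%N; set D := \sum_(_ <= _ < _) _.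
have ji : (j <= i)%N by rewrite /j leq_subLR -add1n leq_add2r.
have j1 : (0 < j)%N by rewrite /j subn_gt0 ltnS.
have jn : (j + lag i)%N = i.+1 by rewrite /j subnK// (leq_trans li).
have bX y n : measurable_fun setT y ->
    bounded_mfun (fun o => (M (x_ o) n (y o))^-1).
  move=> my; apply: (@bounded_mfun_comp _ _ _ _ _ (fun o => (o, y o)) _ _
    (bounded_mfun_invmix mX n)).
  exact/measurable_fun_pair.
have b1 (f : Omega -> R) : bounded_mfun f -> bounded_mfun (fun o => f o - 1).
  by move=> bf; apply: bounded_mfunB => //; exact: bounded_mfun_cst.
have bD (f : Omega -> R) c : bounded_mfun f -> bounded_mfun (fun o => f o + c).
  by move=> bf; apply: bounded_mfunD => //; exact: bounded_mfun_cst.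
have bchi2 n : bounded_mfun (fun o => chi2 (x_ o) n) by exact: bounded_mfun_chi2.
have chi2_ij : \int[P]_o chi2 (x_ o) i <= \int[P]_o chi2 (x_ o) j + b ^+ 3 * D.
  rewrite -[X in _ + X](mean_cst P) -meanD//; last exact: bounded_mfun_cst.
  apply: le_mean => //; first exact: bD.
  by move=> o; exact: ler_distlDr (chi2_drift (x_ o) ji).
have gain_ij : \int[P]_o ((M (x_ o) j (X i.+1 o))^-1 - 1)
    <= \int[P]_o ((M (x_ o) i (X i.+1 o))^-1 - 1) + b ^+ 3 * D.
  have bg n : bounded_mfun (fun o => (M (x_ o) n (X i.+1 o))^-1 - 1).
    by apply: b1; exact: bX.
  rewrite -[X in _ + X](mean_cst P) -meanD//; last exact: bounded_mfun_cst.
  apply: le_mean => //; first exact: bD.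
  move=> o; rewrite addrAC lerD2r.
  exact: ler_distlCDr (invmix_drift (x_ o) (X i.+1 o) ji).
have decouple : \int[P]_o chi2 (x_ o) j
    <= \int[P]_o ((M (x_ o) j (X i.+1 o))^-1 - 1) + b * eps (lag i).
  (* the first [j] data, as a sequence indexed from [1] *)
  pose xi s (y : j.-1.+1.-tuple S) := tnth y (inord s.-1).
  have mxi s : measurable_fun setT (xi s) by exact: measurable_tnth.
  have := @mixing j.-1.+1 (lag i) (fun z => (M (xi ^~ z.1) j z.2)^-1) b isT l1.
  move=> /(_ (bounded_mfun_invmix mxi j).1).
  have Mi (y : j.-1.+1.-tuple S) z := invmix_itv measurable_kappa b_ge1 kappa_itv
    (tilts_pos_density (xi ^~ y) j) z.
  have M0b z : 0 <= (M (xi ^~ z.1) j z.2)^-1 <= b.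
    have /andP[l u] := Mi z.1 z.2; rewrite u andbT.
    by rewrite (le_trans _ l)// invr_ge0.
  move=> /(_ M0b).
  have xiE o : M (xi ^~ [tuple X s.+1 o | s < j.-1.+1]) j = M (x_ o) j.
    congr mix; apply: eq_tilts => s sj.
    by rewrite /xi tnth_mktuple inordK ?prednK.
  under eq_Rintegral do under eq_Rintegral do rewrite /= xiE.
  under [X in _ <= X]eq_Rintegral do rewrite /= xiE prednK// jn.
  move=> H; rewrite meanB; [|exact: bX|exact: bounded_mfun_cst].
  under eq_Rintegral.
    move=> o _; rewrite /chi2_to_target meanB; last exact: bounded_mfun_cst.
      rewrite mean_cst; over.
    exact: (bounded_invmix measurable_kappa b_ge1 kappa_itv (tilts_pos_density _ _)).
  rewrite meanB; last exact: bounded_mfun_cst.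
    by rewrite !mean_cst addrAC lerD2r -lerBlDr.
  exact: (@bounded_mfun_mean2 _ _ _ _ _ Q (fun z => (M (x_ z.1) j z.2)^-1)
    (bounded_mfun_invmix mX j)).
have bb3 : b * eps (lag i) <= 2 * b ^+ 3 * eps (lag i).
  rewrite ler_wpM2r//; apply: (le_trans (ler_eXnr _ b_ge1 : b <= b ^+ 3)) => //.
  by rewrite ler_peMl ?exprn_ge0// ler1n.
apply: (le_trans chi2_ij); rewrite mulrDr.
have -> : 2 * b ^+ 3 * D = b ^+ 3 * D + b ^+ 3 * D by rewrite -mulrA mulr_natl.
rewrite !addrA [leRHS]addrAC lerD2r; apply: (le_trans decouple).
exact: lerD.
Qed.

(** The bound on the gains and the decoupling inequality, summed against the
    weights. *)
Lemma sum_mean_chi2_le : exists C, forall n,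
  \sum_(0 <= i < n) \int[P]_o (w i.+1 * chi2 (x_ o) i) <= C.
Proof.
have bg i : bounded_mfun (fun o => (M (x_ o) i (X i.+1 o))^-1 - 1).
  apply: bounded_mfunB; last exact: bounded_mfun_cst.
  apply: (@bounded_mfun_comp _ _ _ _ _ (fun o => (o, X i.+1 o)) _ _
    (bounded_mfun_invmix mX i)).
  exact/measurable_fun_pair.
have bwg i : bounded_mfun (fun o => w i.+1 * ((M (x_ o) i (X i.+1 o))^-1 - 1)).
  by apply: bounded_mfunM => //; exact: bounded_mfun_cst.
have bchi2 n : bounded_mfun (fun o => chi2 (x_ o) n) by exact: bounded_mfun_chi2.
have gain_le n : \sum_(0 <= i < n)
    \int[P]_o (w i.+1 * ((M (x_ o) i (X i.+1 o))^-1 - 1)) <= K + b ^+ 6 * C1.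
  rewrite -mean_sum// -[leRHS](mean_cst P); apply: le_mean.
  - exact: bounded_mfun_sum.
  - exact: bounded_mfun_cst.
  - move=> o; apply: (le_trans (sum_gain_le (x_ o) n finite_divergence)).
    by rewrite lerD2l ler_wpM2l// exprn_ge0.
have gain_ge i : - 1 <= \int[P]_o (w i.+1 * ((M (x_ o) i (X i.+1 o))^-1 - 1)).
  rewrite -[leLHS](mean_cst P); apply: le_mean => //; first exact: bounded_mfun_cst.
  move=> o; have /andP[w0 w1] := w01 i.
  have /andP[l _] := invmix_itv measurable_kappa b_ge1 kappa_itv
    (tilts_pos_density (x_ o) i) (X i.+1 o).
  have l0 : 0 <= (M (x_ o) i (X i.+1 o))^-1 by rewrite (le_trans _ l)// invr_ge0.
  rewrite mulrBr mulr1 (@le_trans _ _ (- w i.+1)) ?lerN2// lerBrDr addNr.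
  exact: mulr_ge0.
(* each of the first [i0] terms is at most [b] *)
exists (i0%:R * b + (K + b ^+ 6 * C1 + i0%:R + 2 * b ^+ 3 * C2)) => n.
have term_le i : \int[P]_o (w i.+1 * chi2 (x_ o) i) <= b.
  rewrite -[leRHS](mean_cst P); apply: le_mean; first 1 last.
  - exact: bounded_mfun_cst.
  - move=> o; rewrite -[leRHS]mul1r; apply: ler_pM => //.
    + exact: (chi2_to_target_ge0 measurable_kappa b_ge1 kappa_itv kappa_Q
        (tilts_pos_density _ _)).
    + by have /andP[] := w01 i.
    + exact: (chi2_to_target_le Q measurable_kappa b_ge1 kappa_itv
        (tilts_pos_density _ _)).
  - by apply: bounded_mfunM => //; exact: bounded_mfun_cst.
have head_le m : \sum_(0 <= i < m) \int[P]_o (w i.+1 * chi2 (x_ o) i) <= m%:R * b.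
  apply: (@le_trans _ _ (\sum_(0 <= i < m) b)); first exact: ler_sum.
  by rewrite sumr_const_nat subn0 mulr_natl.
have b6 : 0 <= b ^+ 6 by exact: exprn_ge0.
have KC : 0 <= K + b ^+ 6 * C1 by have := gain_le 0%N; rewrite big_nil.
have C20 : 0 <= C2 by have := sum_lag 0%N; rewrite big_geq.
have b3C2 : 0 <= 2 * b ^+ 3 * C2 by rewrite mulr_ge0// mulr_ge0// exprn_ge0.
have [ni0|/ltnW i0n] := leqP n i0.
  apply: (le_trans (head_le n)); apply: (@le_trans _ _ (i0%:R * b)).
    by rewrite ler_wpM2r// ler_nat.
  by rewrite lerDl; apply: addr_ge0 => //; apply: addr_ge0.
rewrite (big_cat_nat _ i0n)//=; apply: lerD => //.
have tail_le : \sum_(i0 <= i < n)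
    \int[P]_o (w i.+1 * ((M (x_ o) i (X i.+1 o))^-1 - 1)) <=
    K + b ^+ 6 * C1 + i0%:R.
  rewrite -lerBlDr; apply: le_trans (gain_le n).
  rewrite [leRHS](big_cat_nat _ i0n)//= [leRHS]addrC lerD2l.
  have -> : - i0%:R = \sum_(0 <= i < i0) (- 1 : R).
    by rewrite sumr_const_nat subn0 mulNrn.
  by apply: ler_sum => i _; exact: gain_ge.
have lag_le : 2 * b ^+ 3 * \sum_(i0 <= i < n)
    w i.+1 * (\sum_(i.+1 - lag i <= s < i) w s.+1 + eps (lag i)) <=
  2 * b ^+ 3 * C2 by rewrite ler_wpM2l// mulr_ge0// exprn_ge0.
apply: le_trans (lerD tail_le lag_le).
rewrite mulr_sumr -big_split/= !big_nat; apply: ler_sum => i /andP[i0i _].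
rewrite !meanZl// mulrCA -mulrDr ler_wpM2l//.
exact: mean_chi2_le.
Qed.

(** The weighted sum of the divergences is almost surely finite, and along each data
    sequence a divergence moves by at most a multiple of the weight. *)
Lemma ae_chi2_cvg0 : {ae P, forall o, (chi2 (x_ o) n) @[n --> \oo] --> 0}.
Proof.
have [C hC] := sum_mean_chi2_le.
have chi2_ge0 o i : 0 <= chi2 (x_ o) i.
  exact: (chi2_to_target_ge0 measurable_kappa b_ge1 kappa_itv kappa_Q
    (tilts_pos_density _ _)).
have := ae_bounded_series (u := fun i o => w i.+1 * chi2 (x_ o) i) (P := P)
  _ _ hC.
have bu i : bounded_mfun (fun o => w i.+1 * chi2 (x_ o) i).
  apply: bounded_mfunM; first exact: bounded_mfun_cst.
  exact: bounded_mfun_chi2.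
move=> /(_ bu (fun i o => mulr_ge0 (w_ge0 i) (chi2_ge0 o i))).
apply: filterS => o [C' hC'].
apply: (@lipschitz_summable_cvg0 _ _ (fun i => w i.+1) (b ^+ 3) C' C1) => //.
- exact: exprn_ge0.
- move=> i; have := chi2_drift (x_ o) (leqnSn i).
  by rewrite big_nat1.
Qed.

End dependent_data.
End recursion.

(** * Coding a compact set by bits *)

Section bit_code.
Context {R : realType} {V : pseudoPMetricType R}.

Lemma compact_finite_net (A : set V) (r : R) : compact A -> 0 < r ->
  exists s : seq V, forall x, A x ->
    exists2 i, (i < size s)%N & (interior (ball (nth point s i) r)) x.
Proof.
rewrite compact_cover => cA r0.
have [] := cA V A (fun c => interior (ball c r)).
- by move=> c _; exact: open_interior.
- move=> x Ax; exists x => //.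
  by apply: nbhs_singleton; apply: nbhs_interior; exact: nbhsx_ballx.
move=> D _ AD; exists ((finmap.enum_fset D)) => x /AD[c /= cD cx].
exists (index c ((finmap.enum_fset D))); first by rewrite index_mem.
by rewrite nth_index.
Qed.

(** The bits record membership in the balls of finite nets of radius [1 / n.+1];
    two points with the same bits up to the last ball of a net of radius [r] lie
    in a common ball of that net. *)
Lemma compact_bit_code (A : set V) : compact A ->
  exists beta : nat -> V -> bool,
    (forall i, measurable ([set x | beta i x] : set (borel V))) /\
    forall e, 0 < e -> exists J, forall x y, A x -> A y ->
      (forall i, (i < J)%N -> beta i x = beta i y) -> ball x e y.
Proof.
move=> cA.
have /choice[s hs] : forall n : nat, exists s : seq V, forall x, A x ->
    exists2 i, (i < size s)%N &
      (interior (ball (nth point s i) (n.+1%:R^-1 : R))) x.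
  by move=> n; apply: compact_finite_net; rewrite ?invr_gt0.
pose U n i := interior (ball (nth point (s n) i) (n.+1%:R^-1 : R)).
exists (fun k x => if unpickle k is Some (n, i) then `[< U n i x >] else false).
split => [k|e e0].
  case: (unpickle k) => [[n i]|].
    have -> : [set x | `[< U n i x >]] = U n i.
      by apply/seteqP; split => x /asboolP.
    by apply: sub_sigma_algebra; exact: open_interior.
  by rewrite [X in measurable X](_ : _ = set0)//; apply/seteqP; split.
have [n ne] : exists n, n.+1%:R^-1 + n.+1%:R^-1 <= e :> R.
  have [n _ hn] := near_infty_natSinv_lt (PosNum (divr_gt0 e0 (ltr0Sn R 1))).
  exists n; have /= := hn n (leqnn n) => H.
  by rewrite [leRHS]splitr; apply: lerD; exact: ltW.
exists (\max_(i < size (s n)) (pickle (n, nat_of_ord i)).+1)%N => x y Ax Ay xy.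
have [i si xi] := hs n x Ax.
have := xy (pickle (n, i)); rewrite pickleK.
have -> : `[< U n i x >] by apply/asboolP.
move=> /(_ _)/esym/asboolP yi.
have {}yi : U n i y.
  apply: yi; exact: (@leq_bigmax _ (fun i : 'I_(size (s n)) =>
    (pickle (n, nat_of_ord i)).+1) (Ordinal si)).
apply: (le_ball ne); apply: (@ball_triangle _ _ (nth point (s n) i)).
  by apply: ball_sym; exact: interior_subset xi.
exact: interior_subset yi.
Qed.

End bit_code.

Section words.
Variable f : nat -> bool.

(** Latest bit first. *)
Fixpoint word (n : nat) : seq bool := if n is n'.+1 then f n' :: word n' else [::].

Lemma size_word n : size (word n) = n.
Proof. by elim: n => //= n ->. Qed.

End words.

Lemma eq_word f g n : word f n = word g n <-> forall i, (i < n)%N -> f i = g i.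
Proof.
split=> [|fg]; last by elim: n fg => //= n IH fg; rewrite fg// IH// => i /leqW/fg.
elim: n => //= n IH [fgn /IH fg] i; rewrite ltnS leq_eqVlt.
by move=> /predU1P[->|/fg].
Qed.

Lemma eq_word_le f g m n : (m <= n)%N -> word f n = word g n ->
  word f m = word g m.
Proof.
by move=> mn /eq_word fg; apply/eq_word => i im; apply: fg; exact: leq_trans mn.
Qed.

Lemma measurable_word {d} {T : measurableType d} (beta : nat -> T -> bool) n
  (D : set (seq bool)) : (forall i, measurable [set x | beta i x]) ->
  measurable [set x | D (word (beta ^~ x) n)].
Proof.
move=> mb.
have mb' i b : measurable [set x | beta i x = b].
  case: b; first exact: mb.
  rewrite (_ : [set x | _] = ~` [set x | beta i x]).
    exact: measurableC.
  by apply/seteqP; split => x; rewrite /setC/=; [move=> ->|move/negP/negbTE].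
have mw s : measurable [set x | word (beta ^~ x) n = s].
  elim: n s => [|n IH] [|b s] /=.
  - by rewrite (_ : [set x | _] = setT)//; apply/seteqP; split.
  - by rewrite (_ : [set x | _] = set0)//; apply/seteqP; split=> y.
  - by rewrite (_ : [set x | _] = set0)//; apply/seteqP; split=> y.
  - rewrite (_ : [set x | _] = [set x | beta n x = b] `&`
      [set x | word (beta ^~ x) n = s]); first exact: measurableI.
    by apply/seteqP; split => x /= [-> ->].
rewrite (_ : [set x | _] = \bigcup_s (if `[< D s >]
    then [set x | word (beta ^~ x) n = s] else set0)).
  apply: countable_bigcupT_measurable => [|s]; first exact: countableP.
  by case: ifP => _; [exact: mw|exact: measurable0].
apply/seteqP; split => x /=.
  by move=> Dx; exists (word (beta ^~ x) n) => //=; rewrite asboolT.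
by case=> s _ /=; case: asboolP => //= Ds ->.
Qed.

(** One representative in [A] for each word that occurs in [A]; it replaces the
    points of [A] by countably many. *)
Lemma coded_points {V : Type} (A : set V) (a0 : V) (beta : nat -> V -> bool) :
  A a0 -> exists2 pt : seq bool -> V, forall s, A (pt s) &
    forall n x, A x -> word (beta ^~ (pt (word (beta ^~ x) n))) n = word (beta ^~ x) n.
Proof.
move=> Aa0; have /choice[pt ptP] : forall s, exists x, A x /\
    ((exists y, A y /\ word (beta ^~ y) (size s) = s) ->
     word (beta ^~ x) (size s) = s).
  move=> s; have [[x [Ax xs]]|nx] := pselect (exists x, A x /\
      word (beta ^~ x) (size s) = s); first by exists x.
  by exists a0; split => // /nx.
exists pt => [s|n x Ax]; first by case: (ptP s).
have [_] := ptP (word (beta ^~ x) n); rewrite size_word; apply.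
by exists x.
Qed.

(** Functions of finitely many bits are finite linear combinations of indicators. *)
Section mean_word.
Context {d} {T : measurableType d} {R : realType}.
Variables (beta : nat -> T -> bool) (n : nat) (g : seq bool -> R).
Hypothesis mbeta : forall i, measurable [set x | beta i x].

Let cell s := [set x | word (beta ^~ x) n = s].

Let g_wordE x : g (word (beta ^~ x) n) =
  \sum_(s : n.-tuple bool) g s * \1_(cell s) x.
Proof.
pose s0 : n.-tuple bool := Tuple (introT eqP (size_word (beta ^~ x) n)).
rewrite (bigD1 s0)//= big1 ?addr0.
  by rewrite indicE mem_set ?mulr1.
move=> s ss0; rewrite indicE memNset ?mulr0// /cell/= => xs.
by move/eqP: ss0; apply; apply: val_inj.
Qed.

Let bterm s : bounded_mfun (fun x => g s * \1_(cell s) x).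
Proof.
apply: bounded_mfunM; first exact: bounded_mfun_cst.
apply: (@bounded_mfun_itv _ _ _ _ 0 1).
  by apply: measurable_indic; exact: (@measurable_word _ _ _ _ [set s]).
by move=> x; rewrite indicE; case: (_ \in _); rewrite /= ?lexx ?ler01.
Qed.

Lemma bounded_mfun_word : bounded_mfun (fun x => g (word (beta ^~ x) n)).
Proof. by under eq_fun do rewrite g_wordE; exact: bounded_mfun_sum. Qed.

Lemma mean_word (P : probability T R) :
  \int[P]_x g (word (beta ^~ x) n) =
  \sum_(s : n.-tuple bool) g s * fine (P [set x | word (beta ^~ x) n = s]).
Proof.
under eq_Rintegral do rewrite g_wordE.
rewrite mean_sum//; apply: eq_bigr => s _.
rewrite meanZl.
  congr (_ * _); rewrite /Rintegral integral_indic// ?setIT//.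
  exact: (@measurable_word _ _ _ _ [set val s]).
apply: (@bounded_mfun_itv _ _ _ _ 0 1).
  by apply: measurable_indic; exact: (@measurable_word _ _ _ _ [set val s]).
by move=> x; rewrite indicE; case: (_ \in _); rewrite /= ?lexx ?ler01.
Qed.

End mean_word.

(** * Limits of probability measures on a compact set *)

(** A probability on infinite bit strings with prescribed masses [mass] of initial
    words, carried by [[0, 1[]: the words of length [n] cut [[0, 1[] into
    consecutive intervals of lengths [mass], and [bits_of_unif i u] tells which half
    of the [i]-th interval [u] falls in. *)
Section masses_of_words.
Context {R : realType}.
Variable mass : seq bool -> R.

Fixpoint left_end (s : seq bool) : R :=
  if s is b :: s' then left_end s' + (if b then mass (false :: s') else 0) else 0.

Fixpoint word_of_unif (u : R) (n : nat) : seq bool :=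
  if n is n'.+1 then
    let s := word_of_unif u n' in (left_end s + mass (false :: s) <= u) :: s
  else [::].

Definition bits_of_unif (i : nat) (u : R) : bool :=
  let s := word_of_unif u i in left_end s + mass (false :: s) <= u.

Lemma word_of_unifE u n : word_of_unif u n = word (bits_of_unif ^~ u) n.
Proof. by elim: n => //= n <-. Qed.

Hypothesis mass_ge0 : forall s, 0 <= mass s.
Hypothesis mass_nil : mass [::] = 1.
Hypothesis mass_cons : forall s, mass s = mass (true :: s) + mass (false :: s).

Lemma word_of_unif_itv u s : 0 <= u < 1 ->
  (word_of_unif u (size s) = s) <-> (left_end s <= u < left_end s + mass s).
Proof.
move=> u01; elim: s => [|b s IH] /=; first by rewrite mass_nil add0r.
have p0 := mass_ge0 (true :: s); have p1 := mass_ge0 (false :: s).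
have pE := mass_cons s.
split=> [[eb es]|].
  have /IH/andP[h1 h2] := es.
  rewrite -eb es; case: (leP (left_end s + mass (false :: s)) u) => h /=;
    apply/andP; split; lra.
case: b => /andP[h1 h2].
  have /IH e : left_end s <= u < left_end s + mass s by apply/andP; split; lra.
  by rewrite e; congr cons; lra.
have /IH e : left_end s <= u < left_end s + mass s by apply/andP; split; lra.
by rewrite e; congr cons; apply/negbTE; rewrite -ltNge; lra.
Qed.

Lemma left_end_itv s : 0 <= left_end s /\ left_end s + mass s <= 1.
Proof.
elim: s => [|b s [h0 h1]] /=; first by rewrite mass_nil add0r.
have p0 := mass_ge0 (true :: s); have p1 := mass_ge0 (false :: s).
by have pE := mass_cons s; case: b; split; lra.
Qed.

Lemma mass_word_of_unif_gt0 u n : 0 <= u < 1 -> 0 < mass (word_of_unif u n).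
Proof.
move=> u01; have /(word_of_unif_itv _ u01) : word_of_unif u
  (size (word_of_unif u n)) = word_of_unif u n.
  by rewrite (word_of_unifE u n) size_word word_of_unifE.
by move=> /andP[h1 h2]; lra.
Qed.

Lemma measurable_bits_of_unif i : measurable [set u | bits_of_unif i u].
Proof.
elim/ltn_ind: i => i IH.
have mw (D : set (seq bool)) : measurable [set u : R | D (word_of_unif u i)].
  under eq_set do rewrite word_of_unifE.
  pose beta j u := (j < i)%N && bits_of_unif j u.
  have -> : [set u | D (word (bits_of_unif ^~ u) i)] =
      [set u | D (word (beta ^~ u) i)].
    apply/funext => u /=; congr D; apply/eq_word => j ji.
    by rewrite /beta ji.
  apply: measurable_word => j; rewrite /beta.
  have [ji|ij] := ltnP j i; first exact: IH.
  by rewrite [X in measurable X](_ : _ = set0)//; apply/seteqP; split.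
rewrite [X in measurable X](_ : _ = \bigcup_s ([set u | word_of_unif u i = s] `&`
    `[left_end s + mass (false :: s), +oo[%classic)).
  apply: countable_bigcupT_measurable => [|s]; first exact: countableP.
  by apply: measurableI => //; exact: (mw [set s]).
apply/seteqP; split => u; rewrite /bits_of_unif/=.
  by exists (word_of_unif u i) => //; split => //=; rewrite in_itv/= andbT.
by move=> [s _ [/= -> ]]; rewrite in_itv/= andbT.
Qed.

End masses_of_words.

Section unif01.
Context {R : realType}.

Definition unif01 : set (measurableTypeR R) -> \bar R :=
  mrestr (@lebesgue_measure R) (measurable_itv `[0, 1[).

HB.instance Definition _ := Measure.on unif01.

Lemma unif01_setT : unif01 setT = 1%E.
Proof.
by rewrite /unif01 /mrestr setTI lebesgue_measure_itv/= lte_fin ltr01 sube0.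
Qed.

HB.instance Definition _ := Measure_isProbability.Build _ _ _ unif01 unif01_setT.

Lemma unif01_word (mass : seq bool -> R) s : (forall s, 0 <= mass s) -> mass [::] = 1 ->
  (forall s, mass s = mass (true :: s) + mass (false :: s)) ->
  fine (unif01 [set u | word (bits_of_unif mass ^~ u) (size s) = s]) = mass s.
Proof.
move=> p0 p1 ps; have [l0 l1] := left_end_itv p0 p1 ps s.
rewrite /unif01 /mrestr.
rewrite (_ : _ `&` _ = `[left_end mass s, left_end mass s + mass s[%classic).
  rewrite lebesgue_measure_itv/= lte_fin ltrDl.
  case: ltP => [_|]; first by rewrite -EFinB/= addrC addKr.
  by move=> ps0; apply/eqP; rewrite eq_le p0.
apply/seteqP; split => u /=; rewrite !in_itv/= -word_of_unifE.
  by move=> [ws u01]; apply/(word_of_unif_itv p0 p1 ps).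
move=> us; have u01 : 0 <= u < 1.
  by have /andP[h1 h2] := us; apply/andP; split; lra.
by split => //; apply/(word_of_unif_itv p0 p1 ps).
Qed.

End unif01.

(** A cluster point of an ultrafilter, which exists by compactness, is a limit. *)
Lemma ultra_cvg_itv {R : realType} {I : Type} (U : set_system I) (u : I -> R) a b :
  UltraFilter U -> (forall n, a <= u n <= b) -> cvg (u n @[n --> U]).
Proof.
move=> UU uab.
have [p [_ clp]] : `[a, b]%classic `&` cluster (u @ U) !=set0.
  apply: segment_compact; apply: (@filterE _ U) => n /=.
  by rewrite in_itv/= uab.
apply: (@cvgP _ _ p) => N Np.
have [//|UN] := in_ultra_setVsetC (u @^-1` N) UU.
by have [x []] := clp (~` N) N UN Np.
Qed.

Lemma mean_close {d} {T : measurableType d} {R : realType}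
  (P : probability T R) (A : set T) (f g : T -> R) (e : R) :
  measurable A -> P A = 1%E -> bounded_mfun f -> bounded_mfun g -> 0 <= e ->
  (forall x, A x -> `|f x - g x| <= e) ->
  `|\int[P]_x f x - \int[P]_x g x| <= e.
Proof.
move=> mA PA bf bg e0 fg; rewrite -meanB//.
have bfg : bounded_mfun (fun x => f x - g x) by exact: bounded_mfunB.
have b1A : bounded_mfun (\1_A : T -> R).
  apply: (@bounded_mfun_itv _ _ _ _ 0 1); first exact: measurable_indic.
  by move=> x; rewrite indicE; case: (_ \in _); rewrite /= ?lexx ?ler01.
have bfg1 : bounded_mfun (fun x => (f x - g x) * \1_A x) by exact: bounded_mfunM.
have -> : \int[P]_x (f x - g x) = \int[P]_x ((f x - g x) * \1_A x).
  congr fine; apply: ae_eq_integral => //.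
  - by apply/measurable_EFinP; case: bfg.
  - by apply/measurable_EFinP; case: bfg1.
  - exists (~` A); split; first exact: measurableC.
      by rewrite [LHS]probability_setC// PA subee.
    move=> x /= xA Ax; apply: xA => _; congr EFin.
    by rewrite indicE mem_set// mulr1.
apply: norm_mean_le => // x; rewrite indicE.
have [xA|xA] := boolP (x \in A); last by rewrite mulr0 normr0.
by rewrite mulr1 fg//; exact: set_mem.
Qed.

Section weak_limit.
Context {R : realType} {V : pseudoPMetricType R}.
Variables (A : set V) (F_ : nat -> probability (borel V) R) (U : set_system nat).
Hypothesis compact_A : compact A.
Hypothesis measurable_A : measurable (A : set (borel V)).
Hypothesis F_A : forall n, F_ n A = 1%E.
Hypothesis ultra_U : UltraFilter U.

(** Bit codes turn the measures into masses of words, which converge along [U];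
    the limiting masses are realized by random bit strings, which are decoded to
    points of the compact set. *)
Lemma ultra_weak_limit : exists2 G : probability (borel V) R, G A = 1%E &
  forall g : borel V -> R, bounded_mfun g ->
    (forall e, 0 < e -> exists2 r, 0 < r &
      forall x y, A x -> A y -> ball x r y -> `|g x - g y| <= e) ->
    (\int[F_ n]_x g x) @[n --> U] --> \int[G]_x g x.
Proof.
have [a0 Aa0] : A !=set0.
  apply/set0P/eqP => A0; have := F_A 0%N; rewrite A0 measure0 => /eqP.
  by rewrite eq_sym onee_eq0.
have [beta [mbeta codeP]] := compact_bit_code compact_A.
pose q n s := fine (F_ n [set x | word (beta ^~ x) (size s) = s]).
have mword s : measurable [set x : borel V | word (beta ^~ x) (size s) = s].
  exact: (@measurable_word _ (borel V) _ _ [set s]).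
have q01 n s : 0 <= q n s <= 1.
  rewrite /q fine_ge0//= -lee_fin fineK ?probability_le1//.
  exact: fin_num_measure.
pose mass s : R := lim (q n s @[n --> U]).
have cpi s : q n s @[n --> U] --> mass s.
  by have := ultra_cvg_itv ultra_U (q01 ^~ s).
have mass_ge0 s : 0 <= mass s.
  apply: limr_ge; first exact: (ultra_cvg_itv ultra_U (q01 ^~ s)).
  by apply: filterE => n; have /andP[] := q01 n s.
have mass_nil : mass [::] = 1.
  apply: cvg_lim => //; rewrite (_ : (fun n => _) = cst 1); first exact: cvg_cst.
  apply/funext => n; rewrite /q/= (_ : [set x | _] = setT) ?probability_setT//.
  by apply/seteqP; split.
have mass_cons s : mass s = mass (true :: s) + mass (false :: s).
  apply: cvg_lim => //; rewrite (_ : q ^~ s = q ^~ (true :: s) \+ q ^~ (false :: s)).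
    exact: cvgD.
  apply/funext => n; rewrite /q/= -fineD ?fin_num_measure//.
  - rewrite -measureU//; first 1 last.
    + exact: (mword (true :: s)).
    + exact: (mword (false :: s)).
    + by apply/seteqP; split => // x [/= [-> _] []].
    congr (fine (F_ n _)); apply/seteqP; split => x /=.
      by move=> ->; case: (beta _ _); [left|right].
    by case=> -[].
  - exact: (mword (true :: s)).
  - exact: (mword (false :: s)).
pose bit := bits_of_unif mass.
have mbit i : measurable [set u | bit i u] by exact: measurable_bits_of_unif.
(* words that occur in the limit occur in [A], so that they have representatives *)
have mass_gt0 s : 0 < mass s -> exists x, A x /\ word (beta ^~ x) (size s) = s.
  apply: contraPP => /forallNP nx; suff -> : mass s = 0 by rewrite ltxx.
  apply: cvg_lim => //; rewrite (_ : q ^~ s = cst 0); first exact: cvg_cst.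
  apply/funext => n; rewrite /q (_ : F_ n _ = 0%E)//.
  apply/eqP; rewrite -measure_le0.
  have <- : F_ n (~` A) = 0%E by rewrite [LHS]probability_setC// F_A subee.
  apply: le_measure; rewrite ?inE//; first exact: measurableC.
  by move=> x /= xs Ax; apply: (nx x).
have [pt pt_A pt_code] := coded_points beta Aa0.
pose approx n u := pt (word (bit ^~ u) n).
have approx_near e : 0 < e -> exists J, forall m n u, 0 <= u < 1 ->
    (J <= m)%N -> (J <= n)%N -> ball (approx m u) e (approx n u).
  move=> /codeP[J hJ]; exists J => m n u u01 Jm Jn.
  have codeE l : word (beta ^~ (approx l u)) l = word (bit ^~ u) l.
    have [|x [Ax]] := mass_gt0 (word (bit ^~ u) l).
      by rewrite -word_of_unifE mass_word_of_unif_gt0.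
    by rewrite size_word /approx => <-; exact: pt_code.
  apply: hJ; [exact: pt_A|exact: pt_A|].
  suff /eq_word : word (beta ^~ (approx m u)) J = word (beta ^~ (approx n u)) J.
    by [].
  by rewrite (eq_word_le Jm (codeE m)) (eq_word_le Jn (codeE n)).
have /choice[lim_pt lim_ptP] : forall u, exists x, A x /\ (0 <= u < 1 ->
    forall e, 0 < e -> exists J, forall n, (J <= n)%N -> ball (approx n u) e x).
  move=> u; have [u01|_] := boolP (0 <= u < 1); last by exists a0.
  have [x [Ax clx]] : A `&` cluster (approx ^~ u @ \oo) !=set0.
    by apply: compact_A; apply: (@filterE _ \oo) => n; exact: pt_A.
  exists x; split => // _ e e0.
  have e20 : 0 < e / 2 by rewrite divr_gt0.
  have [J hJ] := approx_near _ e20; exists J => n Jn.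
  have [|y [/= [m Jm <-]] xm] := clx (approx ^~ u @` [set m | (J <= m)%N]) _ _
    (nbhsx_ballx x _ e20).
    by exists J => // m /= Jm; exists m.
  rewrite [e]splitr; apply: (@ball_triangle _ _ (approx m u)).
    exact: hJ.
  exact: ball_sym.
(* outside of the unit interval, which carries the mass, the value is arbitrary *)
pose dec u := lim_pt (if 0 <= u < 1 then u else 0).
have mdec : measurable_fun setT (dec : R -> borel V).
  apply: (@measurability _ _ _ (borel V) setT dec (@open V)) => //.
  move=> _ [W oW <-]; rewrite setTI.
  pose r m : R := m.+1%:R^-1.
  have r0 m : 0 < r m by rewrite invr_gt0.
  (* an index after which the approximations stay within [r m] *)
  have /choice[J hJ] : forall m, exists J, forall u, 0 <= u < 1 ->
      ball (approx J u) (r m) (lim_pt u).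
    move=> m; have r20 : 0 < r m / 2 by rewrite divr_gt0.
    have [J hJ] := approx_near _ r20; exists J => u u01.
    have [J' hJ'] := (lim_ptP u).2 u01 _ r20.
    rewrite [r m]splitr; apply: (@ball_triangle _ _ (approx (maxn J J') u)).
      by apply: hJ => //; exact: leq_maxl.
    by apply: hJ'; exact: leq_maxr.
  have mW : measurable [set u : R | exists m, ball (approx (J m) u) (r m) `<=` W].
    rewrite [X in measurable X](_ : _ = \bigcup_m
        [set u | (fun s => ball (pt s) (r m) `<=` W) (word (bit ^~ u) (J m))]).
      apply: bigcupT_measurable => m.
      exact: (@measurable_word _ _ bit (J m) (fun s => ball (pt s) (r m) `<=` W)).
    by apply/seteqP; split => u /= [m]; exists m.
  (* an open set contains the limit iff it contains one of the balls around the
     approximations, and these take countably many values *)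
  have decW u : 0 <= u < 1 ->
      W (lim_pt u) <-> exists m, ball (approx (J m) u) (r m) `<=` W.
    move=> u01; split=> [Wu|[m mW']]; last by apply: mW'; exact: hJ.
    have : nbhs (lim_pt u) W by apply: open_nbhs_nbhs; split.
    rewrite -nbhs_ballE => -[e /= e0 eW].
    have [m _ hm] := near_infty_natSinv_lt (PosNum (divr_gt0 e0 (ltr0Sn R 1))).
    have /= rme := hm m (leqnn m).
    exists m => y my; apply: eW; rewrite [e]splitr.
    apply: (@ball_triangle _ _ (approx (J m) u)).
      apply: ball_sym; apply: le_ball (hJ m u u01); exact: ltW.
    by apply: le_ball my; exact: ltW.
  rewrite (_ : dec @^-1` W = (`[0, 1[%classic `&`
      [set u : R | exists m, ball (approx (J m) u) (r m) `<=` W]) `|`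
      (~` `[0, 1[%classic `&` [set u : R | W (lim_pt 0)])).
    apply: measurableU; first exact: measurableI.
    apply: measurableI; first exact: measurableC.
    have [W0|W0] := pselect (W (lim_pt 0)).
      by rewrite (_ : [set u | _] = setT)//; apply/seteqP; split.
    by rewrite (_ : [set u | _] = set0)//; apply/seteqP; split.
  apply/seteqP; split => u /=; rewrite /dec in_itv/=.
    by case: ifPn => [u01|nu] Wu; [left; split => //; exact/decW
                                  |right; split => //; exact/negP].
  by move=> [[u01 /(decW u u01)]|[/negP/negbTE ->]]; rewrite ?u01.
have mdec' : measurable_fun setT (dec : measurableTypeR R -> borel V) by [].
pose dec_mfun : {mfun measurableTypeR R >-> borel V} :=
  HB.pack_for {mfun measurableTypeR R >-> borel V}
  (dec : measurableTypeR R -> borel V)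
  (@isMeasurableFun.Build _ _ _ _ (dec : measurableTypeR R -> borel V) mdec').
have dec_A u : A (dec u) by exact: (lim_ptP _).1.
exists (distribution unif01 dec_mfun).
  rewrite /distribution /pushforward /= (_ : _ @^-1` A = setT) ?probability_setT//.
  by apply/seteqP; split => // u _; exact: dec_A.
move=> g bg ug; apply/cvgrPdist_le => e e0.
have e40 : 0 < e / 4 by rewrite divr_gt0.
have [r r0 gr] := ug _ e40.
have [J1 hJ1] := codeP _ r0; have [J2 hJ2] := approx_near _ r0.
(* up to [e], [g] is a function [gamma] of the first [J] bits *)
pose J := maxn J1 J2; pose gamma s := g (pt s).
have F_close n : `|\int[F_ n]_x g x -
    \int[F_ n]_x gamma (word (beta ^~ x) J)| <= e / 4.
  apply: (@mean_close _ (borel V) _ _ A) => //; last 2 first.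
  - exact: ltW.
  - move=> x Ax; apply: gr => //; apply: hJ1 => // i iJ1.
    suff /eq_word/(_ i (leq_trans iJ1 (leq_maxl _ _))) : word (beta ^~ x) J =
      word (beta ^~ (pt (word (beta ^~ x) J))) J by [].
    by rewrite pt_code.
  - exact: (@bounded_mfun_word _ (borel V)).
have G_close : `|\int[distribution unif01 dec_mfun]_x g x -
    \int[unif01]_u gamma (word (bit ^~ u) J)| <= e / 2.
  have -> : \int[distribution unif01 dec_mfun]_x g x = \int[unif01]_u g (dec u).
    congr fine; rewrite integral_distribution//.
      by apply/measurable_EFinP; case: bg.
    by apply: bounded_mfun_integrable; exact: (bounded_mfun_comp mdec).
  apply: (@mean_close _ (measurableTypeR R) _ unif01 `[0, 1[%classic
    (fun u => g (dec u)) (fun u => gamma (word (bit ^~ u) J))) => //.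
  - have : unif01 (`[0, 1[%classic : set R) = unif01 setT.
      by rewrite /unif01 /mrestr setTI setIid.
    by rewrite unif01_setT.
  - exact: (bounded_mfun_comp mdec).
  - exact: bounded_mfun_word.
  - by rewrite divr_ge0// ltW.
  move=> u; rewrite /= in_itv/= => u01; rewrite /dec u01.
  have [J3 hJ3] := (lim_ptP u).2 u01 _ r0.
  pose n := maxn J J3.
  have h1 : `|g (lim_pt u) - g (approx n u)| <= e / 4.
    rewrite distrC; apply: gr; [exact: pt_A|exact: (lim_ptP _).1|].
    by apply: hJ3; exact: leq_maxr.
  have h2 : `|g (approx n u) - gamma (word (bit ^~ u) J)| <= e / 4.
    apply: gr; [exact: pt_A|exact: pt_A|].
    exact: (hJ2 n J u u01 (leq_trans (leq_maxr J1 J2) (leq_maxl J J3))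
      (leq_maxr J1 J2)).
  by rewrite -(subrKA (g (approx n u))) (le_trans (ler_normD _ _))//; lra.
have : (\sum_(s : J.-tuple bool) gamma s * q n s) @[n --> U] -->
    \sum_(s : J.-tuple bool) gamma s * mass s.
  apply: cvg_big => [|s _]; last exact: cvgM (cvg_cst _) (cpi _).
  exact: add_continuous.
move=> /cvgrPdist_le/(_ _ e40); apply: filterS => n.
have -> : \sum_(s : J.-tuple bool) gamma s * q n s =
    \int[F_ n]_x gamma (word (beta ^~ x) J).
  rewrite (@mean_word _ (borel V))//; apply: eq_bigr => s _.
  by rewrite /q size_tuple.
have -> : \sum_(s : J.-tuple bool) gamma s * mass s =
    \int[unif01]_u gamma (word (bit ^~ u) J).
  rewrite mean_word//; apply: eq_bigr => s _.
  by have := unif01_word s mass_ge0 mass_nil mass_cons; rewrite size_tuple => <-.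
have := F_close n; move: G_close.
move: (\int[unif01]_u _) (\int[distribution unif01 dec_mfun]_x _)
  (\int[F_ n]_x g x) (\int[F_ n]_x _) => i1 i2 i3 i4.
by rewrite !ler_norml => /andP[? ?] /andP[? ?] /andP[? ?]; apply/andP; split; lra.
Qed.

End weak_limit.

(** * Weights and lags *)

Section dyadic_sums.
Context {R : realType}.

(** Cauchy condensation: the [2 ^ k] terms of the [k]-th dyadic block are all at
    most [B k]. *)
Lemma sum_dyadic_le (u : nat -> R) (B : nat -> R) k0 C :
  (forall k, 0 <= B k) -> (forall j, (1 <= j)%N -> 0 <= u j) ->
  (forall k j, (k0 <= k)%N -> (2 ^ k <= j < 2 ^ k.+1)%N -> u j <= B k) ->
  (forall n, \sum_(0 <= k < n) 2 ^+ k * B k <= C) ->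
  forall n, \sum_(2 ^ k0 <= j < n) u j <= C.
Proof.
move=> B0 u0 uB BC n.
have block k1 : (k0 <= k1)%N ->
    \sum_(2 ^ k0 <= j < 2 ^ k1) u j <= \sum_(k0 <= k < k1) 2 ^+ k * B k.
  elim: k1 => [|k1 IH]; first by rewrite leqn0 => /eqP ->; rewrite !big_geq.
  rewrite leq_eqVlt ltnS => /predU1P[<-|k01]; first by rewrite !big_geq.
  rewrite big_nat_recr//= (@big_cat_nat _ _ _ (2 ^ k1))/= ?leq_exp2l//.
  apply: lerD; first exact: IH.
  have -> : 2 ^+ k1 * B k1 = \sum_(2 ^ k1 <= j < 2 ^ k1.+1) B k1.
    rewrite sumr_const_nat -[RHS]mulr_natl expnS mul2n -addnn addnK.
    by rewrite natrX.
  by rewrite !big_nat; apply: ler_sum => j jk; exact: uB.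
have Bterm k : 0 <= 2 ^+ k * B k by rewrite mulr_ge0// exprn_ge0.
have [nk|kn] := leqP n (2 ^ k0).
  by rewrite big_geq//; have := BC 0%N; rewrite big_geq.
have k0n : (k0 <= n)%N by apply: ltnW; apply: ltn_trans kn; exact: ltn_expl.
apply: (@le_trans _ _ (\sum_(2 ^ k0 <= j < 2 ^ n) u j)).
  rewrite [leRHS](@big_cat_nat _ _ _ n)/=; last 2 first.
  - exact: ltnW.
  - by apply: ltnW; exact: ltn_expl.
  rewrite lerDl big_nat; apply: sumr_ge0 => j /andP[nj _]; apply: u0.
  by rewrite (leq_trans _ nj)// (leq_trans _ kn).
apply: (le_trans (block n k0n)); apply: le_trans (BC n).
by rewrite [leRHS](@big_cat_nat _ _ _ k0)//= lerDr; apply: sumr_ge0.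
Qed.

Lemma sum_geometric_le (r : R) n : 0 <= r < 1 ->
  \sum_(0 <= k < n) r ^+ k <= (1 - r)^-1.
Proof.
move=> /andP[r0 r1]; have r1' : 0 < 1 - r by rewrite subr_gt0.
rewrite -[leRHS]mul1r ler_pdivlMr// mulrC.
by rewrite big_mkord -[X in X * _]opprB mulNr -subrX1 opprB gerBl exprn_ge0.
Qed.

Lemma natr_geometric_le (r : R) k : 0 <= r < 1 -> k%:R * r ^+ k <= (1 - r)^-1.
Proof.
move=> r01; apply: le_trans (sum_geometric_le k r01); have /andP[r0 r1] := r01.
have -> : k%:R * r ^+ k = \sum_(0 <= j < k) r ^+ k.
  by rewrite sumr_const_nat subn0 mulr_natl.
rewrite !big_nat; apply: ler_sum => j /andP[_ jk].
by apply: ler_wiXn2l => //; [exact: ltW|exact: ltnW].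
Qed.

End dyadic_sums.

(** A lag proportional to the index of a dyadic block is eventually shorter than
    the preceding block. *)
Lemma linear_le_expn (M : nat) :
  exists k0, forall k, (k0 <= k)%N -> (M * k <= 2 ^ k.-1)%N.
Proof.
exists (M.*2 + 4)%N => k kM.
have Mexp := ltn_expl M (isT : (1 < 2)%N).
have key j : (M * (M.*2 + 4 + j) <= 2 ^ (M.*2 + 3 + j))%N.
  elim: j => [|j IH].
    rewrite !addn0 -addnn !expnD; nia.
  rewrite !(addnS _ j) mulnS expnS [leqRHS]mul2n -[leqRHS]addnn; apply: leq_add => //.
  by apply: (leq_trans (ltnW Mexp)); rewrite leq_exp2l//; lia.
have -> : k = (M.*2 + 4 + (k - (M.*2 + 4)))%N by lia.
by have -> : (M.*2 + 4 + (k - (M.*2 + 4))).-1 =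
  (M.*2 + 3 + (k - (M.*2 + 4)))%N by lia.
Qed.

Lemma lag_within_block k t s j : (0 < k)%N -> (2 ^ k <= j)%N ->
  (j - t.+1 <= s)%N -> (t <= 2 ^ k.-1)%N -> (2 ^ k.-1 <= s.+1)%N.
Proof. by case: k => // k _; rewrite expnS /=; lia. Qed.

Lemma leq_pred_sub j t : (j.-1 - (j - t.+1) <= t)%N.
Proof. lia. Qed.

Section power_weights.
Context {R : realType}.
Variables (w : nat -> R) (alpha : R).
Hypothesis w01 : forall i, (1 <= i)%N -> 0 < w i <= 1.
Hypothesis alpha_itv : 2^-1 < alpha <= 1.
Hypothesis w_equiv : w ~_\oo (fun i : nat => i%:R `^ (- alpha)).

(** Weights in the block [k] are of order [theta ^+ k]; the squares of the [2 ^ k] of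
    them add up to about [r ^+ k * r ^+ k], and [r < 1] because [2^-1 < alpha]. *)
Let theta : R := 2 `^ (- alpha).
Let r : R := 2 `^ (2^-1 - alpha).

Let theta_gt0 : 0 < theta. Proof. exact: powR_gt0. Qed.

Let r01 : 0 <= r < 1.
Proof.
rewrite /r powR_ge0/= -opprB powRN invf_lt1 ?powR_gt0//.
have a0 : 0 < alpha - 2^-1 by rewrite subr_gt0; have /andP[] := alpha_itv.
rewrite -[X in X < _](congr1 (@^~ (alpha - 2^-1)) (powR1 R)).
by apply: (gt0_ltr_powR a0); rewrite ?nnegrE// ltr1n.
Qed.

Let theta_r k : 2 ^+ k * (theta ^+ k * theta ^+ k) = r ^+ k * r ^+ k.
Proof.
rewrite -!exprMn; congr (_ ^+ k).
rewrite /theta /r -[X in X * _](powRr1 (ler0n R 2)) -!powRD;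
  try by apply/implyP.
by congr (_ `^ _); lra.
Qed.

Lemma power_weight_bounds : exists k0, forall k j, (k0 <= k)%N ->
  (2 ^ k <= j < 2 ^ k.+1)%N -> (2 ^+ k.+2)^-1 <= w j <= 2 * theta ^+ k.
Proof.
have : \forall j \near \oo, `|w j - j%:R `^ (- alpha)| <= 2^-1 * `|j%:R `^ (- alpha)|.
  by have /eqaddoP/(_ 2^-1) := w_equiv; apply; rewrite invr_gt0.
move=> [N _ wN]; exists N => k j Nk /andP[kj jk].
have j1 : (1 <= j)%N by rewrite (leq_trans _ kj)// expn_gt0.
have j0 : 0 < j%:R :> R by rewrite ltr0n.
have := wN j; rewrite /= (leq_trans Nk)//; last first.
  by rewrite (leq_trans _ kj)// ltnW// ltn_expl.
move=> /(_ isT); rewrite [`|_ `^ _|]ger0_norm ?powR_ge0// ler_norml => /andP[h1 h2].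
have /andP[a1 a2] := alpha_itv.
have up : j%:R `^ (- alpha) <= theta ^+ k.
  rewrite /theta -powR_mulrn ?powR_ge0// -powRrM mulrC powRrM powR_mulrn//.
  rewrite !powRN lef_pV2 ?posrE ?powR_gt0// ?exprn_gt0//.
  rewrite ge0_ler_powR ?nnegrE ?exprn_ge0 ?(ltW j0)//; last by rewrite -natrX ler_nat.
  by lra.
have lo : (2 ^+ k.+1)^-1 <= j%:R `^ (- alpha) :> R.
  apply: (@le_trans _ _ (j%:R^-1)).
    by rewrite lef_pV2 ?posrE ?exprn_gt0// -natrX ler_nat ltnW.
  rewrite powRN lef_pV2 ?posrE ?powR_gt0//.
  rewrite -[leRHS]powRr1 ?(ltW j0)// ler_powR// ler1n.
  by [].
apply/andP; split; last by lra.
have -> : (2 ^+ k.+2)^-1 = 2^-1 * (2 ^+ k.+1)^-1 :> R by rewrite exprS invfM.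
by lra.
Qed.

(** Each dyadic block contributes at least [4^-1], since [alpha <= 1]. *)
Lemma sum_power_weights : forall A, exists n, A <= \sum_(0 <= i < n) w i.+1.
Proof.
have [k0 hk0] := power_weight_bounds => A.
have block k1 : (k0 <= k1)%N ->
    (k1 - k0)%:R * 4^-1 <= \sum_(2 ^ k0 <= j < 2 ^ k1) w j.
  elim: k1 => [|k1 IH].
    by rewrite leqn0 => /eqP ->; rewrite subnn mul0r big_geq.
  rewrite leq_eqVlt ltnS => /predU1P[<-|k01].
    by rewrite subnn mul0r big_geq.
  rewrite (@big_cat_nat _ _ _ (2 ^ k1))/= ?leq_exp2l//.
  rewrite subSn// -natr1 mulrDl; apply: lerD; first exact: IH.
  have -> : 1 * 4^-1 = \sum_(2 ^ k1 <= j < 2 ^ k1.+1) (2 ^+ k1.+2)^-1 :> R.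
    rewrite sumr_const_nat -[RHS]mulr_natl expnS mul2n -addnn addnK natrX !exprS.
    by field; rewrite expf_neq0.
  rewrite !big_nat; apply: ler_sum => j jk.
  by have /andP[] := hk0 _ _ k01 jk.
pose n := Num.truncn (4 * `|A|).
have An : 4 * `|A| <= n.+1%:R by rewrite ltW// truncnS_gt// mulr_ge0.
exists (2 ^ (k0 + n.+1)).-1.
have -> : \sum_(0 <= i < (2 ^ (k0 + n.+1)).-1) w i.+1 =
    \sum_(1 <= j < 2 ^ (k0 + n.+1)) w j by rewrite big_add1.
rewrite (@big_cat_nat _ _ _ (2 ^ k0))/= ?expn_gt0// ?leq_exp2l ?leq_addr//.
apply: (@le_trans _ _ (\sum_(2 ^ k0 <= j < 2 ^ (k0 + n.+1)) w j)).
  apply: le_trans (block _ (leq_addr _ _)); rewrite addKn.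
  rewrite ler_pdivlMr// mulrC (le_trans _ An)// ler_wpM2l//; exact: ler_norm.
rewrite lerDr big_nat; apply: sumr_ge0 => j /andP[j1 _].
by have /andP[/ltW] := w01 j1.
Qed.

Lemma sum_sqr_power_weights :
  exists C, forall n, \sum_(0 <= i < n) w i.+1 ^+ 2 <= C.
Proof.
have [k0 hk0] := power_weight_bounds.
have hsum n : \sum_(2 ^ k0 <= j < n) w j ^+ 2 <= 4 * (1 - r)^-1.
  apply: (@sum_dyadic_le _ _ (fun k => 4 * (theta ^+ k * theta ^+ k)) k0).
  - by move=> k; rewrite mulr_ge0// mulr_ge0// exprn_ge0// ltW.
  - by move=> j _; exact: sqr_ge0.
  - move=> k j k0k jk; have /andP[l u] := hk0 k j k0k jk.
    have -> : 4 * (theta ^+ k * theta ^+ k) = (2 * theta ^+ k) ^+ 2 by ring.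
    rewrite lerXn2r ?nnegrE//.
      by rewrite (le_trans _ l)// invr_ge0 exprn_ge0.
    by rewrite mulr_ge0// exprn_ge0// ltW.
  - move=> m; under eq_bigr do rewrite mulrCA theta_r.
    rewrite -mulr_sumr ler_wpM2l//; apply: le_trans (sum_geometric_le m r01).
    apply: ler_sum => k _; have /andP[r0 r1] := r01.
    by rewrite ler_piMl ?exprn_ge0// exprn_ile1// ltW.
exists ((2 ^ k0)%:R + 4 * (1 - r)^-1) => n.
have -> : \sum_(0 <= i < n) w i.+1 ^+ 2 = \sum_(1 <= j < n.+1) w j ^+ 2.
  by rewrite big_add1.
have head m : (m <= 2 ^ k0)%N -> \sum_(1 <= j < m) w j ^+ 2 <= (2 ^ k0)%:R.
  move=> mk; apply: (@le_trans _ _ (\sum_(1 <= j < m) 1)).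
    rewrite !big_nat; apply: ler_sum => j /andP[j1 _].
    by have /andP[/ltW ? ?] := w01 j1; rewrite exprn_ile1.
  by rewrite sumr_const_nat ler_nat (leq_trans (leq_subr _ _)).
have rinv : 0 <= 4 * (1 - r)^-1.
  by have /andP[_ r1] := r01; rewrite mulr_ge0// invr_ge0 subr_ge0 ltW.
have [nk|kn] := leqP n.+1 (2 ^ k0).
  by rewrite (le_trans (head _ nk))// lerDl.
rewrite (@big_cat_nat _ _ _ (2 ^ k0))/= ?expn_gt0// ?(ltnW kn)//.
by apply: lerD; [exact: head|exact: hsum].
Qed.

(** In the dyadic block [k], a lag proportional to [k] is short enough for the
    weights to be almost constant across it, and long enough for [rho ^+ lag] to
    beat the number of terms. *)
Lemma power_weights_lag (c0 rho : R) : 0 <= c0 -> 0 < rho < 1 ->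
  exists lag i0 C, (forall i, (i0 <= i)%N -> (1 <= lag i <= i)%N) /\
    forall n, \sum_(i0 <= i < n) w i.+1 *
      (\sum_(i.+1 - lag i <= s < i) w s.+1 + c0 * rho ^+ lag i) <= C.
Proof.
move=> c00 /andP[rho0 rho1].
have [M hM] : exists M, rho ^+ M <= 4^-1.
  have : (fun n => rho ^+ n) @ \oo --> 0.
    by apply: cvg_expr; rewrite ger0_norm// ltW.
  move=> /cvgr0Pnorm_le/(_ 4^-1 (_ : 0 < 4^-1)) [//|N _ hN].
  by exists N; have := hN N (leqnn N); rewrite /= ger0_norm// exprn_ge0// ltW.
have [k1 hk1] := power_weight_bounds.
have [k2 hk2] := linear_le_expn M.
pose k0 := maxn k1.+1 (maxn k2 2).
pose lag i := (M * trunc_log 2 i.+1).+1.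
pose i0 := (2 ^ k0).-1.
have block i k : (2 ^ k <= i.+1 < 2 ^ k.+1)%N -> trunc_log 2 i.+1 = k.
  by move=> ?; exact: trunc_log_eq.
have i0S : i0.+1 = (2 ^ k0)%N by rewrite prednK// expn_gt0.
have lagP i : (i0 <= i)%N -> (1 <= lag i <= i)%N.
  rewrite -ltnS i0S /lag => i0i; rewrite ltnS/=.
  have /andP[t1 t2] := @trunc_log_bounds 2 i.+1 isT isT.
  have tk : (k0 <= trunc_log 2 i.+1)%N by exact: trunc_log_max.
  have := hk2 (trunc_log 2 i.+1).
  move: t1 tk; set t := trunc_log _ _; rewrite !geq_max => t1 /and3P[_ tk2 t2'].
  move=> /(_ tk2); case: t t1 t2' {tk2} => // t; rewrite expnS /= => t1 t2' Mt.
  have : (2 <= 2 ^ t)%N by rewrite -{1}(expn1 2) leq_exp2l.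
  by lia.
(* [B k] bounds the terms of the block [k]; the factor [theta ^+ k.-1] allows for a
   lag that reaches back into the block [k.-1] *)
pose u j := w j * (\sum_(j - lag j.-1 <= s < j.-1) w s.+1 + c0 * rho ^+ lag j.-1).
pose B k := 2 * theta ^+ k * ((M * k)%:R * (2 * theta ^+ k.-1)) + c0 * 4^-1 ^+ k.
have [C hC] : exists C, forall n, \sum_(2 ^ k0 <= j < n) u j <= C.
  exists (4 * M%:R / theta * (1 - r)^-1 * (1 - r)^-1 + c0 * (1 - 2^-1)^-1).
  apply: (@sum_dyadic_le _ u B).
  - move=> k; apply: addr_ge0; last by rewrite mulr_ge0// exprn_ge0.
    by rewrite !mulr_ge0// exprn_ge0// ltW.
  - move=> j j1; rewrite /u; have /andP[/ltW wj _] := w01 j1.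
    apply: mulr_ge0 => //; apply: addr_ge0.
      by apply: sumr_ge0 => s _; have /andP[/ltW] := w01 (ltn0Sn s).
    by rewrite mulr_ge0// exprn_ge0// ltW.
  - move=> k j k0k /[dup] jk /andP[kj jk'].
    have j1 : (1 <= j)%N by rewrite (leq_trans _ kj)// expn_gt0.
    move: k0k; rewrite !geq_max => /and3P[k1k k2k k22].
    have kS : k.-1.+1 = k by rewrite prednK// ltnW.
    have -> : u j = w j * (\sum_(j - (M * k).+1 <= s < j.-1) w s.+1 +
        c0 * rho ^+ (M * k).+1).
      by rewrite /u /lag prednK// (trunc_log_eq _ jk).
    have wj : 0 <= w j <= 1 by have /andP[/ltW -> ->] := w01 j1.
    have /andP[wj0 wj1] := wj.
    rewrite mulrDr /B; apply: lerD.
      have /andP[_ wjk] := hk1 k j (ltnW k1k) jk.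
      apply: ler_pM => //.
        by apply: sumr_ge0 => s _; have /andP[/ltW] := w01 (ltn0Sn s).
      apply: (@le_trans _ _ (\sum_(j - (M * k).+1 <= s < j.-1) (2 * theta ^+ k.-1))).
        rewrite !big_nat; apply: ler_sum => s /andP[s1 s2].
        have Mk := hk2 k k2k.
        have ks : (2 ^ k.-1 <= s.+1)%N.
          by apply: (lag_within_block _ kj s1 Mk); exact: ltnW.
        have sk : (s.+1 < 2 ^ k.+1)%N.
          by apply: leq_ltn_trans jk'; rewrite (leq_trans s2)// leq_pred.
        have [sk'|ks'] := ltnP s.+1 (2 ^ k).
          have := hk1 k.-1 s.+1; rewrite kS ks sk' => /(_ _ isT)/andP[]//.
          by rewrite -ltnS kS.
        have /andP[_] := hk1 k s.+1 (ltnW k1k) (introT andP (conj ks' sk)).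
        move=> /le_trans; apply; rewrite ler_wpM2l//.
        rewrite ler_wiXn2l ?leq_pred// ?(ltW theta_gt0)//.
        rewrite /theta powRN invf_le1 ?powR_gt0// -[leLHS](powRr0 2) ler_powR// ?ler1n//.
        have /andP[a1 _] := alpha_itv; apply/ltW; apply: lt_trans a1.
        by rewrite invr_gt0.
      rewrite sumr_const_nat -[leLHS]mulr_natl ler_wpM2r//.
        by rewrite mulr_ge0// exprn_ge0// ltW.
      by rewrite ler_nat leq_pred_sub.
    rewrite -[leRHS]mul1r; apply: ler_pM => //.
      by rewrite mulr_ge0// exprn_ge0// ltW.
    rewrite ler_wpM2l// exprS -[leRHS]mul1r.
    have rk0 : 0 <= rho ^+ M by rewrite exprn_ge0// ltW.
    apply: ler_pM; [exact: ltW|by rewrite exprn_ge0// ltW|exact: ltW|].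
    by rewrite exprM; apply: lerXn2r; rewrite ?nnegrE.
  - move=> m.
    apply: (@le_trans _ _ (\sum_(0 <= k < m)
        (4 * M%:R / theta * (1 - r)^-1 * r ^+ k + c0 * 2^-1 ^+ k))).
      apply: ler_sum => k _; rewrite /B mulrDr; apply: lerD; last first.
        rewrite mulrCA ler_wpM2l// -exprMn le_eqVlt; apply/orP; left.
        by apply/eqP; congr (_ ^+ k); field.
      have -> : 2 ^+ k * (2 * theta ^+ k * ((M * k)%:R * (2 * theta ^+ k.-1))) =
          4 * M%:R / theta * (k%:R * r ^+ k) * r ^+ k.
        case: k => [|k]; first by rewrite muln0 !(mul0r, mulr0).
        transitivity (4 * M%:R / theta * k.+1%:R * (r ^+ k.+1 * r ^+ k.+1)); last by ring.
        rewrite -theta_r natrM /= ![theta ^+ k.+1]exprS.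
        move: (2 ^+ k.+1) (theta ^+ k) k.+1%:R M%:R => A1 A2 A3 A4.
        by field; rewrite gt_eqF.
      have /andP[r0 r1] := r01.
      rewrite ler_wpM2r ?exprn_ge0// ler_wpM2l//.
        by rewrite !mulr_ge0// invr_ge0 ltW.
      exact: natr_geometric_le.
    rewrite big_split/= -!mulr_sumr; apply: lerD; apply: ler_wpM2l => //.
    - have /andP[r0 r1] := r01.
      by rewrite !mulr_ge0// ?invr_ge0 ?subr_ge0 ltW.
    - exact: sum_geometric_le.
    - by apply: sum_geometric_le; lra.
exists lag, i0, C; split => // n; apply: le_trans (hC n.+1).
by rewrite -i0S big_add1.
Qed.

End power_weights.

(** * Measures with densities *)

Section densities.
Context {d} {T : measurableType d} {R : realType}.
Variable mu : {measure set T -> \bar R}.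

Lemma is_density_probability (g : T -> R) : is_density mu g ->
  exists G : probability T R, forall A, G A = (\int[mu]_(t in A) (g t)%:E)%E.
Proof.
move=> [mg g0 g1].
pose G A := (\int[mu]_(t in A) (g t)%:E)%E.
have G0 : G set0 = 0%E by rewrite /G integral_set0.
have Gge0 A : (0 <= G A)%E by apply: integral_ge0 => t _; rewrite lee_fin.
have Gsigma : semi_sigma_additive G.
  move=> /= A mA tA mUA; rewrite /G; apply: cvg_toP.
    apply: ereal_nondecreasing_is_cvgn => m n mn.
    by apply: lee_sum_nneg_natr => // k _ _; exact: Gge0.
  rewrite ge0_integral_bigcup//.
  - by apply/measurable_EFinP; exact: measurable_funTS.
  - by move=> t _; rewrite lee_fin.
pose Gm := HB.pack_for {measure set T -> \bar R} G
  (isMeasure.Build _ _ _ G G0 Gge0 Gsigma).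
pose Gp := HB.pack_for (probability T R) G
  (isMeasure.Build _ _ _ G G0 Gge0 Gsigma)
  (Measure_isProbability.Build _ _ _ Gm g1).
by exists Gp.
Qed.

Import HBNNSimple.

(** Both sides are limits along the same increasing simple functions. *)
Lemma ge0_integral_density (G : {measure set T -> \bar R}) (g : T -> R)
    (h : T -> \bar R) :
  measurable_fun setT g -> (forall t, 0 <= g t) ->
  (forall A, measurable A -> G A = (\int[mu]_(t in A) (g t)%:E)%E) ->
  measurable_fun setT h -> (forall t, 0 <= h t)%E ->
  (\int[G]_t h t = \int[mu]_t (h t * (g t)%:E))%E.
Proof.
move=> mg g0 Gg mh h0.
have mEg : measurable_fun setT (EFin \o g) by exact/measurable_EFinP.
have Eg0 t : (0 <= (g t)%:E)%E by rewrite lee_fin.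
pose h_ := nnsfun_approx measurableT mh.
have -> : (\int[G]_t h t = limn (fun n => \int[G]_t (h_ n t)%:E))%E.
  rewrite -monotone_convergence//=.
  - apply: eq_integral => t _; apply/esym/cvg_lim => //.
    exact: cvg_nnsfun_approx.
  - by move=> n; exact/measurable_EFinP/measurable_funTS.
  - by move=> n t _; rewrite lee_fin.
  - by move=> t _ m n mn; rewrite lee_fin; exact/lefP/nd_nnsfun_approx.
have -> : (\int[mu]_t (h t * (g t)%:E) =
    limn (fun n => \int[mu]_t ((h_ n t)%:E * (g t)%:E)))%E.
  rewrite -monotone_convergence//=.
  - apply: eq_integral => t _; apply/esym/cvg_lim => //.
    by apply: cvgeZr => //; exact: cvg_nnsfun_approx.
  - move=> n; apply: emeasurable_funM => //.
    exact/measurable_EFinP/measurable_funTS.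
  - by move=> n t _; rewrite mule_ge0// lee_fin.
  - move=> t _ m n mn; rewrite lee_wpmul2r ?lee_fin//.
    exact/lefP/nd_nnsfun_approx.
suff hE n : (\int[G]_t (h_ n t)%:E = \int[mu]_t ((h_ n t)%:E * (g t)%:E))%E.
  by apply: congr_lim; apply/funext => n; exact: hE.
under [LHS]eq_integral do rewrite fimfunE -fsumEFin//.
rewrite [LHS]ge0_integral_fsum//; last 2 first.
  - by move=> r; exact/measurable_EFinP/measurableT_comp.
  - by move=> r t _; rewrite EFinM nnfun_muleindic_ge0.
under [RHS]eq_integral.
  move=> t _; rewrite fimfunE -fsumEFin// ge0_mule_fsuml; last first.
    by move=> r; rewrite EFinM nnfun_muleindic_ge0.
  over.
rewrite [RHS]ge0_integral_fsum//; last 2 first.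
  - move=> r; apply: emeasurable_funM => //.
    exact/measurable_EFinP/measurableT_comp.
  - by move=> r t _; rewrite mule_ge0// EFinM nnfun_muleindic_ge0.
apply: eq_fsbigr => r rh.
have r0 : 0 <= r by move: rh; rewrite inE => -[t _ <-].
have mr : measurable (h_ n @^-1` [set r]) by [].
under eq_integral do rewrite EFinM.
under [RHS]eq_integral do rewrite EFinM -muleA.
rewrite !ge0_integralZl//.
- congr (_ * _)%E; rewrite integral_indic// setIT Gg// integral_mkcond.
  apply: eq_integral => t _; rewrite patchE indicE.
  by case: ifPn => tr; rewrite ?mul1e ?mul0e.
- by apply: emeasurable_funM => //; exact/measurable_EFinP/measurable_indic.
- by move=> t _; rewrite mule_ge0// lee_fin.
- exact/measurable_EFinP/measurable_indic.
Qed.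

Lemma mean_density (G : probability T R) (g h : T -> R) :
  is_density mu g ->
  (forall A, measurable A -> G A = (\int[mu]_(t in A) (g t)%:E)%E) ->
  bounded_mfun h ->
  mu.-integrable setT (fun t => (h t * g t)%:E) /\
  (\int[mu]_t (h t * g t)%:E = (\int[G]_t h t)%:E)%E.
Proof.
move=> [mg g0 g1] Gg bh; have [mh [C hC]] := bh.
have ig : mu.-integrable setT (EFin \o g).
  apply/integrableP; split; first exact/measurable_EFinP.
  by under eq_integral do rewrite gee0_abs ?lee_fin//; rewrite g1 ltry.
have C0 : 0 <= C by exact: le_trans (normr_ge0 _) (hC point).
have iCg : mu.-integrable setT (fun t => (C * g t)%:E).
  by apply: (eq_integrable measurableT _ _ _ (integrableZl measurableT C ig)).
have ihg : mu.-integrable setT (fun t => (h t * g t)%:E).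
  apply: (le_integrable measurableT _ _ iCg).
    by apply/measurable_EFinP; exact: measurable_funM.
  move=> t _ /=; rewrite lee_fin !normrM (ger0_norm C0) ler_wpM2r//.
split => //.
(* the shift by [C] makes the function nonnegative *)
have bhC : bounded_mfun (fun t => h t + C).
  by apply: bounded_mfunD => //; exact: bounded_mfun_cst.
have hC0 t : 0 <= h t + C by have := hC t; rewrite ler_norml; lra.
have := @ge0_integral_density G g (fun t => (h t + C)%:E) mg g0 Gg.
move=> /(_ _ _); rewrite (bounded_mfun_EFin _ bhC).
rewrite meanD ?mean_cst//; last exact: bounded_mfun_cst.
have -> : (\int[mu]_t ((h t + C)%:E * (g t)%:E) =
    \int[mu]_t (h t * g t)%:E + C%:E)%E.
  transitivity (\int[mu]_t ((h t * g t)%:E + (C * g t)%:E))%E.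
    by apply: eq_integral => t _; rewrite -EFinM mulrDl.
  rewrite integralD//; congr (_ + _)%E.
  under eq_integral do rewrite EFinM.
  by rewrite integralZl// g1 mule1.
move=> H; have {H} : ((\int[G]_t h t + C)%:E = \int[mu]_t (h t * g t)%:E + C%:E)%E.
  by apply: H => //; apply/measurable_EFinP; case: bhC.
rewrite -(fineK (integrable_fin_num measurableT ihg)) -EFinD => -[].
by move=> /addIr ->.
Qed.

End densities.

(** * Decoupling from conditional densities *)

(** Rectangles form a pi-system that generates the product. *)
Lemma probability_rectangle_unique {d1 d2} {T1 : measurableType d1}
    {T2 : measurableType d2} {R : realType} (m1 m2 : probability (T1 * T2)%type R) :
  (forall A B, measurable A -> measurable B -> m1 (A `*` B) = m2 (A `*` B)) ->
  forall C, measurable C -> m1 C = m2 C.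
Proof.
move=> m12; pose G : set (set (T1 * T2)) :=
  [set C | exists A, measurable A /\ exists B, measurable B /\ C = A `*` B].
move=> C mC; apply: (measure_unique G (fun=> setT)) => //.
- rewrite measurable_prod_measurableType //; congr (<<s _ >>).
  rewrite predeqE; split => [[A mA [B mB <-]]|[A [mA [B [mB ->]]]]].
    by exists A; split => //; exists B.
  by exists A => //; exists B.
- move=> /= _ _ [X1 [mX1 [X2 [mX2 ->]]]] [Y1 [mY1 [Y2 [mY2 ->]]]].
  rewrite -setXI; exists (X1 `&` Y1); split; first exact: measurableI.
  by exists (X2 `&` Y2); split => //; exact: measurableI.
- by move=> _; exists setT; split => //; exists setT; rewrite setXTT.
- by apply/seteqP; split => // x _; exists 0%N.
- by move=> A [A1 [mA1 [A2 [mA2 ->]]]]; exact: m12.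
- by move=> _; rewrite [X in (X < _)%E]probability_setT ltry.
Qed.

Section conditional_density.
Context {R : realType} {d} {Omega : measurableType d} {chi : ptopologicalType}.
Variables (P : probability Omega R)
  (nu : {sigma_finite_measure set (borel chi) -> \bar R}).
Variable X : nat -> {mfun Omega >-> borel chi}.

Lemma measurable_past i : measurable_fun setT (past X i).
Proof.
apply/measurable_fun_tnthP => j.
rewrite (_ : _ \o _ = X j.+1)//; apply/funext => o /=.
by rewrite tnth_mktuple.
Qed.

Section one_lag.
Variables (i n : nat) (q : i.-tuple (borel chi) -> borel chi -> R).
Hypothesis cond_q : is_cond_density P nu X n q.

Let rho (z : Omega * borel chi) := q (past X i z.1) z.2.

Let measurable_past_fst :
  measurable_fun setT (fun z : Omega * borel chi => (past X i z.1, z.2)).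
Proof.
apply/measurable_fun_pair => //.
exact: (measurableT_comp (@measurable_past i) measurable_fst).
Qed.

Let measurable_rho : measurable_fun setT rho.
Proof. by have [mq _ _] := cond_q; exact: (measurableT_comp mq measurable_past_fst). Qed.

Let rho_ge0 z : 0 <= rho z. Proof. by have [_ q0 _] := cond_q; exact: q0. Qed.

Let past_rectangle A B : measurable A -> measurable B ->
  (\int[(P \x nu)%E]_(z in [set z | A (past X i z.1) /\ B z.2]) (rho z)%:E)%E =
  P (past X i @^-1` A `&` X (i + n)%N @^-1` B).
Proof.
move=> mA mB; have [_ _ ->//] := cond_q.
rewrite integral_mkcond (fubini_tonelli1 _).
- rewrite [RHS]integral_mkcond; apply: eq_integral => o _.
  rewrite /fubini_F patchE; case: ifPn => [/set_mem oA|/negP oA].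
    rewrite [RHS]integral_mkcond; apply: eq_integral => x _; rewrite !patchE.
    have -> // : ((o, x) \in [set z | A (past X i z.1) /\ B z.2]) = (x \in B).
    apply/idP/idP => [/set_mem[_ xB]|/set_mem xB]; apply/mem_set; first exact: xB.
    by split; [exact: oA|exact: xB].
  apply: integral0_eq => x _; rewrite patchE.
  case: ifPn => // /set_mem[oA' _]; exfalso; apply: oA; apply/mem_set.
  exact: oA'.
- apply/(measurable_restrictT _ _).1.
    rewrite (_ : [set z | _] = (fun z : Omega * borel chi => (past X i z.1, z.2)) @^-1` (A `*` B)).
      rewrite -[X in measurable X]setTI; apply: measurable_past_fst => //.
      exact: measurableX.
    by apply/seteqP; split.
  by apply/measurable_EFinP; exact: measurable_funTS.
- by move=> z; rewrite patchE; case: ifPn => // _; rewrite lee_fin.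
Qed.

(** Two probability measures on pairs (past, future) that agree on rectangles:
    the law of the pair, and the image of the law with density [rho] with respect
    to the product of [P] and [nu]. *)
Lemma integral_cond_density (Phi : i.-tuple (borel chi) * borel chi -> \bar R) :
  measurable_fun setT Phi -> (forall z, 0 <= Phi z)%E ->
  (\int[P]_o Phi (past X i o, X (i + n)%N o) =
   \int[(P \x nu)%E]_z (Phi (past X i z.1, z.2) * (rho z)%:E))%E.
Proof.
move=> mPhi Phi0.
have rho1 : is_density (P \x nu)%E rho.
  split => //.
  have := @past_rectangle setT setT measurableT measurableT.
  rewrite (_ : [set z | _] = setT); last by apply/seteqP; split.
  by rewrite !preimage_setT setTI => ->; exact: probability_setT.
have [D hD] := is_density_probability rho1.
have mpair : measurable_fun setT (fun o => (past X i o, X (i + n)%N o)).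
  by apply/measurable_fun_pair => //; exact: measurable_past.
rewrite -(@ge0_integral_density _ _ _ (P \x nu)%E D rho
  (fun z => Phi (past X i z.1, z.2)))//; last first.
- exact: (measurableT_comp mPhi measurable_past_fst).
- by move=> A _; exact: hD.
pose future := HB.pack_for {mfun Omega >-> (i.-tuple (borel chi) * borel chi)%type}
  (fun o => (past X i o, X (i + n)%N o)) (isMeasurableFun.Build _ _ _ _ _ mpair).
pose copy := HB.pack_for {mfun (Omega * borel chi)%type >->
    (i.-tuple (borel chi) * borel chi)%type}
  (fun z : Omega * borel chi => (past X i z.1, z.2))
  (isMeasurableFun.Build _ _ _ _ _ measurable_past_fst).
transitivity (\int[distribution P future]_z Phi z)%E.
  exact: (esym (ge0_integral_distribution future mPhi Phi0)).
transitivity (\int[distribution D copy]_z Phi z)%E; last first.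
  exact: (ge0_integral_distribution copy mPhi Phi0).
apply: eq_measure_integral => C mC _.
apply: probability_rectangle_unique => // A B mA mB.
transitivity (D [set z | A (past X i z.1) /\ B z.2]); last by [].
by rewrite hD past_rectangle.
Qed.

(** The chi-square dependence controls the total variation one: with
    [v = q / m - 1], the arithmetic-geometric inequality gives
    [|q - m| = |v| m <= (t / 2) m + v ^ 2 m / (2 t)]. *)
Lemma chi2_decoupling (m : borel chi -> R) (Q : probability (borel chi) R)
    (t C : R) (Phi : i.-tuple (borel chi) * borel chi -> R) :
  is_density nu m ->
  (forall A, measurable A -> Q A = (\int[nu]_(x in A) (m x)%:E)%E) ->
  0 < t -> (chi2_dependence P nu X m q <= (t ^+ 2)%:E)%E ->
  measurable_fun setT Phi -> (forall z, 0 <= Phi z <= C) ->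
  \int[P]_o \int[Q]_y Phi (past X i o, y) - C * t <=
    \int[P]_o Phi (past X i o, X (i + n)%N o).
Proof.
move=> dm Qm t0 chi2t mPhi PhiC; have [mm m0 m1] := dm.
have Phi0 z : 0 <= Phi z by have /andP[] := PhiC z.
have C0 : 0 <= C by have /andP[] := PhiC (point, point); exact: le_trans.
have bPhi : bounded_mfun Phi by exact: bounded_mfun_itv PhiC.
pose Psi (z : Omega * borel chi) := Phi (past X i z.1, z.2).
have bPsi : bounded_mfun Psi by exact: (bounded_mfun_comp measurable_past_fst).
have mPsi : measurable_fun setT Psi by case: bPsi.
have Psi0 z : 0 <= Psi z by exact: Phi0.
pose m2 (z : Omega * borel chi) := m z.2.
have mm2 : measurable_fun setT m2 by exact: (measurableT_comp mm measurable_snd).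
pose v2 (z : Omega * borel chi) := (rho z / m2 z - 1) ^+ 2 * m2 z.
have mv2 : measurable_fun setT v2.
  apply: measurable_funM => //; apply: measurable_funX; apply: measurable_funB => //.
  apply: measurable_funM => //; apply: ge0_measurable_funV => //.
  by move=> z; exact: m0.
have m20 z : 0 <= m2 z by exact: m0.
have v20 z : 0 <= v2 z by rewrite mulr_ge0// sqr_ge0.
have mean_m2 : (\int[(P \x nu)%E]_z (m2 z)%:E = 1)%E.
  rewrite (fubini_tonelli1 (fun z => (m2 z)%:E))/fubini_F/=; first last.
  - by move=> z; rewrite lee_fin.
  - exact/measurable_EFinP.
  by under eq_integral do rewrite m1; rewrite integral_cst// mul1e [LHS]probability_setT.
have mean_v2 : (\int[(P \x nu)%E]_z (v2 z)%:E <= (t ^+ 2)%:E)%E.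
  rewrite (fubini_tonelli1 (fun z => (v2 z)%:E))//.
  exact/measurable_EFinP.
have mean_indep : (\int[(P \x nu)%E]_z (Psi z * m2 z)%:E =
    (\int[P]_o \int[Q]_y Phi (past X i o, y))%:E)%E.
  rewrite (fubini_tonelli1 (fun z => (Psi z * m2 z)%:E))/fubini_F/=; first last.
  - by move=> z; rewrite lee_fin mulr_ge0.
  - by apply/measurable_EFinP; exact: measurable_funM.
  under eq_integral.
    move=> o _; rewrite (mean_density dm Qm _).2; last exact: (bounded_mfun_pairl o bPsi).
    over.
  rewrite bounded_mfun_EFin//.
  exact: (bounded_mfun_mean2 Q bPsi).
have mean_dep : (\int[(P \x nu)%E]_z (Psi z * rho z)%:E =
    (\int[P]_o Phi (past X i o, X (i + n)%N o))%:E)%E.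
  rewrite -bounded_mfun_EFin; last first.
    apply: (bounded_mfun_comp _ bPhi); apply/measurable_fun_pair => //.
    exact: measurable_past.
  by rewrite (@integral_cond_density (fun z => (Phi z)%:E))//; exact/measurable_EFinP.
have pointwise z : Psi z * m2 z <=
    Psi z * rho z + (C * t / 2 * m2 z + C / (2 * t) * v2 z).
  have := m20 z; rewrite le_eqVlt => /predU1P[m2z|m2z].
    by rewrite /v2 -m2z !mulr0 !addr0 mulr_ge0.
  rewrite /v2; set v := rho z / m2 z - 1.
  have -> : rho z = m2 z * (1 + v) by rewrite /v; field; rewrite gt_eqF.
  rewrite [X in _ <= X](_ : _ =
    m2 z * (Psi z * (1 + v) + (C * t / 2 + C / (2 * t) * v ^+ 2))); last by ring.
  rewrite mulrC ler_pM2l// mulrDr mulr1 -addrA lerDl.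
  apply: (@le_trans _ _ (C * (t / 2 + v ^+ 2 / (2 * t)) - C * `|v|)).
    rewrite -mulrBr mulr_ge0//.
    have -> : t / 2 + v ^+ 2 / (2 * t) - `|v| = (t - `|v|) ^+ 2 / (2 * t).
      by rewrite -(real_normK (num_real v)); field; rewrite gt_eqF.
    by rewrite divr_ge0 ?sqr_ge0// mulr_ge0// ltW.
  rewrite [leLHS]addrC; apply: lerD; last first.
    by rewrite le_eqVlt; apply/orP; left; apply/eqP; field; rewrite gt_eqF.
  rewrite lerNl -mulrN; have /andP[_ PC] := PhiC (past X i z.1, z.2).
  apply: (@le_trans _ _ (Psi z * `|v|)); last by rewrite ler_wpM2r.
  by rewrite ler_wpM2l ?Phi0// -normrN ler_norm.
have Ct0 : 0 <= C * t / 2 by rewrite !mulr_ge0// ltW.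
have Ct1 : 0 <= C / (2 * t) by rewrite divr_ge0// mulr_ge0// ltW.
rewrite lerBlDr -lee_fin -mean_indep EFinD -mean_dep.
apply: (@le_trans _ _ (\int[(P \x nu)%E]_z ((Psi z * rho z)%:E +
    ((C * t / 2)%:E * (m2 z)%:E + (C / (2 * t))%:E * (v2 z)%:E)))%E).
  apply: ge0_le_integral => //.
  - by move=> z _; rewrite lee_fin mulr_ge0.
  - by apply/measurable_EFinP; exact: measurable_funM.
  - apply/measurable_EFinP; apply: measurable_funD.
      exact: measurable_funM.
    by apply: measurable_funD; apply: measurable_funM.
  - by move=> z _; rewrite -!EFinM -!EFinD lee_fin.
have mE (h : Omega * borel chi -> R) : measurable_fun setT h ->
    measurable_fun setT (EFin \o h) by move=> ?; exact/measurable_EFinP.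
rewrite ge0_integralD//; first last.
- by apply: emeasurable_funD; apply: emeasurable_funM => //; exact: mE.
- by move=> z _; rewrite -!EFinM -EFinD lee_fin addr_ge0// mulr_ge0.
- by apply/measurable_EFinP; exact: measurable_funM.
- by move=> z _; rewrite lee_fin mulr_ge0.
rewrite leeD2l// ge0_integralD//; first last.
- by apply: emeasurable_funM => //; exact: mE.
- by move=> z _; rewrite -!EFinM lee_fin mulr_ge0.
- by apply: emeasurable_funM => //; exact: mE.
- by move=> z _; rewrite -!EFinM lee_fin mulr_ge0.
rewrite !ge0_integralZl//; first last.
- by move=> z _; rewrite lee_fin.
- exact: mE.
- by move=> z _; rewrite lee_fin.
- exact: mE.
rewrite mean_m2 mule1.
apply: (@le_trans _ _ ((C * t / 2)%:E + (C / (2 * t))%:E * (t ^+ 2)%:E)%E).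
  by rewrite leeD2l// lee_wpmul2l// lee_fin.
rewrite -EFinM -EFinD lee_fin le_eqVlt; apply/orP; left; apply/eqP.
by field; rewrite gt_eqF.
Qed.

End one_lag.
End conditional_density.

(** * The likelihood ratios are essentially bounded *)

Lemma measurable_ler_set {d} {T : measurableType d} {R : realType} (f g : T -> R) :
  measurable_fun setT f -> measurable_fun setT g -> measurable [set x | f x <= g x].
Proof.
move=> mf mg; have := measurable_fun_ler mf mg measurableT (Y := [set true]).
by rewrite setTI; apply.
Qed.

Section ratio_bound.
Context {R : realType} {k : nat} {chi : ptopologicalType}.
Variables (nu : {measure set (borel chi) -> \bar R})
  (p : chi -> 'rV[R]_k -> R) (That : set 'rV[R]_k) (c : R).
Hypothesis mp : forall t, That t -> measurable_fun setT (p ^~ t : borel chi -> R).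
Hypothesis p0 : forall x t, That t -> 0 <= p x t.

Lemma measurable_lratio t1 t2 : That t1 -> That t2 ->
  measurable_fun setT ((fun x => lratio p x t1 t2) : borel chi -> \bar R).
Proof.
move=> h1 h2; apply: emeasurable_funM; first by apply/measurable_EFinP; exact: mp.
under eq_fun do rewrite inver; apply: measurable_fun_ifT => //.
  by apply: measurable_fun_eqr => //; exact: mp.
apply/measurable_EFinP; under eq_fun do rewrite -(powR_inv1 (p0 _ h2)).
by apply: (measurableT_comp (@measurable_powR R (-1))); exact: mp.
Qed.

Lemma lee_pexpe (x : \bar R) (r : R) n : 0 <= r -> (r%:E <= x)%E ->
  ((r ^+ n)%:E <= x ^+ n)%E.
Proof.
move=> r0 rx; elim: n => // n IH; rewrite exprS EFinM expeS.
by apply: lee_pmul => //; rewrite lee_fin exprn_ge0.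
Qed.

Lemma lratio_ge (x : chi) t1 t2 (r : R) : That t2 -> 0 < r -> 0 < p x t1 ->
  r * p x t2 <= p x t1 -> (r%:E <= lratio p x t1 t2)%E.
Proof.
move=> h2 r0 p1 rp; rewrite /lratio inver; case: ifPn => [_|p2].
  by rewrite gt0_muley ?lte_fin// leey.
have p2' : 0 < p x t2 by rewrite lt_neqAle eq_sym p2 p0.
by rewrite -EFinM lee_fin ler_pdivlMr.
Qed.

(** If the ratio exceeded [c + r] on a set where [p x t1 >= r] and which has
    positive measure, its moments would grow at least like [(c + r) ^ j]. *)
Lemma moments_lratio_null t1 t2 r :
  (forall j, (1 <= j)%N -> (sup_ratio_moment nu p That j < (c ^+ j)%:E)%E) ->
  0 < c -> That t1 -> That t2 -> 0 < r ->
  nu.-negligible [set x : borel chi | r <= p x t1 /\ (c + r) * p x t2 <= p x t1].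
Proof.
move=> mom c0 h1 h2 r0; set A := [set x | _].
have cr0 : 0 < c + r by exact: addr_gt0.
have mA : measurable A.
  have -> : A = [set x : borel chi | r <= p x t1] `&`
      [set x : borel chi | (c + r) * p x t2 <= p x t1] by [].
  apply: measurableI; apply: measurable_ler_set => //; try exact: mp.
  by apply: measurable_funM => //; exact: mp.
pose th := c / (c + r).
have th01 : 0 <= th < 1.
  by rewrite divr_ge0 ?(ltW c0) ?(ltW cr0)//= ltr_pdivrMr// mul1r ltrDl.
have nuA j : (1 <= j)%N -> (nu A <= (r^-1 * th ^+ j)%:E)%E.
  move=> j1.
  have : (((c + r) ^+ j * r)%:E * nu A <= (c ^+ j)%:E)%E.
    apply: le_trans (ltW (mom j j1)).
    apply: (@le_trans _ _ (ratio_moment nu p j t1 t2 t1)); last first.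
      by apply: ereal_sup_ubound; exists t1, t2, t1.
    rewrite -integral_cst//.
    have mf : measurable_fun setT
        ((fun x => (lratio p x t1 t2 ^+ j * (p x t1)%:E)%E) : borel chi -> \bar R).
      apply: emeasurable_funM; last by apply/measurable_EFinP; exact: mp.
      elim: {+}j => [|l IH]; first exact: measurable_cst.
      under eq_fun do rewrite expeS; apply: emeasurable_funM => //.
      exact: measurable_lratio.
    have f0 (x : borel chi) : (0 <= lratio p x t1 t2 ^+ j * (p x t1)%:E)%E.
      rewrite mule_ge0 ?lee_fin ?p0//; apply: expe_ge0; rewrite /lratio.
      by rewrite mule_ge0 ?inve_ge0 ?lee_fin ?p0//.
    apply: (@le_trans _ _ (\int[nu]_(x in A) (lratio p x t1 t2 ^+ j * (p x t1)%:E))%E).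
      apply: ge0_le_integral => //.
      - by move=> x _; rewrite lee_fin mulr_ge0// ?exprn_ge0// ltW.
      - exact: measurable_funTS.
      - move=> x [rp crp]; rewrite EFinM; apply: lee_pmul;
          [by rewrite lee_fin exprn_ge0// ltW|by rewrite lee_fin ltW| |by rewrite lee_fin].
        apply: lee_pexpe; first exact: ltW.
        by apply: lratio_ge => //; exact: lt_le_trans rp.
    by apply: ge0_subset_integral.
  rewrite muleC -lee_pdivlMr ?mulr_gt0 ?exprn_gt0// => /le_trans; apply.
  rewrite -EFinM lee_fin /th expr_div_n le_eqVlt; apply/orP; left; apply/eqP.
  by field; rewrite !gt_eqF// exprn_gt0.
(* [th < 1], so the bounds tend to [0] as [j] grows *)
exists A; split => //.
apply/eqP; rewrite -measure_le0; apply/lee_addgt0Pr => e e0; rewrite add0e.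
have : (fun j => r^-1 * th ^+ j) @ \oo --> r^-1 * 0.
  by apply: cvgM; [exact: cvg_cst|apply: cvg_expr; rewrite ger0_norm;
    have /andP[] := th01].
rewrite mulr0 => /cvgr0Pnorm_le/(_ e e0)[N _ hN].
apply: (le_trans (nuA N.+1 isT)); rewrite lee_fin.
by have := hN N.+1 (leqnSn N); rewrite /= => /ler_normlP[].
Qed.

Lemma ae_ratio_le t1 t2 :
  (forall j, (1 <= j)%N -> (sup_ratio_moment nu p That j < (c ^+ j)%:E)%E) ->
  0 < c -> That t1 -> That t2 ->
  {ae nu, forall x : borel chi, p x t1 <= c * p x t2}.
Proof.
move=> mom c0 h1 h2.
pose A n := [set x : borel chi | n.+1%:R^-1 <= p x t1 /\
  (c + n.+1%:R^-1) * p x t2 <= p x t1].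
have : nu.-negligible (\bigcup_n A n).
  apply: negligible_bigcup => n.
  by apply: moments_lratio_null; rewrite ?invr_gt0.
rewrite /almost_everywhere; apply: negligibleS => x /= /negP.
rewrite -ltNge => cp; have p2 : 0 <= p x t2 by exact: p0.
have p1 : 0 < p x t1 by apply: le_lt_trans cp; rewrite mulr_ge0// ltW.
have d0 : 0 < p x t1 - c * p x t2 by rewrite subr_gt0.
have q0 : 0 < p x t2 + 1 by exact: ltr_wpDl.
have [n _ hn] := near_infty_natSinv_lt (PosNum (divr_gt0 d0 q0)).
have [m _ hm] := near_infty_natSinv_lt (PosNum p1).
exists (maxn n m) => //; have /= := hn _ (leq_maxl n m); have /= := hm _ (leq_maxr n m).
set r := _^-1 => rp; rewrite (ltr_pdivlMr _ _ q0) => rd.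
have r0 : 0 < r by rewrite invr_gt0.
by split; [exact: ltW|rewrite -/r mulrDl; lra].
Qed.

End ratio_bound.

(** * Functions that are continuous on a compact set *)

Section continuity_on_compact.
Context {R : realType} {V : pseudoPMetricType R}.

Lemma continuous_borel_measurable (g : V -> R) :
  continuous g -> measurable_fun setT (g : borel V -> R).
Proof.
move=> /continuousP cg.
apply: (measurability _ (RGenOpens.measurableE R)) => //.
move=> _ [_ [a [b ->]] <-]; rewrite setTI; apply: sub_sigma_algebra.
by apply: cg; exact: interval_open.
Qed.

Lemma uniformly_continuous_on (A : set V) (g : V -> R) (e : R) : compact A ->
  {within A, continuous g} -> 0 < e ->
  exists2 r, 0 < r & forall x y, A x -> A y -> ball x r y -> `|g x - g y| <= e.
Proof.
move=> cA cg e0; apply: contrapT => nr.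
have /choice[xy xyP] : forall n : nat, exists xy : V * V,
    [/\ A xy.1, A xy.2, ball xy.1 n.+1%:R^-1 xy.2 & e < `|g xy.1 - g xy.2|].
  move=> n; apply: contrapT => nxy; apply: nr; exists n.+1%:R^-1.
    by rewrite invr_gt0.
  move=> x y Ax Ay xyn; rewrite leNgt; apply/negP => exy.
  by apply: nxy; exists (x, y).
have [x [Ax clx]] : A `&` cluster ((xy n).1 @[n --> \oo]) !=set0.
  by apply: cA; apply: (@filterE _ \oo) => n; have [] := xyP n.
have e20 : 0 < e / 2 by rewrite divr_gt0.
have /(@cvgrPdist_lt _ R^o)/(_ _ e20) : g @ within A (nbhs x) --> g x.
  by have /subspace_continuousP/(_ x Ax) := cg.
rewrite /= /within/= -nbhs_ballE => -[r /= r0 hr].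
have r20 : 0 < r / 2 by rewrite divr_gt0.
have [N _ hN] := near_infty_natSinv_lt (PosNum r20).
have [|y [/= [n Nn <-]] xn] := clx ((fun n => (xy n).1) @` [set n | (N <= n)%N]) _ _
    (nbhsx_ballx x _ r20).
  by exists N => // n /= Nn; exists n.
have [A1 A2 xyn exy] := xyP n.
have h1 : `|g x - g (xy n).1| < e / 2.
  by apply: hr => //=; apply: le_ball xn; rewrite ler_pdivrMr// mulr2n mulrDr mulr1 lerDl ltW.
have h2 : `|g x - g (xy n).2| < e / 2.
  apply: hr => //=; rewrite [r]splitr; apply: (@ball_triangle _ _ (xy n).1) => //.
  by apply: le_ball xyn; apply: ltW; have := hN n Nn.
move: exy; rewrite ltNge => /negP; apply.
rewrite -(subrKA (g x)) (le_trans (ler_normD _ _))// [leRHS]splitr.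
by rewrite lerD// ltW// distrC.
Qed.

(** Composition with it extends functions on [A] to the whole space without
    leaving their range on [A]. *)
Definition retract (A : set V) (a0 : V) (x : V) : V := if `[< A x >] then x else a0.

Lemma retract_id A a0 x : A x -> retract A a0 x = x.
Proof. by rewrite /retract; case: asboolP. Qed.

Lemma retract_in A a0 x : A a0 -> A (retract A a0 x).
Proof. by rewrite /retract; case: asboolP. Qed.

Lemma measurable_retract_preimage (A B : set V) a0 :
  measurable (A : set (borel V)) -> measurable (B : set (borel V)) ->
  measurable (retract A a0 @^-1` B : set (borel V)).
Proof.
move=> mA mB; have [Ba0|Ba0] := pselect (B a0).
  rewrite (_ : _ @^-1` B = (A `&` B) `|` ~` A).
    by apply: measurableU; [exact: measurableI|exact: measurableC].
  apply/seteqP; split => x /=; rewrite /retract; case: asboolP => //; tauto.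
rewrite (_ : _ @^-1` B = A `&` B); first exact: measurableI.
by apply/seteqP; split => x /=; rewrite /retract; case: asboolP => //; tauto.
Qed.

(** Approximate the second argument by one of countably many points, selected by
    initial bits of its code. *)
Lemma measurable_continuous_on {d} {S : measurableType d} (A : set V) (a0 : V)
    (p : S -> V -> R) :
  compact A -> A a0 -> measurable (A : set (borel V)) ->
  (forall t, A t -> measurable_fun setT (p ^~ t)) ->
  (forall x, {within A, continuous (p x)}) ->
  measurable_fun setT (fun z : S * borel V => p z.1 (retract A a0 z.2)).
Proof.
move=> cA Aa0 mA mp cp; have [beta [mbeta codeP]] := compact_bit_code cA.
pose beta' i (t : borel V) := beta i (retract A a0 t).
have mbeta' i : measurable [set t | beta' i t].
  exact: (@measurable_retract_preimage A [set t | beta i t]).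
have [pt pt_A pt_code] := coded_points beta Aa0.
pose h n (z : S * borel V) := p z.1 (pt (word (beta' ^~ z.2) n)).
apply: (measurable_fun_cvg (h := h)) => [n|[x t] _].
  move=> _ B mB; rewrite setTI.
  rewrite (_ : _ @^-1` B = \bigcup_s ((p ^~ (pt s) @^-1` B) `*`
      [set t | word (beta' ^~ t) n = s])).
    apply: countable_bigcupT_measurable => [|s]; first exact: countableP.
    apply: measurableX; last exact: (measurable_word n [set s] mbeta').
    rewrite -[X in measurable X]setTI; apply: mp => //; exact: pt_A.
  apply/seteqP; split => [[x t] /= Bxt|[x t] [s _ [/= Bx ts]]].
    by exists (word (beta' ^~ t) n).
  by rewrite /h/= ts.
apply/cvgrPdist_le => e e0 /=.
have [r r0 hr] := uniformly_continuous_on cA (cp x) e0.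
have [J hJ] := codeP _ r0.
exists J => // n /= Jn; apply: hr; [exact: retract_in|exact: pt_A|].
apply: hJ => [||i iJ]; [exact: retract_in|exact: pt_A|].
suff /eq_word/(_ i (leq_trans iJ Jn)) : word (beta ^~ (retract A a0 t)) n =
    word (beta ^~ (pt (word (beta' ^~ t) n))) n by [].
by rewrite pt_code//; exact: retract_in.
Qed.

End continuity_on_compact.

(** * The normalised kernel *)

(** The join of the two structures that [borel] sets and [ball]s come from. *)
HB.instance Definition _ (R : realType) (k : nat) := Pointed.on 'rV[R]_k.

Section normalised_kernel.
Context {R : realType} {k : nat} {chi : ptopologicalType}.
Local Notation V := 'rV[R]_k.
Variables (nu : {measure set (borel chi) -> \bar R})
  (mu : {measure set (borel V) -> \bar R}).
Variables (Theta : set V) (t0 : V) (p : chi -> V -> R) (b : R).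
Hypothesis compact_Theta : compact Theta.
Hypothesis measurable_Theta : measurable (Theta : set (borel V)).
Hypothesis Theta_t0 : Theta t0.
Hypothesis density_p : forall t, Theta t -> is_density nu (p ^~ t).
Hypothesis continuous_p : forall x, {within Theta, continuous (p x)}.
Hypothesis bounded_p : forall x, exists C, forall t, Theta t -> `|p x t| <= C.
Hypothesis b_ge1 : 1 <= b.
Hypothesis ae_ratio : forall t1 t2, Theta t1 -> Theta t2 ->
  {ae nu, forall x : borel chi, p x t1 <= b * p x t2}.

Let b_gt0 : 0 < b. Proof. exact: lt_le_trans ltr01 b_ge1. Qed.

Definition pbar (x : chi) (t : V) : R := p x (retract Theta t0 t).

Let retract_Theta t : Theta (retract Theta t0 t). Proof. exact: retract_in. Qed.

Let pbar_ge0 x t : 0 <= pbar x t.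
Proof. by have [_ + _] := density_p (retract_Theta t); exact. Qed.

Let measurable_pbar :
  measurable_fun setT (fun z : borel chi * borel V => pbar z.1 z.2).
Proof.
apply: (@measurable_continuous_on _ _ _ (borel chi) Theta t0 p) => // t Tt.
by have [] := density_p Tt.
Qed.

Lemma bounded_pbar x : bounded_mfun (pbar x : borel V -> R).
Proof.
split; last by have [C hC] := bounded_p x; exists C => t; exact: hC.
have := measurableT_comp measurable_pbar (@measurable_fun_pair _ _ _
  (borel V) (borel chi) (borel V) (fun=> x) id _ _).
by apply.
Qed.

Section mixing_density.
Variables (g : V -> R) (G : probability (borel V) R).
Hypothesis density_g : is_density mu g.
Hypothesis G_g : forall A, G A = (\int[mu]_(t in A) (g t)%:E)%E.
Hypothesis g_Theta : forall t, ~ Theta t -> g t = 0.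

Lemma mixture_mean x : mixture mu Theta p g x = \int[G]_t pbar x t.
Proof.
rewrite /mixture Rintegral_mkcond /Rintegral; congr fine.
have [_] := mean_density density_g (fun A _ => G_g A) (bounded_pbar x).
rewrite -(bounded_mfun_EFin G (bounded_pbar x)) => <-.
apply: eq_integral => t _; rewrite patchE.
case: ifPn => [/set_mem Tt|/negP Tt].
  by rewrite /pbar retract_id.
by rewrite g_Theta ?mulr0// => Tt'; apply: Tt; exact/mem_set.
Qed.

Lemma measurable_mixture :
  measurable_fun setT (mixture mu Theta p g : borel chi -> R).
Proof.
rewrite (_ : mixture mu Theta p g = (fun x => \int[G]_t pbar x t)); last first.
  by apply/funext => x; exact: mixture_mean.
apply: measurableT_comp => //.
apply: (@measurable_fun_fubini_tonelli_F _ _ (borel chi) (borel V) _ G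
  (fun z => (pbar z.1 z.2)%:E)); first exact/measurable_EFinP.
by move=> z; rewrite lee_fin.
Qed.

Lemma mixture_ge0 x : 0 <= mixture mu Theta p g x.
Proof. by rewrite mixture_mean; apply: Rintegral_ge0 => t _. Qed.

Lemma G_Theta : G Theta = 1%E.
Proof.
have [mg g0 g1] := density_g.
rewrite G_g integral_mkcond -g1; apply: eq_integral => t _; rewrite patchE.
case: ifPn => // /negP tT; rewrite g_Theta// => Tt; apply: tT; exact/mem_set.
Qed.

End mixing_density.

(** The exceptional null set depends on the pair of parameters.  Countably many pairs
    suffice, by uniform continuity in the parameter. *)
Lemma ae_ratio_all : {ae nu, forall x : borel chi, forall t1 t2, Theta t1 -> Theta t2 ->
  p x t1 <= b * p x t2}.
Proof.
have [beta [mbeta codeP]] := compact_bit_code compact_Theta.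
have [pt pt_A pt_code] := coded_points beta Theta_t0.
have : {ae nu, forall x : borel chi, forall s s', p x (pt s) <= b * p x (pt s')}.
  suff : {ae nu, forall x : borel chi, forall n : nat, if unpickle n is Some (s, s') then
      p x (pt s) <= b * p x (pt s') else true}.
    by apply: filterS => x H s s'; have := H (pickle (s, s')); rewrite pickleK.
  apply: ae_foralln => n; case: unpickle => [[s s']|]; first exact: ae_ratio.
  exact: aeW.
apply: filterS => x hx t1 t2 T1 T2; apply/ler_addgt0Pr => e e0.
have e1 : 0 < e / (1 + b) by rewrite divr_gt0// addr_gt0.
have [r r0 hr] := uniformly_continuous_on compact_Theta (@continuous_p x) e1.
have [J hJ] := codeP _ r0.
have near t : Theta t ->
    `|p x t - p x (pt (word (beta ^~ t) J))| <= e / (1 + b).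
  move=> Tt; apply: hr => //; apply: hJ => // i iJ.
  suff /eq_word/(_ i iJ) : word (beta ^~ t) J =
    word (beta ^~ (pt (word (beta ^~ t) J))) J by [].
  by rewrite pt_code.
have := near t1 T1; have := near t2 T2.
have := hx (word (beta ^~ t1) J) (word (beta ^~ t2) J).
set a1 := p x (pt _); set a2 := p x (pt (word (beta ^~ t2) J)).
rewrite !ler_norml => h /andP[h1 _] /andP[_ h2].
have -> : e = e / (1 + b) + b * (e / (1 + b)) by field; rewrite gt_eqF// addr_gt0.
have : b * a2 <= b * (p x t2 + e / (1 + b)).
  rewrite ler_wpM2l ?(ltW b_gt0)//.
  by move: h1; rewrite lerNl opprB lerBlDl.
rewrite mulrDr => h3; rewrite addrCA; apply: (@le_trans _ _ (e / (1 + b) + a1)).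
  by rewrite -lerBlDr.
by rewrite lerD2l (le_trans h).
Qed.

Section target.
Variables (f : V -> R) (F : probability (borel V) R) (Q : probability (borel chi) R)
  (good : set chi).
Hypothesis density_f : is_density mu f.
Hypothesis F_f : forall A, F A = (\int[mu]_(t in A) (f t)%:E)%E.
Hypothesis f_Theta : forall t, ~ Theta t -> f t = 0.
Local Notation m := (mixture mu Theta p f).
Hypothesis Q_m : forall A, measurable A -> Q A = (\int[nu]_(x in A) (m x)%:E)%E.
Hypothesis measurable_good : measurable (good : set (borel chi)).
Hypothesis good_null : nu (~` good) = 0%E.
Hypothesis good_ratio : forall x, good x -> forall t1 t2, Theta t1 -> Theta t2 ->
  p x t1 <= b * p x t2.

(** Off the set of regular observations, which has full measure, the value [1]
    keeps all properties of the kernel valid everywhere. *)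
Definition regular (x : chi) : Prop := good x /\ 0 < m x.

Definition normalised_kernel (x : chi) (t : V) : R :=
  if `[< regular x >] then pbar x t / m x else 1.
Local Notation kappa := normalised_kernel.

Let mm : measurable_fun setT (m : borel chi -> R).
Proof. exact: measurable_mixture density_f F_f f_Theta. Qed.

Let m_ge0 x : 0 <= m x.
Proof. exact: (mixture_ge0 density_f F_f f_Theta). Qed.

Let mE x : m x = \int[F]_t pbar x t.
Proof. exact: (mixture_mean density_f F_f f_Theta). Qed.

Let density_m : is_density nu m.
Proof.
split => //; rewrite -Q_m//; exact: probability_setT.
Qed.

Lemma measurable_regular : measurable (regular : set (borel chi)).
Proof.
have -> : regular = good `&` [set x | 0 < m x] by [].
apply: measurableI => //.
rewrite (_ : [set x | _] = ~` [set x | m x <= 0]).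
  by apply: measurableC; exact: (measurable_ler_set mm).
by apply/seteqP; split => x /=; rewrite ltNge => /negP.
Qed.

(** At a good [x] with [m x = 0] the density vanishes for all parameters, since each
    [p x t] is at most [b] times the average [m x]. *)
Lemma ae_regular : {ae nu, forall x : borel chi, regular x \/
  (m x = 0 /\ forall t, Theta t -> p x t = 0)}.
Proof.
exists (~` good); split => //; first exact: measurableC.
move=> x /= nx gx; apply: nx; have := m_ge0 x; rewrite le_eqVlt.
move=> /predU1P[m0|m0]; last by left.
right; split => // t Tt; apply/eqP; rewrite eq_le.
have [_ + _] := density_p Tt; move=> -> ; rewrite andbT.
apply: (@le_trans _ _ (b * m x)); last by rewrite -m0 mulr0.
rewrite mE -(mean_cst F (p x t)) -meanZl; last exact: bounded_pbar.
apply: le_mean; first exact: bounded_mfun_cst.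
- apply: bounded_mfunM; [exact: bounded_mfun_cst|exact: bounded_pbar].
- by move=> s; exact: good_ratio.
Qed.

Lemma Q_regular : Q regular = 1%E.
Proof.
rewrite -(probability_setT Q) !Q_m//; last exact: measurable_regular.
rewrite integral_mkcond; apply: ae_eq_integral => //.
- apply/(measurable_restrictT _ _).1; first exact: measurable_regular.
  by apply/measurable_EFinP; exact: measurable_funTS.
- exact/measurable_EFinP.
apply: filterS ae_regular => x [rx|[mx0 _]] _; rewrite patchE.
  by rewrite mem_set.
by case: ifPn => //; rewrite mx0.
Qed.

Lemma measurable_normalised_kernel :
  measurable_fun setT (fun z : borel chi * borel V => kappa z.1 z.2).
Proof.
apply: measurable_fun_ifT => //.
- have -> : (fun z : borel chi * borel V => `[< regular z.1 >]) =
      (fun x : borel chi => `[< regular x >]) \o fst by [].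
  apply: measurableT_comp => //; apply: (measurable_fun_bool true) => //.
  rewrite setTI (_ : _ @^-1` _ = regular); first exact: measurable_regular.
  by apply/seteqP; split => x /= /asboolP.
- apply: measurable_funM => //; apply: ge0_measurable_funV => //.
  exact: (measurableT_comp mm measurable_fst).
Qed.

(** [m x] is an average of densities that are all within a factor [b]. *)
Lemma normalised_kernel_itv x t : b^-1 <= kappa x t <= b.
Proof.
rewrite /kappa; case: asboolP => [[gx m0]|_]; last by rewrite invf_le1 ?b_ge1.
rewrite ler_pdivlMr// ler_pdivrMr// ler_pdivrMl// mulrC.
rewrite -(mulrC b) mE -meanZl; last exact: bounded_pbar.
have bb : bounded_mfun (fun s : borel V => b * pbar x s).
  by apply: bounded_mfunM; [exact: bounded_mfun_cst|exact: bounded_pbar].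
apply/andP; split.
  rewrite -[leRHS](mean_cst F); apply: le_mean.
  - exact: bounded_pbar.
  - exact: bounded_mfun_cst.
  - by move=> s; exact: good_ratio.
rewrite -[leLHS](mean_cst F); apply: le_mean => //.
- exact: bounded_mfun_cst.
- by move=> s; exact: good_ratio.
Qed.

Lemma normalised_kernel_Q t : \int[Q]_x kappa x t = 1.
Proof.
have bk : bounded_mfun (kappa ^~ t : borel chi -> R).
  have bk2 := bounded_mfun_itv measurable_normalised_kernel
    (fun z => normalised_kernel_itv z.1 z.2).
  exact: (bounded_mfun_pairr (t : borel V) bk2).
apply: EFin_inj; rewrite -(mean_density density_m Q_m bk).2.
have [mp p0 <-] := density_p (retract_Theta t).
apply: ae_eq_integral => //.
- by apply/measurable_EFinP; apply: measurable_funM => //; case: bk.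
- exact/measurable_EFinP.
apply: filterS ae_regular => x [rx|[mx0 px0]] _; congr EFin.
  rewrite /kappa asboolT// mulfVK// gt_eqF//; by case: rx.
by rewrite mx0 mulr0 px0.
Qed.

Lemma normalised_kernel_F x : \int[F]_t kappa x t = 1.
Proof.
rewrite /kappa; case: asboolP => [[gx m0]|_]; last exact: mean_cst.
by rewrite meanZr -?mE ?divff// ?gt_eqF//; exact: bounded_pbar.
Qed.

End target.

End normalised_kernel.

(** * Consequences for the recursion *)

(** A Donsker-Varadhan bound, from [ln z <= z - 1] at [z = h * f0 / f]. *)
Lemma mean_ln_le_divergence {d} {T : measurableType d} {R : realType}
  (mu : {measure set T -> \bar R}) (f f0 : T -> R) (F F0 : probability T R) :
  is_density mu f -> (forall A, F A = (\int[mu]_(t in A) (f t)%:E)%E) ->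
  is_density mu f0 -> (forall A, F0 A = (\int[mu]_(t in A) (f0 t)%:E)%E) ->
  kullback_leibler mu f f0 \is a fin_num ->
  forall h, pos_density F0 h ->
  \int[F]_t ln (h t) <= fine (kullback_leibler mu f f0).
Proof.
move=> df Ff df0 F0f kl_fin h [bh [c c0 ch] h1].
have [mf f_ge0 f1] := df; have [mf0 f0_ge0 f01] := df0.
pose K t := ((f t)%:E * lne ((f t)%:E / (f0 t)%:E))%E.
have KE t : K t = if f t == 0 then 0%E else if f0 t == 0 then +oo%E
    else (f t * ln (f t / f0 t))%:E.
  rewrite /K; case: eqP => [->|/eqP ft]; first by rewrite mul0e.
  have ft0 : 0 < f t by rewrite lt_neqAle eq_sym ft f_ge0.
  rewrite inver; case: ifPn => f0t.
    by rewrite gt0_muley ?lte_fin// [lne _]/= gt0_muley// lte_fin.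
  have f0t0 : 0 < f0 t by rewrite lt_neqAle eq_sym f0t f0_ge0.
  by rewrite -EFinM lne_EFin// divr_gt0.
have mK : measurable_fun setT K.
  rewrite (funext KE); apply: measurable_fun_ifT => //.
    exact: measurable_fun_eqr.
  apply: measurable_fun_ifT => //; first exact: measurable_fun_eqr.
  apply/measurable_EFinP; apply: measurable_funM => //.
  apply: (measurableT_comp (@measurable_ln R)).
  by apply: measurable_funM => //; exact: ge0_measurable_funV.
have iK : mu.-integrable setT K.
  apply/integrableP; split => //; apply/abse_integralP => //.
  by move: kl_fin; rewrite -abse_fin_num -ge0_fin_numE.
have bln : bounded_mfun (fun t => ln (h t)) by exact: (bounded_mfun_ln c0).
have [ilnf lnfE] := mean_density df (fun A _ => Ff A) bln.
have [ihf0 hf0E] := mean_density df0 (fun A _ => F0f A) bh.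
have if_ : mu.-integrable setT (EFin \o f).
  have [+ _] := mean_density df (fun A _ => Ff A) (bounded_mfun_cst (1 : R)).
  by apply: eq_integrable => // t _; rewrite mul1r.
rewrite -lee_fin -lnfE fineK//.
have -> : kullback_leibler mu f f0 =
    (\int[mu]_t (K t + ((h t * f0 t)%:E - (f t)%:E)))%E.
  rewrite integralD//; last exact: integrableB.
  by rewrite integralB// hf0E h1 f1 subee// adde0.
apply: le_integral => //.
  by apply: integrableD => //; exact: integrableB.
move=> t _; rewrite KE; case: eqP => [->|/eqP ft].
  by rewrite mulr0 add0e sube0 lee_fin mulr_ge0// (le_trans _ (ch t))// ltW.
case: eqP => [f0t|/eqP f0t]; first by rewrite addye// leey.
have ft0 : 0 < f t by rewrite lt_neqAle eq_sym ft f_ge0.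
have f0t0 : 0 < f0 t by rewrite lt_neqAle eq_sym f0t f0_ge0.
have ht0 : 0 < h t by exact: lt_le_trans (ch t).
rewrite -EFinB -EFinD lee_fin.
have := @le_ln1Dx R (h t * (f0 t / f t) - 1); rewrite subrKC.
have z0 : 0 < f0 t / f t by rewrite divr_gt0.
rewrite lnM ?posrE// -[ln (_ / f t)]opprK -lnV ?posrE// invf_div.
have -> : -1 < h t * (f0 t / f t) - 1 by rewrite ltrBrDr addNr mulr_gt0.
move=> /(_ isT) /(ler_wpM2l (ltW ft0)).
have -> : f t * (h t * (f0 t / f t) - 1) = h t * f0 t - f t.
  by field; rewrite gt_eqF.
by rewrite mulrBr lerBlDl mulrC.
Qed.

Section from_tilts_to_iterates.
Context {R : realType} {k : nat} {chi : ptopologicalType}.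
Local Notation V := 'rV[R]_k.
Variables (nu : {measure set (borel chi) -> \bar R})
  (mu : {measure set (borel V) -> \bar R}).
Variables (Theta : set V) (t0 : V) (p : chi -> V -> R) (b : R).
Hypothesis compact_Theta : compact Theta.
Hypothesis measurable_Theta : measurable (Theta : set (borel V)).
Hypothesis Theta_t0 : Theta t0.
Hypothesis density_p : forall t, Theta t -> is_density nu (p ^~ t).
Hypothesis continuous_p : forall x, {within Theta, continuous (p x)}.
Hypothesis bounded_p : forall x, exists C, forall t, Theta t -> `|p x t| <= C.
Hypothesis b_ge1 : 1 <= b.
Variables (f f0 : V -> R) (F F0 : probability (borel V) R)
  (Q : probability (borel chi) R) (good : set chi).
Hypothesis density_f : is_density mu f.
Hypothesis F_f : forall A, F A = (\int[mu]_(t in A) (f t)%:E)%E.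
Hypothesis f_Theta : forall t, ~ Theta t -> f t = 0.
Hypothesis density_f0 : is_density mu f0.
Hypothesis F0_f0 : forall A, F0 A = (\int[mu]_(t in A) (f0 t)%:E)%E.
Hypothesis f0_Theta : forall t, ~ Theta t -> f0 t = 0.
Local Notation m := (mixture mu Theta p f).
Hypothesis Q_m : forall A, measurable A -> Q A = (\int[nu]_(x in A) (m x)%:E)%E.
Hypothesis measurable_good : measurable (good : set (borel chi)).
Hypothesis good_null : nu (~` good) = 0%E.
Hypothesis good_ratio : forall x, good x -> forall t1 t2, Theta t1 -> Theta t2 ->
  p x t1 <= b * p x t2.
Local Notation kappa :=
  (normalised_kernel mu Theta t0 p f good : borel chi -> borel V -> R).
Local Notation regular := (regular mu Theta p f good).
Local Notation pbar := (pbar Theta t0 p).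

Let measurable_kappa :
  measurable_fun setT (fun z : borel chi * borel V => kappa z.1 z.2).
Proof.
exact: (measurable_normalised_kernel compact_Theta measurable_Theta Theta_t0
  density_p continuous_p bounded_p density_f F_f f_Theta measurable_good).
Qed.

Let kappa_itv x t : b^-1 <= kappa x t <= b.
Proof.
exact: (normalised_kernel_itv compact_Theta measurable_Theta Theta_t0
  density_p continuous_p bounded_p b_ge1 density_f F_f f_Theta good_ratio).
Qed.

Let bounded_pb x : bounded_mfun (pbar x : borel V -> R).
Proof.
exact: (bounded_pbar compact_Theta measurable_Theta Theta_t0 density_p
  continuous_p bounded_p).
Qed.

Let m_gt0 x : regular x -> 0 < m x. Proof. by case. Qed.

Lemma density_tilted h : pos_density F0 h -> is_density mu (fun t => f0 t * h t).
Proof.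
move=> [bh [c c0 ch] h1]; have [mf0 f0_ge0 _] := density_f0.
split.
- by apply: measurable_funM => //; case: bh.
- by move=> t; rewrite mulr_ge0// (le_trans _ (ch t))// ltW.
- under eq_integral do rewrite mulrC.
  by rewrite (mean_density density_f0 (fun A _ => F0_f0 A) bh).2 h1.
Qed.

Lemma mean_tilted h (G : probability (borel V) R) (u : borel V -> R) :
  pos_density F0 h ->
  (forall A, G A = (\int[mu]_(t in A) (f0 t * h t)%:E)%E) ->
  bounded_mfun u -> \int[G]_t u t = \int[F0]_t (u t * h t).
Proof.
move=> hh G_h bu; have [bh _ _] := hh; apply: EFin_inj.
rewrite -(mean_density (density_tilted hh) (fun A _ => G_h A) bu).2.
rewrite -(mean_density density_f0 (fun A _ => F0_f0 A) (bounded_mfunM bu bh)).2.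
by apply: eq_integral => t _; rewrite mulrA mulrAC.
Qed.

Lemma mean_pbar_tilted h (G : probability (borel V) R) x : regular x ->
  pos_density F0 h ->
  (forall A, G A = (\int[mu]_(t in A) (f0 t * h t)%:E)%E) ->
  \int[G]_t pbar x t = m x * mix F0 kappa h x.
Proof.
move=> rx hh G_h; rewrite (mean_tilted hh G_h)//; have [bh _ _] := hh.
rewrite /mix -meanZl.
  apply: eq_Rintegral => t _; rewrite /normalised_kernel asboolT//.
  by field; rewrite gt_eqF// m_gt0.
apply: bounded_mfunM => //; rewrite /normalised_kernel asboolT//.
by apply: bounded_mfunM => //; exact: bounded_mfun_cst.
Qed.

(** On regular data the factor [m] cancels between the density and the mixture in the
    denominator. *)
Lemma pred_rec_tilts (w : nat -> R) (x : nat -> chi) n :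
  (forall i, 0 <= w i.+1 <= 1) -> (forall i, regular (x i.+1)) ->
  pred_rec mu Theta p w f0 x n = (fun t => f0 t * tilts F0 kappa w x n t).
Proof.
move=> w01 rx; elim: n => [|n IH]; first by apply/funext => t /=; rewrite mulr1.
apply/funext => t; rewrite /= IH.
have hh : pos_density F0 (tilts F0 kappa w x n).
  exact: (tilts_pos_density F0 measurable_kappa b_ge1 kappa_itv w01).
have [G hG] := is_density_probability (density_tilted hh).
have -> : mixture mu Theta p (fun t => f0 t * tilts F0 kappa w x n t) (x n.+1) =
    m (x n.+1) * mix F0 kappa (tilts F0 kappa w x n) (x n.+1).
  rewrite -(mean_pbar_tilted (rx n) hh hG).
  apply: (mixture_mean compact_Theta measurable_Theta Theta_t0 density_p
    continuous_p bounded_p (density_tilted hh) hG) => s Ts.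
  by rewrite f0_Theta// mul0r.
have [Tt|Tt] := pselect (Theta t); last by rewrite f0_Theta// !(mul0r, mulr0) addr0.
have -> : p (x n.+1) t = m (x n.+1) * kappa (x n.+1) t.
  rewrite /normalised_kernel asboolT// /pbar retract_id// mulrC divfK//.
  by rewrite gt_eqF// m_gt0.
rewrite /tilt; field; rewrite !gt_eqF// ?m_gt0//.
exact: (mix_gt0 measurable_kappa b_ge1 kappa_itv hh).
Qed.

Let kappa_Q t : \int[Q]_x kappa x t = 1.
Proof.
exact: (normalised_kernel_Q compact_Theta measurable_Theta Theta_t0 density_p
  continuous_p bounded_p b_ge1 density_f F_f f_Theta Q_m measurable_good
  good_null good_ratio).
Qed.

Let ae_Q_nu (A : set (borel chi)) : {ae Q, forall x, A x} ->
  {ae nu, forall x : borel chi, 0 < m x -> A x}.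
Proof.
move=> [N [mN N0 AN]].
have mm : measurable_fun setT (m : borel chi -> R).
  exact: (measurable_mixture compact_Theta measurable_Theta Theta_t0 density_p
    continuous_p bounded_p density_f F_f f_Theta).
have m_ge0 x : 0 <= m x.
  exact: (mixture_ge0 compact_Theta measurable_Theta Theta_t0 density_p
    continuous_p bounded_p density_f F_f f_Theta).
have : (\int[nu]_(x in N) `|(m x)%:E|)%E = 0%E.
  rewrite -N0 Q_m//; apply: eq_integral => x _.
  by rewrite gee0_abs// lee_fin.
have mmN : measurable_fun N (fun x : borel chi => (m x)%:E).
  by apply/measurable_EFinP; exact: measurable_funTS.
move/(ae_eq_integral_abs nu mN mmN) => H.
apply: filterS H => x Hx mx; apply: contrapT => nA.
have := Hx (AN _ nA) => -[mx0]; by rewrite mx0 ltxx in mx.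
Qed.

(** Summable divergences make the series of the [(1 - M) ^ 2 / M] finite almost
    everywhere, and [M <= b]. *)
Let ae_mix_cvg1 (h : nat -> borel V -> R) : (forall n, pos_density F0 (h n)) ->
  (forall n, chi2_to_target Q F0 kappa (h n) <= 2^-1 ^+ n) ->
  {ae Q, forall x, (mix F0 kappa (h n) x) @[n --> \oo] --> (1 : R)}.
Proof.
move=> hh chi2h.
pose u n x := (1 - mix F0 kappa (h n) x) ^+ 2 / mix F0 kappa (h n) x.
have M0 n x : 0 < mix F0 kappa (h n) x.
  exact: (mix_gt0 measurable_kappa b_ge1 kappa_itv (hh n)).
have bM n : bounded_mfun (mix F0 kappa (h n)).
  exact: (bounded_mix measurable_kappa kappa_itv (hh n)).
have u_ge0 n x : 0 <= u n x by rewrite divr_ge0 ?sqr_ge0// ltW.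
have bu n : bounded_mfun (u n).
  have b1 := bounded_mfunB (bounded_mfun_cst (1 : R)) (bM n).
  apply: bounded_mfunM; first exact: bounded_mfunM.
  exact: (bounded_invmix measurable_kappa b_ge1 kappa_itv (hh n)).
have sum_u n : \sum_(0 <= i < n) \int[Q]_x u i x <= 2.
  have : \sum_(0 <= i < n) \int[Q]_x u i x <= 2 - 2 * 2^-1 ^+ n.
    elim: n => [|n IH]; first by rewrite big_geq// expr0 mulr1 subrr.
    rewrite big_nat_recr//= (le_trans (lerD IH (_ : _ <= 2^-1 ^+ n)))//.
      rewrite -(chi2_to_targetE measurable_kappa b_ge1 kappa_itv kappa_Q (hh n)).
      exact: chi2h.
    rewrite exprS mulrA divff ?pnatr_eq0// mul1r.
    by rewrite mulr_natl mulr2n opprD addrA subrK.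
  by move=> /le_trans; apply; rewrite gerBl mulr_ge0// exprn_ge0// invr_ge0.
apply: filterS (ae_bounded_series bu u_ge0 sum_u) => x [C hC].
have u0 : u n x @[n --> \oo] --> 0.
  apply: cvg_series_cvg_0; apply: nondecreasing_is_cvgn.
    by apply/nondecreasing_seqP => n; rewrite /series/= big_nat_recr//= lerDl.
  by exists C => _ [n _ <-]; exact: hC.
have : Num.sqrt (b * u n x) @[n --> \oo] --> 0.
  have bu0 : b * u n x @[n --> \oo] --> 0.
    by have := cvgM (cvg_cst b) u0; rewrite mulr0; apply.
  by have := cvg_comp _ _ bu0 (@sqrt_continuous R 0); rewrite sqrtr0; apply.
move/cvgr0Pnorm_le => H; apply/cvgrPdist_le => e e0.
near=> n; rewrite -[leLHS]sqrtr_sqr.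
apply: (@le_trans _ _ (Num.sqrt (b * u n x))).
  rewrite ler_wsqrtr// /u mulrCA ler_peMr ?sqr_ge0// ler_pdivlMr// mul1r.
  by have /andP[] := mix_itv measurable_kappa kappa_itv (hh n) x.
rewrite -[leLHS]ger0_norm ?sqrtr_ge0//; near: n; exact: H.
Unshelve. all: by end_near.
Qed.

Hypothesis identifiable_f : identifiable nu mu Theta p f.

(** The limit of the iterates along an ultrafilter has the mixture of the target, so
    that identifiability applies to it. *)
Let ultra_mean_cvg (h : nat -> borel V -> R) (G : nat -> probability (borel V) R)
  (U : set_system nat) (g : V -> R) :
  (forall n, pos_density F0 (h n)) ->
  (forall n A, G n A = (\int[mu]_(t in A) (f0 t * h n t)%:E)%E) ->
  (forall n, chi2_to_target Q F0 kappa (h n) <= 2^-1 ^+ n) ->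
  UltraFilter U -> \oo `<=` U ->
  continuous g -> bounded_mfun (g : borel V -> R) ->
  (\int[G n]_t g t) @[n --> U] --> \int[F]_t g t.
Proof.
move=> hh Gh chi2h UU ooU cg bg.
have PU : ProperFilter U := ultra_proper.
have [G' G'Theta G'cvg] : exists2 G' : probability (borel V) R, G' Theta = 1%E &
    forall g : borel V -> R, bounded_mfun g ->
      (forall e, 0 < e -> exists2 r, 0 < r &
        forall x y, Theta x -> Theta y -> ball x r y -> `|g x - g y| <= e) ->
      (\int[G n]_x g x) @[n --> U] --> \int[G']_x g x.
  apply: ultra_weak_limit => // n.
  apply: (G_Theta (density_tilted (hh n)) (Gh n)) => t Tt.
  by rewrite f0_Theta// mul0r.
have G'C : G' (~` Theta) = 0%E.
  by rewrite probability_setC// G'Theta subee.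
have G'F A : measurable A -> G' A = F A.
  move=> mA; rewrite F_f; apply: identifiable_f => //.
  have := ae_Q_nu (ae_mix_cvg1 hh chi2h).
  have := ae_regular compact_Theta measurable_Theta Theta_t0 density_p
    continuous_p bounded_p density_f F_f f_Theta measurable_good good_null
    good_ratio.
  apply: filterS2 => x [rx|[mx0 px0]] H; last first.
    rewrite mx0; transitivity (\int[G']_(t in Theta) (0 : R)).
      by apply: eq_Rintegral => t /set_mem Tt; rewrite px0.
    by rewrite Rintegral_cst// mul0r.
  have {}H := H (m_gt0 rx).
  have -> : \int[G']_(t in Theta) p x t = \int[G']_t pbar x t.
    rewrite /Rintegral; congr fine.
    rewrite [RHS](@negligible_integral _ _ _ _ _ (~` Theta : set (borel V)))//; last 2 first.
    - exact: measurableC.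
    - exact: bounded_mfun_integrable.
    rewrite setTD setCK; apply: eq_integral => t /set_mem Tt.
    by rewrite /pbar retract_id.
  have l1 : (\int[G n]_t pbar x t) @[n --> U] --> \int[G']_t pbar x t.
    apply: G'cvg => // e e0.
    have [r r0 hr] := uniformly_continuous_on compact_Theta (@continuous_p x) e0.
    by exists r => // s t Ts Tt; rewrite /pbar !retract_id//; exact: hr.
  have l2 : (\int[G n]_t pbar x t) @[n --> U] --> m x.
    under eq_fun do rewrite (mean_pbar_tilted rx (hh _) (Gh _)).
    have H' : (mix F0 kappa (h n) x) @[n --> U] --> (1 : R).
      by apply: cvg_trans H; exact: cvg_app.
    by have := cvgM (cvg_cst (m x)) H'; rewrite mulr1; apply.
  exact: (cvg_unique (@norm_hausdorff _ _) l1 l2).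
have -> : \int[F]_t g t = \int[G']_t g t.
  by apply/esym; congr fine; apply: eq_measure_integral => A mA _; exact: G'F.
apply: G'cvg => // e e0.
have [r r0 hr] := uniformly_continuous_on compact_Theta
  (@continuous_subspaceT _ _ Theta g cg) e0.
by exists r.
Qed.

(** A sequence of test integrals that stays away from its limit would do so along
    a subsequence on which the divergences are summable. *)
Lemma weakly_cvg_tilted (h : nat -> borel V -> R) :
  (forall n, pos_density F0 (h n)) ->
  chi2_to_target Q F0 kappa (h n) @[n --> \oo] --> 0 ->
  weakly_cvg (fun n => mixing_dist mu (fun t => f0 t * h n t)) (mixing_dist mu f).
Proof.
move=> hh chi20 g cg bdg.
have [G Gh] : exists G : nat -> probability (borel V) R,
    forall n A, G n A = (\int[mu]_(t in A) (f0 t * h n t)%:E)%E.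
  have /choice[G Gh] n := is_density_probability (density_tilted (hh n)).
  by exists G.
have bg : bounded_mfun (g : borel V -> R).
  split; first exact: continuous_borel_measurable.
  have [M [_ hM]] := bdg; exists (M + 1) => t.
  by apply: (hM (M + 1)) => //; rewrite ltrDl.
have -> : mixing_dist mu f = F by apply/funext => A; rewrite F_f.
have -> : (fun n => \int[mixing_dist mu (fun t => f0 t * h n t)%R]_t (g t)%:E)%E =
    (fun n => (\int[G n]_t g t)%:E).
  apply/funext => n; rewrite -bounded_mfun_EFin//.
  by congr (integral _ _ _); apply/funext => A; rewrite Gh.
rewrite bounded_mfun_EFin//; apply: cvg_EFin; first exact: nearW.
rewrite (_ : _ \o _ = fun n => \int[G n]_t g t)//.
apply/cvgrPdist_le => e e0; apply: contrapT => nnear.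
have /choice[s hs] j : exists n, chi2_to_target Q F0 kappa (h n) <= 2^-1 ^+ j /\
    ~ `|\int[F]_t g t - \int[G n]_t g t| <= e.
  have e1 : 0 < 2^-1 ^+ j :> R by rewrite exprn_gt0// invr_gt0.
  have [N _ hN] : \forall n \near \oo, chi2_to_target Q F0 kappa (h n) <= 2^-1 ^+ j.
    move/cvgr0Pnorm_le: chi20 => /(_ _ e1); apply: filterS => n.
    exact: le_trans (ler_norm _).
  apply: contrapT => nex; apply: nnear; exists N => // n Nn /=.
  apply: contrapT => nle; apply: nex; exists n; split => //; exact: hN.
have [U [UU ooU]] := @ultraFilterLemma nat \oo _.
have := ultra_mean_cvg (h := h \o s) (G := G \o s) _ _ _ UU ooU cg bg.
move=> /(_ (fun n => hh _) (fun n => Gh _) (fun n => (hs n).1)).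
have PU : ProperFilter U := ultra_proper.
move/cvgrPdist_le => /(_ e e0) /(filter_ex) [n /=].
exact: (hs n).2.
Qed.
End from_tilts_to_iterates.

(** * Almost sure weak convergence of the iterates *)

Theorem theorem3p2 (R : realType) (k : nat)
  (chi : ptopologicalType)
  (nu : {sigma_finite_measure set (borel chi) -> \bar R})
  (mu : {sigma_finite_measure set (borel 'rV[R]_k) -> \bar R})
  (Theta Theta_hat : set 'rV[R]_k)
  (p : chi -> 'rV[R]_k -> R)
  (f f0 : 'rV[R]_k -> R)
  (d : measure_display) (Omega : measurableType d) (P : probability Omega R)
  (X : nat -> {mfun Omega >-> borel chi})
  (cm : forall i n : nat, i.-tuple (borel chi) -> borel chi -> R)
  (w : nat -> R) (alpha c0 rho cu a b b3 B : R)
  (Theta_H : set 'rV[R]_k) (chi_c : set chi)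
  (m := mixture mu Theta p f) (m0 := mixture mu Theta p f0)
  (sub_Theta : Theta `<=` Theta_hat)
  (closed_Theta_hat : closed Theta_hat)
  (convex_Theta_hat : convex_set (Theta_hat : set (convex_lmodType 'rV[R]_k)))
  (kernel_p : forall t, Theta_hat t -> is_density nu (p ^~ t))
  (compact_Theta : compact Theta)
  (density_f : is_density mu f)
  (support_f : closure [set t | f t != 0] = Theta)
  (density_f0 : is_density mu f0)
  (support_f0 : closure [set t | f0 t != 0] = Theta)
  (K0_fin : kullback_leibler mu f f0 \is a fin_num)
  (K0star_fin : kullback_leibler nu m m0 \is a fin_num)
  (identifiable_f : identifiable nu mu Theta p f)
  (marginal_X : forall i A, (1 <= i)%N -> measurable A ->
     distribution P (X i) A = (\int[nu]_(x in A) (m x)%:E)%E)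
  (conditional_X : forall i n, (1 <= i)%N -> (1 <= n)%N ->
     is_cond_density P nu X n (cm i n))
  (c0_gt0 : 0 < c0) (rho_01 : 0 < rho < 1)
  (dependence : forall n, (1 <= n)%N ->
     (ereal_sup [set chi2_dependence P nu X m (cm i n)
                | i in [set i | (1 <= i)%N]]
      <= (c0 ^+ 2 * rho ^+ (2 * n))%:E)%E)
  (finite_Theta_H : finite_set Theta_H)
  (sub_Theta_H : Theta_H `<=` Theta_hat)
  (compact_chi_c : compact chi_c)
  (cu_gt1 : 1 < cu)
  (C1 : forall x, ~ chi_c x -> exists t1 t2, [/\ Theta_H t1, Theta_H t2 &
     (ereal_sup [set lratio p x t t' | t in Theta & t' in Theta]
      <= cu%:E * lratio p x t2 t1)%E])
  (a_gt0 : 0 < a)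
  (C2 : (a%:E < ereal_inf [set (p x t)%:E | x in chi_c & t in Theta])%E)
  (C3 : (ereal_sup [set (p x t)%:E | x in chi_c & t in Theta] < b%:E)%E)
  (B1_range : forall i, (1 <= i)%N -> 0 < w i <= 1)
  (B1_decr : forall i, (1 <= i)%N -> w i.+1 <= w i)
  (B1_lim : w @ \oo --> 0)
  (B1_alpha : 2^-1 < alpha <= 1)
  (B1_equiv : w ~_\oo (fun i : nat => i%:R `^ (- alpha)))
  (b3_gt0 : 0 < b3)
  (B2' : forall j, (1 <= j)%N ->
     (sup_ratio_moment nu p Theta_hat j < (b3 ^+ j)%:E)%E)
  (B3 : (sup_ratio_moment nu p Theta_hat 2 < B%:E)%E)
  (B4 : forall x, {within Theta_hat, continuous (p x)} /\
     [bounded p x t | t in Theta_hat]) :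
  {ae P, forall omega,
     weakly_cvg
       (fun n => mixing_dist mu
          (pred_rec mu Theta p w f0 (fun i => X i omega) n))
       (mixing_dist mu f)}.
Proof.
have closed_Theta : closed Theta by rewrite -support_f; exact: closed_closure.
have measurable_Theta : measurable (Theta : set (borel 'rV[R]_k)).
  rewrite -[X in measurable X]setCK; apply: measurableC.
  by apply: sub_sigma_algebra; exact: closed_openC.
have f_Theta t : ~ Theta t -> f t = 0.
  move=> Tt; apply/eqP/negPn/negP => ft; apply: Tt.
  by rewrite -support_f; exact: subset_closure.
have f0_Theta t : ~ Theta t -> f0 t = 0.
  move=> Tt; apply/eqP/negPn/negP => ft; apply: Tt.
  by rewrite -support_f0; exact: subset_closure.
have [t0 Theta_t0] : exists t0, Theta t0.
  apply: contrapT => nT; have [_ _] := density_f.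
  rewrite integral0_eq; first by move/esym/eqP; rewrite onee_eq0.
  by move=> t _; rewrite f_Theta// => Tt; apply: nT; exists t.
have density_p t : Theta t -> is_density nu (p ^~ t) by move=> /sub_Theta/kernel_p.
have continuous_p x : {within Theta, continuous (p x)}.
  exact: (continuous_subspaceW sub_Theta (B4 x).1).
have bounded_p x : exists C, forall t, Theta t -> `|p x t| <= C.
  have [M [_ hM]] := (B4 x).2; exists (M + 1) => t Tt.
  by apply: (hM (M + 1)); [rewrite ltrDl|exact: sub_Theta].
pose b' := Num.max b3 1.
have b_ge1 : 1 <= b' by rewrite le_max lexx orbT.
have ae_ratio t1 t2 : Theta t1 -> Theta t2 ->
    {ae nu, forall x : borel chi, p x t1 <= b' * p x t2}.
  move=> T1 T2; apply: filterS (ae_ratio_le (nu := nu) (p := p) (c := b3)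
      (That := Theta_hat) _ _ B2' b3_gt0 (sub_Theta _ T1) (sub_Theta _ T2)).
  - move=> x /le_trans; apply; rewrite ler_wpM2r ?le_max ?lexx//.
    by have [_ + _] := density_p _ T2; exact.
  - by move=> t /kernel_p[].
  - by move=> x t /kernel_p[_ + _]; exact.
have [N [mN N0 ratioN]] := ae_ratio_all compact_Theta Theta_t0 continuous_p
  b_ge1 ae_ratio.
pose good : set chi := ~` N.
have measurable_good : measurable (good : set (borel chi)) by exact: measurableC.
have good_null : nu (~` good) = 0%E by rewrite setCK.
have good_ratio x : good x -> forall t1 t2, Theta t1 -> Theta t2 ->
    p x t1 <= b' * p x t2.
  by move=> gx; apply: contrapT => nx; apply: gx; exact: ratioN.
have [F F_f] := is_density_probability density_f.
have [F0 F0_f0] := is_density_probability density_f0.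
pose Q : probability (borel chi) R := distribution P (X 1%N).
have Q_m A : measurable A -> Q A = (\int[nu]_(x in A) (m x)%:E)%E.
  by move=> mA; exact: marginal_X.
have density_m : is_density nu m.
  split.
  - exact: (measurable_mixture compact_Theta measurable_Theta Theta_t0 density_p
      continuous_p bounded_p density_f F_f f_Theta).
  - exact: (mixture_ge0 compact_Theta measurable_Theta Theta_t0 density_p
      continuous_p bounded_p density_f F_f f_Theta).
  - by rewrite -Q_m//; exact: probability_setT.
pose kappa : borel chi -> borel 'rV[R]_k -> R :=
  normalised_kernel mu Theta t0 p f good.
have measurable_kappa : measurable_fun setT
    (fun z : borel chi * borel 'rV[R]_k => kappa z.1 z.2).
  exact: (measurable_normalised_kernel compact_Theta measurable_Theta Theta_t0
    density_p continuous_p bounded_p density_f F_f f_Theta measurable_good).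
have kappa_itv x t : b'^-1 <= kappa x t <= b'.
  exact: (normalised_kernel_itv compact_Theta measurable_Theta Theta_t0
    density_p continuous_p bounded_p b_ge1 density_f F_f f_Theta good_ratio).
have kappa_Q t : \int[Q]_x kappa x t = 1.
  exact: (normalised_kernel_Q compact_Theta measurable_Theta Theta_t0 density_p
    continuous_p bounded_p b_ge1 density_f F_f f_Theta Q_m measurable_good
    good_null good_ratio).
have kappa_F x : \int[F]_t kappa x t = 1.
  exact: (normalised_kernel_F compact_Theta measurable_Theta Theta_t0 density_p
    continuous_p bounded_p good density_f F_f f_Theta).
have w01 i : 0 <= w i.+1 <= 1.
  by have /andP[w0 ->] := B1_range _ (ltn0Sn i); rewrite ltW.
have mX i : measurable_fun setT (X i) by exact: measurable_funP.
have rho0 : 0 < rho by have /andP[] := rho_01.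
pose eps n := c0 * rho ^+ n.
have eps_gt0 n : 0 < eps n by rewrite mulr_gt0// exprn_gt0.
have mixing j n (Phi : j.-tuple (borel chi) * borel chi -> R) C :
    (1 <= j)%N -> (1 <= n)%N -> measurable_fun setT Phi ->
    (forall z, 0 <= Phi z <= C) ->
    \int[P]_o \int[Q]_y Phi ([tuple X i.+1 o | i < j], y) - C * eps n
      <= \int[P]_o Phi ([tuple X i.+1 o | i < j], X (j + n)%N o).
  move=> j1 n1 mPhi PhiC.
  apply: (chi2_decoupling (conditional_X _ _ j1 n1) density_m Q_m (eps_gt0 n) _ mPhi
    PhiC).
  rewrite /eps exprMn -exprM mulnC; apply: le_trans (dependence _ n1).
  by apply: ereal_sup_ubound; exists j.
have [lag [i0 [C2' [lag_itv sum_lag]]]] :=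
  power_weights_lag B1_range B1_alpha B1_equiv (ltW c0_gt0) rho_01.
have [C1' sum_w2] := sum_sqr_power_weights B1_range B1_alpha B1_equiv.
have sum_w := sum_power_weights B1_range B1_alpha B1_equiv.
have := ae_chi2_cvg0 measurable_kappa b_ge1 kappa_itv kappa_Q kappa_F w01
  mX (fun n => ltW (eps_gt0 n)) mixing
  (mean_ln_le_divergence density_f F_f density_f0 F0_f0 K0_fin) lag_itv sum_w2
  sum_lag sum_w.
have : {ae P, forall o, forall i, regular mu Theta p f good (X i.+1 o)}.
  apply: ae_foralln => i.
  have mreg := measurable_regular compact_Theta measurable_Theta Theta_t0
    density_p continuous_p bounded_p density_f F_f f_Theta measurable_good.
  have Preg : P (X i.+1 @^-1` regular mu Theta p f good) = 1%E.
    have := marginal_X _ _ (ltn0Sn i) mreg; rewrite -Q_m//.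
    rewrite (Q_regular compact_Theta measurable_Theta Theta_t0 density_p
      continuous_p bounded_p density_f F_f f_Theta Q_m measurable_good good_null
      good_ratio).
    by [].
  have mXreg : measurable (X i.+1 @^-1` regular mu Theta p f good).
    by rewrite -[X in measurable X]setTI; exact: mX.
  exists (~` (X i.+1 @^-1` regular mu Theta p f good)); split.
  - exact: measurableC.
  - by rewrite [LHS](probability_setC P)// Preg subee.
  - exact: subset_refl.
apply: filterS2 => o reg chi20.
pose x i := X i o.
have -> : (fun n => mixing_dist mu (pred_rec mu Theta p w f0 x n)) =
    (fun n => mixing_dist mu (fun t => f0 t * tilts F0 kappa w x n t)).
  apply/funext => n; congr mixing_dist.
  exact: (pred_rec_tilts compact_Theta measurable_Theta Theta_t0 density_p
    continuous_p bounded_p b_ge1 density_f F_f f_Theta density_f0 F0_f0 f0_Theta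
    measurable_good good_ratio n w01 reg).
apply: (weakly_cvg_tilted compact_Theta measurable_Theta Theta_t0 density_p
  continuous_p bounded_p b_ge1 density_f F_f f_Theta density_f0 F0_f0 f0_Theta
  Q_m measurable_good good_null good_ratio identifiable_f) => //.
by move=> n; exact: (tilts_pos_density F0 measurable_kappa b_ge1 kappa_itv w01).
Qed.
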